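(* Let $I,J$ be disjoint index sets and let $K,K'$ be disjoint index sets. For each $k\in K$ let $C_k=(c_{i,j;k})_{i,j\in I\cup J}$ be a positive definite matrix with real entries. For each $N\in\mathbb{N}$, $k\in K$ and $l\in I\cup J$ let $Y_N^{l,k}=[x^{l,k}_{i,j;N}]_{i,j=1}^N$ be an $N\times N$ matrix with entries in $L^{\infty-}(\Omega,\mu)$, such that: (1) $E(x^{l,k}_{i,j;N})=0$ for all $1\le i,j\le N$, $l\in I\cup J$, $k\in K$; (2) $x^{l,k}_{j,i;N}=\overline{x^{l,k}_{i,j;N}}$ for all $1\le i,j\le N$, $l\in I\cup J$, $k\in K$; (3) for each $N$, $\{\{x^{l,k}_{i,j;N}:l\in I\cup J,\ k\in K\}:1\le i\le j\le N\}$ is an independent family of sets of random variables; (4) $E(x^{l_1,k}_{i,j;N}x^{l_2,k}_{j,i;N})=\frac1N c_{l_1,l_2;k}$ for all $1\le i,j\le N$, $l_1,l_2\in I\cup J$, $k\in K$, and $E(x^{l_1,k_1}_{i,j;N}x^{l_2,k_2}_{j,i;N})=0$ for all $1\le i,j\le N$, $l_1,l_2\in I\cup J$ and $k_1\neq k_2$ in $K$; (5) for every $m\in\mathbb{N}$ and all functions $\chi:\{1,\dots,m\}\to I\cup J$, $\epsilon:\{1,\dots,m\}\to K$ there exist a constant $M(\chi,\epsilon,m)>0$ and $N_0\in\mathbb{N}$ such that, whenever $N>N_0$, $$\sup_{1\le i\le j\le N}|E(x^{\chi(1),\epsilon(1)}_{\lambda(1),\tau(1);N}\cdots x^{\chi(m),\epsilon(m)}_{\lambda(m),\tau(m);N})|\le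 M(\chi,\epsilon,m)N^{-m/2},$$ where $(\lambda(l),\tau(l))=(i,j)$ or $(j,i)$ for $l=1,\dots,m$. For $k'\in K'$ and $N\in\mathbb{N}$ let $D_{k',N}=\mathrm{diag}(d^{k'}_{1,N},\dots,d^{k'}_{N,N})\in M_N(\mathbb{C})$ be constant diagonal matrices such that, as $N\to\infty$, the joint distribution of $\{D_{k',N}:k'\in K'\}$ (with respect to $\frac1N\mathrm{Tr}$) converges to that of a family $\{d_{k'}:k'\in K'\}$ of elements of a non-commutative probability space $(\mathcal{A},\varphi)$ with $\varphi$ tracial, and assume $$\sup_{1\le i\le N,\ N=1,2,\dots}|d^{k'}_{i,N}|=M(k')<\infty\quad\text{for all }k'\in K'.$$ Then the two-faced families $$\big((L(Y_N^{i,k}))_{i\in I},(R(Y_N^{j,k}))_{j\in J}\big),\quad \big(L(D_{k',N}),R(D_{k',N})\big),\qquad k\in K,\ k'\in K',$$ are asymptotically bi-free as $N\to\infty$, with respect to $\frac1N\mathrm{Tr}\circ E_{\mathcal{L}(\mathcal{X}_N)}$.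
   Context: **Positive definite.** A matrix $C$ indexed by $(I\cup J)\times(I\cup J)$ is called positive definite if it is Hermitian and $(c_{\chi(k),\chi(l)})_{k,l=1}^m\ge 0$ (positive semidefinite, possibly singular) for all $m\in\mathbb{N}$ and $\chi:\{1,\dots,m\}\to I\cup J$. **Bi-matrix model.** $(\Omega,\mu)$ is a probability space, $L^{\infty-}(\Omega,\mu)=\bigcap_{p\ge1}L^p(\Omega,\mu)$, and $E(f)=\int_\Omega f\,d\mu$. Let $\mathcal{X}=L^{\infty-}(\Omega,\mu)$; elements of $L^{\infty-}(\Omega,\mu)$ (including constants) act on $\mathcal{X}$ by multiplication. Let $\mathcal{X}_N=M_N(\mathcal{X})$ and let $\mathcal{L}(\mathcal{X}_N)$ be the algebra of linear operators on $\mathcal{X}_N$. For a matrix $[T_{i,j}]$ with entries in $L^{\infty-}(\Omega,\mu)$ define $L([T_{i,j}]),R([T_{i,j}])\in\mathcal{L}(\mathcal{X}_N)$ by $$L([T_{i,j}])[\eta_{i,j}]=\Big[\sum_{k=1}^N T_{i,k}\eta_{k,j}\Big],\qquad R([T_{i,j}])[\eta_{i,j}]=\Big[\sum_{k=1}^N T_{k,j}\eta_{i,k}\Big].$$ For $A\in\mathcal{L}(\mathcal{X}_N)$, $E_{\mathcal{L}(\mathcal{X}_N)}(A)\in M_N(\mathbb{C})$ is obtained by applying $E$ to each entry of $A(1_N)$, where $1_N=\mathrm{diag}(1,\dots,1)\in\mathcal{X}_N$. $\mathrm{Tr}$ is the unnormalized trace on $M_N(\mathbb{C})$. **Bi-free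 cumulants.** A non-commutative probability space $(\mathcal{A},\varphi)$ is a unital complex algebra with a unital linear functional. Convergence of joint distributions means convergence of all joint moments. For $\chi:\{1,\dots,n\}\to\{l,r\}$ with $\chi^{-1}(l)=\{i_1<\dots<i_p\}$ and $\chi^{-1}(r)=\{i_{p+1}>\dots>i_n\}$, let $s_\chi$ be the permutation $s_\chi(k)=i_k$. Let $NC(n)$ be the lattice of non-crossing partitions of $\{1,\dots,n\}$ with Möbius function $\mu_n$ and largest element $1_n$; for a partition $\pi$, $s_\chi\circ\pi$ is the partition with blocks $s_\chi(V)$, $V\in\pi$, and $BNC(n,\chi)=\{s_\chi\circ\pi:\pi\in NC(n)\}$. For a partition $\pi$ put $\varphi_\pi(a_1,\dots,a_n)=\prod_{V\in\pi}\varphi(a_{v_1}\cdots a_{v_k})$, where $V=\{v_1<\dots<v_k\}$. The bi-free cumulants are $$\kappa_\chi(a_1,\dots,a_n)=\sum_{\pi\in BNC(n,\chi)}\varphi_\pi(a_1,\dots,a_n)\,\mu_n(s_\chi^{-1}\circ\pi,1_n).$$ **(Asymptotic) bi-freeness.** A two-faced family consists of a family of left elements and a family of right elements; a pair $(a,b)$ is the two-faced family with the single left element $a$ and the single right element $b$. A collection of two-faced families in $(\mathcal{A},\varphi)$ is bi-free if and only if $\kappa_\chi(z_1,\dots,z_n)=0$ whenever $n\ge2$, each $z_m$ is a left element (if $\chi(m)=l$) or a right element (if $\chi(m)=r$) of one of the two-faced families in the collection, and $z_1,\dots,z_n$ are not all taken from the same two-faced family. A sequence (indexed by $N$) of collections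 of two-faced families in non-commutative probability spaces $(\mathcal{A}_N,\varphi_N)$, with fixed index sets, is asymptotically bi-free if all joint moments of the elements converge as $N\to\infty$ and the collection of two-faced families having the limiting joint distribution is bi-free.
   Formalization: All the diagonal matrices are grouped into one two-faced family ((L(D_{k',N}))_{k'}, (R(D_{k',N}))_{k'}) instead of a separate pair for each k'; with separate pairs the claim fails, e.g. for D_{1,N} = D_{2,N} = diag(1,-1,1,...). *)

(* Defs.v *)
From HB Require Import structures.
From mathcomp Require Import all_boot all_order all_algebra all_fingroup.

Set Implicit Arguments.
Unset Strict Implicit.
Unset Printing Implicit Defensive.

Import Order.TTheory GRing.Theory Num.Theory.

Local Open Scope ring_scope.

Section Mobius.
Variables (T : finType) (S : {set T}) (le : rel T).

(* mu(x, x) = 1 and mu(x, y) = - \sum_(x <= z < y) mu(x, z); the fuel #|S|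
   bounds the length of the chains of S, see mobius_sum. *)
Fixpoint mobius_rec (n : nat) (x y : T) : int :=
  if n is n'.+1 then
    if x == y then 1
    else - \sum_(z in S | [&& le x z, le z y & z != y]) mobius_rec n' x z
  else 0.

Definition mobius (x y : T) : int := mobius_rec #|S| x y.

Lemma mobius_recE n x y : {in S &, antisymmetric le} -> {in S & &, transitive le} ->
  x \in S -> y \in S ->
  (#|[set z in S | le z y && (z != y)]| < n)%N ->
  mobius_rec n x y = mobius x y.
Proof.
move=> asym tr xS.
have main : forall k m y, y \in S ->
    (#|[set z in S | le z y && (z != y)]| < k)%N ->
    (#|[set z in S | le z y && (z != y)]| < m)%N ->
    mobius_rec k x y = mobius_rec m x y.
  elim=> [|k IH] [|m] // {}y yS; rewrite !ltnS => hk hm /=.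
  case: eqP => // _; congr (- _); apply: eq_bigr => z /and4P[zS _ zy zNy].
  have lt : (#|[set t in S | le t z && (t != z)]|
             < #|[set t in S | le t y && (t != y)]|)%N.
    apply: proper_card; apply/properP; split.
      apply/subsetP => t; rewrite !inE => /and3P[tS tz tNz].
      rewrite tS (tr z t y) //=; apply: contraNneq tNz => ty.
      by apply/eqP/asym => //; rewrite tz ty zy.
    by exists z; rewrite !inE zS ?zy ?zNy // eqxx !andbF.
  by apply: IH => //; [exact: leq_trans lt hk | exact: leq_trans lt hm].
move=> yS hn; apply: main => //; apply: proper_card; apply/properP; split.
  by apply/subsetP => t; rewrite inE => /andP[].
by exists y; rewrite // inE eqxx !andbF.
Qed.

Lemma mobius_sum x y : {in S, reflexive le} -> {in S &, antisymmetric le} ->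
  {in S & &, transitive le} -> x \in S -> y \in S -> le x y ->
  \sum_(z in S | le x z && le z y) mobius x z = (x == y)%:R.
Proof.
move=> rfl asym tr xS yS lexy.
rewrite (bigD1 y) /=; last by rewrite yS lexy rfl.
case: eqP => [<-|xNy].
  rewrite big1 => [|z /andP[/and3P[zS xz zx] zNx]]; last first.
    by case/eqP: zNx; apply: asym => //; rewrite zx xz.
  have: (0 < #|S|)%N by apply/card_gt0P; exists x.
  by rewrite addr0 /mobius; case: #|S| => //= n; rewrite eqxx.
apply/eqP; rewrite addr_eq0; apply/eqP.
have yS1 : (#|[set z in S | le z y && (z != y)]| < #|S|)%N.
  apply: proper_card; apply/properP; split.
    by apply/subsetP => t; rewrite inE => /andP[].
  by exists y; rewrite // inE eqxx !andbF.
rewrite -(@mobius_recE (#|S|.+1)) ?(leq_trans yS1) //= ifN; last exact/eqP.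
by congr (- _); apply: eq_bigl => z; rewrite -!andbA.
Qed.

End Mobius.

Section Partitions.
Variable n : nat.
Implicit Types (p q : {set {set 'I_n}}) (V W : {set 'I_n}).

Definition noncrossing p : bool :=
  [forall V in p, forall W in p, (V != W) ==>
    ~~ [exists a : 'I_n, exists b : 'I_n, exists c : 'I_n, exists d : 'I_n,
          [&& (a < b)%N, (b < c)%N, (c < d)%N,
              a \in V, c \in V, b \in W & d \in W]]].

Definition NC : {set {set {set 'I_n}}} :=
  [set p | partition p [set: 'I_n] & noncrossing p].

Definition refines p q : bool :=
  [forall V in p, exists W in q, V \subset W].

Definition top_part : {set {set 'I_n}} := [set [set: 'I_n]].

Definition part_act (s : {perm 'I_n}) p : {set {set 'I_n}} :=
  [set s @: V | V : {set 'I_n} in p].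

(* chi i = true encodes chi(i) = l, and chi i = false encodes chi(i) = r. *)
Variable chi : 'I_n -> bool.

Definition schi_seq : seq 'I_n :=
  [seq i <- enum 'I_n | chi i] ++ rev [seq i <- enum 'I_n | ~~ chi i].

Lemma schi_inj : injective (fun k : 'I_n => nth k schi_seq k).
Proof.
have perm_s : perm_eq schi_seq (enum 'I_n).
  by apply: perm_trans (permEl (perm_filterC chi _)); rewrite perm_cat2l perm_rev.
have size_s : size schi_seq = n by rewrite (perm_size perm_s) size_enum_ord.
move=> j k; rewrite (set_nth_default j k) ?size_s // => /eqP.
rewrite nth_uniq ?size_s //; first by move/eqP/val_inj.
by rewrite (perm_uniq perm_s) enum_uniq.
Qed.

Definition schi : {perm 'I_n} := perm schi_inj.

Definition BNC : {set {set {set 'I_n}}} := [set part_act schi p | p in NC].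

End Partitions.

(* Imported only now: the finite-set notations above clash with those of
   classical sets. *)
From mathcomp Require Import complex.
From mathcomp Require Import all_classical all_reals all_analysis.
From mathcomp Require Import measurable_realfun.

Import numFieldNormedType.Exports.

Local Open Scope classical_set_scope.
Local Open Scope complex_scope.

Section PositiveDefinite.
Variable R : realType.
Local Notation C := R[i].

Definition possemidef m (A : 'M[C]_m) : Prop :=
  forall v : 'cV[C]_m, 0 <= ((map_mx conjc v)^T *m A *m v) 0 0.

Definition posdef (L : Type) (c : L -> L -> C) : Prop :=
  (forall i j, c j i = conjc (c i j)) /\
  (forall m (chi : 'I_m -> L), possemidef (\matrix_(k, l) c (chi k) (chi l))).

End PositiveDefinite.

Section NCProbability.
Variable R : realType.
Local Notation C := R[i].

Record ncps := NCPS {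
  ncps_alg :> algType C;
  ncps_state : {scalar ncps_alg};
  ncps_state1 : ncps_state 1 = 1 }.

Definition tracial (A : ncps) : Prop :=
  forall a b : A, ncps_state A (a * b) = ncps_state A (b * a).

Definition moment (A : ncps) (Z : Type) (z : Z -> A) (w : seq Z) : C :=
  ncps_state A (\prod_(i <- w) z i).

Definition cvg_joint_distr (Z : Type) (A_ : nat -> ncps)
    (z_ : forall N, Z -> A_ N) (A : ncps) (z : Z -> A) : Prop :=
  forall w : seq Z,
    (fun N => moment (z_ N) w : C^o) @ \oo --> (moment z w : C^o).

(* In \prod_(i in V) the indices i run through V in increasing order. *)
Definition state_part (A : ncps) n (p : {set {set 'I_n}}) (a : 'I_n -> A) : C :=
  \prod_(V in p) ncps_state A (\prod_(i in V) a i).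

Definition cumulant (A : ncps) n (chi : 'I_n -> bool) (a : 'I_n -> A) : C :=
  \sum_(p in BNC chi) state_part p a *
    (mobius (NC n) (@refines n) (part_act (schi chi)^-1%g p) (top_part n))%:~R.

Record two_faced (A : Type) (Lx Rx : Type) :=
  TwoFaced { lface : Lx -> A; rface : Rx -> A }.

Section Collection.
Variables (T : Type) (lx rx : T -> Type).

(* The index of one element of a collection of two-faced families, the family
   t having left elements indexed by lx t and right ones indexed by rx t. *)
Definition letter : Type := {t : T & (lx t + rx t)%type}.

Definition is_left_letter (z : letter) : bool :=
  if projT2 z is inl _ then true else false.

Definition element (A : Type) (c : forall t, two_faced A (lx t) (rx t))
    (z : letter) : A :=
  match projT2 z with
  | inl i => lface (c (projT1 z)) i
  | inr j => rface (c (projT1 z)) j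
  end.

Definition bifree (A : ncps) (c : forall t, two_faced A (lx t) (rx t)) : Prop :=
  forall n (z : 'I_n -> letter), (2 <= n)%N ->
    ~ (forall i j, projT1 (z i) = projT1 (z j)) ->
    cumulant (fun i => is_left_letter (z i)) (fun i => element c (z i)) = 0.

Definition asymptotically_bifree (A_ : nat -> ncps)
    (c_ : forall N t, two_faced (A_ N) (lx t) (rx t)) : Prop :=
  exists (A : ncps) (c : forall t, two_faced A (lx t) (rx t)),
    cvg_joint_distr (fun N => element (c_ N)) (element c) /\ bifree c.

End Collection.
End NCProbability.

Section Independence.
Context (d : measure_display) (T : measurableType d) (R : realType).
Variable P : probability T R.

Definition generated_sigma (F : set (T -> R[i])) : set (set T) :=
  <<s [set A | exists f B, [/\ F f, measurable B &
         A = (fun t => complex.Re (f t)) @^-1` B \/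
         A = (fun t => complex.Im (f t)) @^-1` B]] >>.

Definition independent_sets (I : finType) (F : I -> set (T -> R[i])) : Prop :=
  forall (S : {set I}) (A : I -> set T),
    (forall i, i \in S -> generated_sigma (F i) (A i)) ->
    P (\bigcap_(i in [set` S]) A i) = (\prod_(i in S) P (A i))%E.

End Independence.

Section Linfty.
Context (d : measure_display) (T : measurableType d) (R : realType).
Variable P : probability T R.
Local Notation C := R[i].

Definition cmod (f : T -> C) (t : T) : R := complex.Re `|f t|.

Definition in_Linfty (f : T -> C) : Prop :=
  [/\ measurable_fun setT (fun t => complex.Re (f t)),
      measurable_fun setT (fun t => complex.Im (f t)) &
      forall p : R, 1 <= p -> cmod f \in Lfun P p%:E].

Definition Linfty_pred : {pred T -> C} := mem [set f | in_Linfty f].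

Lemma Linfty_predP (f : T -> C) : reflect (in_Linfty f) (f \in Linfty_pred).
Proof. by apply: (iffP idP); rewrite inE. Qed.

Lemma cmod_ge0 f t : 0 <= cmod f t.
Proof. by rewrite /cmod normc_def /= sqrtr_ge0. Qed.

Lemma cmodE f t : (cmod f t)%:C = `|f t|.
Proof. by rewrite /cmod normc_def. Qed.

Lemma measurable_cmod (f : T -> C) :
  measurable_fun setT (fun t => complex.Re (f t)) ->
  measurable_fun setT (fun t => complex.Im (f t)) ->
  measurable_fun setT (cmod f).
Proof.
move=> mr mi.
have -> : cmod f =
    fun t => (complex.Re (f t) ^+ 2 + complex.Im (f t) ^+ 2) `^ 2^-1.
  apply/funext => t; rewrite /cmod normc_def /= powR12_sqrt //.
  by rewrite addr_ge0 ?sqr_ge0.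
apply: (@measurableT_comp _ _ _ _ _ _ (@powR R ^~ 2^-1)) => //.
by apply: measurable_funD; apply: measurable_funX.
Qed.

Lemma Lfun_powP (u : T -> R) (p : R) : 1 <= p -> measurable_fun setT u ->
  P.-integrable setT (fun t => (`|u t| `^ p)%:E) -> u \in Lfun P p%:E.
Proof.
move=> p1 mu /integrableP[_ iu]; rewrite inE; apply/andP; split.
  by rewrite inE.
rewrite inE /finite_norm unlock /=; apply: poweR_lty.
apply: le_lt_trans iu.
by under [leRHS]eq_integral do rewrite gee0_abs ?lee_fin ?powR_ge0//.
Qed.

Lemma Lfun_le (u v : T -> R) (p : R) : 1 <= p -> measurable_fun setT u ->
  (forall t, `|u t| <= `|v t|) -> v \in Lfun P p%:E -> u \in Lfun P p%:E.
Proof.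
move=> p1 mu uv /(Lfun_integrable p1) iv; apply: Lfun_powP => //.
apply: le_integrable iv => //.
  apply/measurable_EFinP; apply: (measurableT_comp (measurable_powR _)).
  exact: measurableT_comp.
move=> t _ /=; rewrite lee_fin 2?(ger0_norm (powR_ge0 _ _)).
have p0 : 0 <= p by exact: le_trans p1.
by rewrite ge0_ler_powR ?nnegrE.
Qed.

Lemma Lfun_mulP (u v : T -> R) (p : R) : 1 <= p ->
  u \in Lfun P (2 * p)%:E -> v \in Lfun P (2 * p)%:E -> u \* v \in Lfun P p%:E.
Proof.
move=> p1 hu hv.
have p2 : 1 <= 2 * p by rewrite mulr_natl mulr2n (le_trans p1)// lerDl (le_trans _ p1).
have [mu mv] : measurable_fun setT u /\ measurable_fun setT v.
  by move: hu hv => /andP[+ _] /andP[+ _]; rewrite !inE.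
have pow2 w : w \in Lfun P (2 * p)%:E -> measurable_fun setT w ->
    (fun t => `|w t| `^ p) \in Lfun P 2%:E.
  move=> /(Lfun_integrable p2) iw mw; apply: Lfun_powP.
  - by rewrite ler1n.
  - apply: (measurableT_comp (measurable_powR _)); exact: measurableT_comp.
  - apply: eq_integrable iw => // t _.
    by rewrite (ger0_norm (powR_ge0 _ _)) -powRrM mulrC.
have := Lfun2_mul_Lfun1 (pow2 _ hu mu) (pow2 _ hv mv).
move=> /Lfun1_integrable iuv; apply: Lfun_powP => //.
  exact: measurable_funM.
by apply: eq_integrable iuv => // t _ /=; rewrite normrM powRM.
Qed.

Lemma in_LinftyD f g : in_Linfty f -> in_Linfty g -> in_Linfty (f + g).
Proof.
move=> [rf If hf] [rg ig hg].
have mr : measurable_fun setT (fun t => complex.Re ((f + g) t)).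
  under [X in measurable_fun _ X]funext do rewrite /GRing.add /= raddfD.
  exact: measurable_funD.
have mi : measurable_fun setT (fun t => complex.Im ((f + g) t)).
  under [X in measurable_fun _ X]funext do rewrite /GRing.add /= raddfD.
  exact: measurable_funD.
split=> // p p1.
apply: (@Lfun_le _ (cmod f \+ cmod g)) => //; first exact: measurable_cmod.
  move=> t; rewrite !ger0_norm ?addr_ge0 ?cmod_ge0//.
  by rewrite -lecR [(_ + _)%:C]rmorphD /= !cmodE ler_normD.
have p1' : (1 <= p%:E)%E by rewrite lee_fin.
by have [_] := Lfun_addr_closed P p1'; apply; [exact: hf|exact: hg].
Qed.

Lemma in_LinftyM f g : in_Linfty f -> in_Linfty g -> in_Linfty (f * g).
Proof.
move=> [rf If hf] [rg ig hg].
have mr : measurable_fun setT (fun t => complex.Re ((f * g) t)).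
  have -> : (fun t => complex.Re ((f * g) t)) = fun t =>
      complex.Re (f t) * complex.Re (g t) - complex.Im (f t) * complex.Im (g t).
    by apply/funext => t; rewrite /GRing.mul/=; case: (f t) (g t) => ? ? [].
  by apply: measurable_funB; apply: measurable_funM.
have mi : measurable_fun setT (fun t => complex.Im ((f * g) t)).
  have -> : (fun t => complex.Im ((f * g) t)) = fun t =>
      complex.Re (f t) * complex.Im (g t) + complex.Im (f t) * complex.Re (g t).
    by apply/funext => t; rewrite /GRing.mul/=; case: (f t) (g t) => ? ? [].
  by apply: measurable_funD; apply: measurable_funM.
split=> // p p1.
have p2 : 1 <= 2 * p by rewrite mulr_natl mulr2n (le_trans p1)// lerDl (le_trans _ p1).
have -> : cmod (f * g) = cmod f \* cmod g.
  apply/funext => t /=; apply: (@complexI R).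
  by rewrite rmorphM /= !cmodE [(f * g) t]/(f t * g t) normrM.
by apply: Lfun_mulP => //; [exact: hf | exact: hg].
Qed.

Lemma in_Linfty_cst (c : C) : in_Linfty (cst c).
Proof.
split=> [||p p1]; [exact: measurable_cst..|].
exact: Lfun_cst.
Qed.

Lemma Linfty_subring_closed : subring_closed Linfty_pred.
Proof.
have hN f : in_Linfty f -> in_Linfty (- f).
  by rewrite -mulN1r; apply: in_LinftyM; exact: (in_Linfty_cst (-1)).
split; first exact/Linfty_predP/in_Linfty_cst.
  by move=> f g /Linfty_predP hf /Linfty_predP hg; apply/Linfty_predP/in_LinftyD => //; exact: hN.
by move=> f g /Linfty_predP hf /Linfty_predP hg; apply/Linfty_predP/in_LinftyM.
Qed.

HB.instance Definition _ :=
  GRing.isSubringClosed.Build (T -> C) Linfty_pred Linfty_subring_closed.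

Lemma Linfty_scaler_closed : GRing.scaler_closed Linfty_pred.
Proof.
move=> c f /Linfty_predP hf; apply/Linfty_predP.
have -> : c *: f = cst c * f by apply/funext.
by apply: in_LinftyM => //; exact: in_Linfty_cst.
Qed.

HB.instance Definition _ :=
  GRing.isScaleClosed.Build C (T -> C) Linfty_pred Linfty_scaler_closed.

(* Functions, rather than classes of functions modulo a.e. equality. *)
Record Linfty := MkLinfty {
  Linfty_fun :> T -> C;
  Linfty_funP : Linfty_fun \in Linfty_pred }.

HB.instance Definition _ := [isSub of Linfty for Linfty_fun].
HB.instance Definition _ := [Choice of Linfty by <:].
HB.instance Definition _ := GRing.SubChoice_isSubComPzRing.Build
  (T -> C) Linfty_pred Linfty Linfty_subring_closed.
HB.instance Definition _ := [SubZmodule_isSubLmodule of Linfty by <:].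

Definition Ex (f : Linfty) : C :=
  (\int[P]_t complex.Re (f t)) +i* (\int[P]_t complex.Im (f t)).

Lemma Linfty_integrable (f : Linfty) :
  P.-integrable setT (EFin \o (fun t => complex.Re (f t))) /\
  P.-integrable setT (EFin \o (fun t => complex.Im (f t))).
Proof.
have [mr mi /(_ 1 (lexx _)) L1] := Linfty_predP _ (Linfty_funP f).
split; apply/Lfun1_integrable; apply: Lfun_le L1 => // t;
  rewrite (ger0_norm (cmod_ge0 _ _)) -lecR cmodE; first exact: normc_ge_Re.
by rewrite normc_def lecR -sqrtr_sqr ler_wsqrtr// lerDr sqr_ge0.
Qed.

Lemma Ex_is_scalar : scalar Ex.
Proof.
move=> c f g; have [fr fi] := Linfty_integrable f.
have [gr gi] := Linfty_integrable g.
case: c => a b; rewrite /Ex.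
have rZ (h : T -> R) k : P.-integrable setT (EFin \o h) ->
    P.-integrable setT (EFin \o (fun t => k * h t)).
  by move=> hi; apply: eq_integrable (integrableZl _ k hi).
have rB (h k : T -> R) : P.-integrable setT (EFin \o h) ->
    P.-integrable setT (EFin \o k) ->
    P.-integrable setT (EFin \o (fun t => h t - k t)).
  by move=> hi ki; apply: eq_integrable (integrableB _ hi ki).
have rD (h k : T -> R) : P.-integrable setT (EFin \o h) ->
    P.-integrable setT (EFin \o k) ->
    P.-integrable setT (EFin \o (fun t => h t + k t)).
  by move=> hi ki; apply: eq_integrable (integrableD _ hi ki).
have -> : (fun t => complex.Re (((a +i* b) *: f + g) t)) = fun t =>
    a * complex.Re (f t) - b * complex.Im (f t) + complex.Re (g t).
  apply/funext => t; change (((a +i* b) *: f + g) t) with ((a +i* b) * f t + g t).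
  by case: (f t) (g t) => ? ? [].
have -> : (fun t => complex.Im (((a +i* b) *: f + g) t)) = fun t =>
    a * complex.Im (f t) + b * complex.Re (f t) + complex.Im (g t).
  apply/funext => t; change (((a +i* b) *: f + g) t) with ((a +i* b) * f t + g t).
  by case: (f t) (g t) => ? ? [].
have s1 := rB _ _ (rZ _ a fr) (rZ _ b fi).
have s2 := rD _ _ (rZ _ a fi) (rZ _ b fr).
rewrite (RintegralD measurableT s1 gr) (RintegralD measurableT s2 gi).
rewrite (RintegralB measurableT (rZ _ a fr) (rZ _ b fi)).
rewrite (RintegralD measurableT (rZ _ a fi) (rZ _ b fr)).
by rewrite !RintegralZl.
Qed.

HB.instance Definition _ := GRing.isLinear.Build C Linfty C _ Ex Ex_is_scalar.

End Linfty.

Section LinearOperators.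
Variables (R : realType) (V : lmodType R[i]).

Definition linop_pred : {pred V -> V} := mem [set f : V -> V | linear f].

Lemma linop_predP (f : V -> V) : reflect (linear f) (f \in linop_pred).
Proof. by apply: (iffP idP); rewrite inE. Qed.

Lemma linop_submod_closed : submod_closed linop_pred.
Proof.
split; first by apply/linop_predP => c u v; rewrite /= scaler0 addr0.
move=> c f g /linop_predP hf /linop_predP hg; apply/linop_predP => a u v.
change (c *: f (a *: u + v) + g (a *: u + v) =
        a *: (c *: f u + g u) + (c *: f v + g v)).
by rewrite hf hg !scalerDr addrACA !scalerA (mulrC c).
Qed.

HB.instance Definition _ :=
  GRing.isSubmodClosed.Build R[i] (V -> V) linop_pred linop_submod_closed.

Record linop := MkLinop { linop_fun :> V -> V; linop_funP : linop_fun \in linop_pred }.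

HB.instance Definition _ := [isSub of linop for linop_fun].
HB.instance Definition _ := [Choice of linop by <:].
HB.instance Definition _ := [SubChoice_isSubLmodule of linop by <:].

Definition linop_one : linop :=
  MkLinop (introT (linop_predP id) (fun c u v => erefl)).

Lemma linop_mul_subproof (f g : linop) : f \o g \in linop_pred.
Proof.
apply/linop_predP => c u v /=.
by rewrite (linop_predP _ (linop_funP g)) (linop_predP _ (linop_funP f)).
Qed.

Definition linop_mul (f g : linop) : linop := MkLinop (linop_mul_subproof f g).

Lemma linop_eqP (f g : linop) : (forall v, f v = g v) -> f = g.
Proof. by move=> fg; apply/val_inj/funext. Qed.

Lemma linop_mulA : associative linop_mul. Proof. by move=> *; exact: linop_eqP. Qed.
Lemma linop_mul1 : left_id linop_one linop_mul. Proof. by move=> *; exact: linop_eqP. Qed.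
Lemma linop_1mul : right_id linop_one linop_mul. Proof. by move=> *; exact: linop_eqP. Qed.
Lemma linop_mulDl : left_distributive linop_mul +%R.
Proof. by move=> *; exact: linop_eqP. Qed.
Lemma linop_mulDr : right_distributive linop_mul +%R.
Proof.
move=> f g h; apply: linop_eqP => v /=.
have := linop_predP _ (linop_funP f) 1 (g v) (h v).
by rewrite !scale1r.
Qed.

HB.instance Definition _ := GRing.Zmodule_isPzRing.Build linop
  linop_mulA linop_mul1 linop_1mul linop_mulDl linop_mulDr.

Lemma linop_scaleAl (c : R[i]) (f g : linop) : c *: (f * g) = c *: f * g.
Proof. exact: linop_eqP. Qed.

Lemma linop_scaleAr (c : R[i]) (f g : linop) : c *: (f * g) = f * (c *: g).
Proof.
apply: linop_eqP => v; have fl := linop_predP _ (linop_funP f).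
have f0 : f 0 = 0 by have := fl (-1) 0 0; rewrite scaler0 addr0 scaleN1r addNr.
by have := fl c (g v) 0; rewrite !addr0 f0 addr0 => /esym.
Qed.

End LinearOperators.

Section BiMatrixModel.
Context (d : measure_display) (T : measurableType d) (R : realType).
Variable P : probability T R.
Local Notation C := R[i].
Local Notation L := (Linfty P).

Definition const_Linfty (c : C) : L :=
  MkLinfty (introT (Linfty_predP P _) (in_Linfty_cst P c)).

(* An alias, because 'M[L]_N is canonically a module over L and not over C. *)
Definition Xmat (N : nat) := 'M[L]_N.

Section Xmat.
Variable N : nat.

HB.instance Definition _ := GRing.Zmodule.on (Xmat N).

Definition Xmat_scale (c : C) (eta : Xmat N) : Xmat N := map_mx ( *:%R c) eta.

Lemma Xmat_scaleA a b v : Xmat_scale a (Xmat_scale b v) = Xmat_scale (a * b) v.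
Proof. by apply/matrixP => i j; rewrite !mxE scalerA. Qed.
Lemma Xmat_scale1 : left_id 1 Xmat_scale.
Proof. by move=> v; apply/matrixP => i j; rewrite !mxE scale1r. Qed.
Lemma Xmat_scaleDr : right_distributive Xmat_scale +%R.
Proof. by move=> a u v; apply/matrixP => i j; rewrite !mxE scalerDr. Qed.
Lemma Xmat_scaleDl v : {morph Xmat_scale^~ v : a b / a + b}.
Proof. by move=> a b; apply/matrixP => i j; rewrite !mxE scalerDl. Qed.

HB.instance Definition _ := GRing.Zmodule_isLmodule.Build C (Xmat N)
  Xmat_scaleA Xmat_scale1 Xmat_scaleDr Xmat_scaleDl.

Definition Lfn (A : 'M[L]_N) (eta : Xmat N) : Xmat N :=
  \matrix_(i, j) \sum_k A i k * eta k j.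

Definition Rfn (A : 'M[L]_N) (eta : Xmat N) : Xmat N :=
  \matrix_(i, j) \sum_k A k j * eta i k.

Lemma LinftyZAl (c : C) (f g : L) : c *: (f * g) = (c *: f) * g.
Proof. by apply/val_inj/funext => t; exact: mulrA. Qed.

Lemma LinftyZAr (c : C) (f g : L) : f * (c *: g) = c *: (f * g).
Proof. by rewrite mulrC -LinftyZAl mulrC. Qed.

Lemma Lfn_linear A : Lfn A \in @linop_pred R (Xmat N).
Proof.
apply/linop_predP => c u v; apply/matrixP => i j; rewrite !mxE.
rewrite scaler_sumr -big_split; apply: eq_bigr => k _ /=.
by rewrite !mxE mulrDr LinftyZAr.
Qed.

Lemma Rfn_linear A : Rfn A \in @linop_pred R (Xmat N).
Proof.
apply/linop_predP => c u v; apply/matrixP => i j; rewrite !mxE.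
rewrite scaler_sumr -big_split; apply: eq_bigr => k _ /=.
by rewrite !mxE mulrDr LinftyZAr.
Qed.

End Xmat.

(* From here on the index N : nat stands for matrices of size N.+1, so that
   sequences indexed by nat range over the sizes 1, 2, ... *)
Definition LX (N : nat) : Type := linop (Xmat N.+1).

Section LX.
Variable N : nat.

HB.instance Definition _ := GRing.PzRing.on (LX N).
HB.instance Definition _ := GRing.Lmodule.on (LX N).

Definition Lop (A : 'M[L]_N.+1) : LX N := MkLinop (Lfn_linear A).
Definition Rop (A : 'M[L]_N.+1) : LX N := MkLinop (Rfn_linear A).

Definition ELX (A : LX N) : 'M[C]_N.+1 :=
  map_mx (@Ex d T R P) ((A : linop (Xmat N.+1)) (1%:M : 'M[L]_N.+1)).

Definition trE (A : LX N) : C := (N.+1%:R)^-1 * \tr (ELX A).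

Lemma Ex1 : Ex (1 : L) = 1.
Proof.
rewrite /Ex.
have -> : (fun t => complex.Re ((1 : L) t)) = cst 1 by apply/funext.
have -> : (fun t => complex.Im ((1 : L) t)) = cst 0 by apply/funext.
by rewrite !Rintegral_cst //= probability_setT /= mul0r mul1r.
Qed.

Lemma trE1 : trE 1 = 1.
Proof.
rewrite /trE /ELX /= /mxtrace.
under eq_bigr do rewrite !mxE eqxx Ex1.
by rewrite sumr_const card_ord mulVf // pnatr_eq0.
Qed.

Lemma trE_is_scalar : scalar trE.
Proof.
move=> c A B; rewrite /trE mulrCA -mulrDr; congr (_ * _).
rewrite /mxtrace mulr_sumr -big_split; apply: eq_bigr => i _ /=.
by rewrite !mxE -linearP; congr (Ex _); rewrite /= !mxE.
Qed.

Lemma LX_neq0 : (1 : LX N) != 0.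
Proof.
apply/eqP => h; have := trE1; rewrite h.
have := trE_is_scalar (-1) 0 0; rewrite scaler0 addr0 mulN1r addNr => ->.
by move/esym/eqP; rewrite oner_eq0.
Qed.

HB.instance Definition _ := GRing.PzSemiRing_isNonZero.Build (LX N) LX_neq0.
HB.instance Definition _ :=
  GRing.LSemiModule_isLSemiAlgebra.Build C (LX N) (@linop_scaleAl R (Xmat N.+1)).
HB.instance Definition _ :=
  GRing.LSemiAlgebra_isSemiAlgebra.Build C (LX N) (@linop_scaleAr R (Xmat N.+1)).
HB.instance Definition _ := GRing.isLinear.Build C (LX N) C _ trE trE_is_scalar.

Definition LXspace : ncps R := NCPS (ncps_alg := LX N) (ncps_state := trE) trE1.

Definition ntr (A : 'M[C]_N.+1) : C := (N.+1%:R)^-1 * \tr A.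

Lemma ntr1 : ntr 1 = 1.
Proof. by rewrite /ntr mxtrace1 mulVf // pnatr_eq0. Qed.

Lemma ntr_is_scalar : scalar ntr.
Proof. by move=> c A B; rewrite /ntr linearP mulrDr mulrCA. Qed.

HB.instance Definition _ :=
  GRing.isLinear.Build C 'M[C]_N.+1 C _ ntr ntr_is_scalar.

Definition MXspace : ncps R :=
  NCPS (ncps_alg := 'M[C]_N.+1) (ncps_state := ntr) ntr1.

End LX.

Variables I J K K' : Type.

(* The index t = Some k denotes the family of the matrices Y^{l,k}; the index
   t = None denotes the single two-faced family of all the matrices D_{k'}.
   The joint limit law of the D_{k'} being arbitrary, distinct D_{k'} are in
   general not (bi-)free from each other. *)
Definition left_index (t : option K) : Type := if t is Some _ then I else K'.
Definition right_index (t : option K) : Type := if t is Some _ then J else K'.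

Definition bimatrix_families (N : nat)
    (Y : K -> I + J -> 'M[L]_N.+1) (D : K' -> 'M[C]_N.+1) (t : option K) :
    two_faced (LXspace N) (left_index t) (right_index t) :=
  match t with
  | Some k => TwoFaced (A := LXspace N) (Lx := left_index (Some k))
      (Rx := right_index (Some k))
      (fun i : I => Lop (Y k (inl i))) (fun j : J => Rop (Y k (inr j)))
  | None => TwoFaced (A := LXspace N) (Lx := left_index None)
      (Rx := right_index None)
      (fun k' : K' => Lop (map_mx const_Linfty (D k')))
      (fun k' : K' => Rop (map_mx const_Linfty (D k')))
  end.

End BiMatrixModel.

(* Main.v *)
From HB Require Import structures.
Require Import Defs.
From mathcomp Require Import all_boot all_order all_algebra all_fingroup.
From mathcomp Require Import zify lra ring.
From mathcomp Require Import complex reals.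
Set Implicit Arguments.
Unset Strict Implicit.
Unset Printing Implicit Defensive.
Import Order.TTheory GRing.Theory Num.Theory.
Local Open Scope ring_scope.
Local Open Scope complex_scope.

(* L(T) and R(T) multiply a matrix of commuting random variables by T on the left
   and on the right, so a mixed moment of left and right operators is the
   ordinary trace moment of the word permuted by s_chi, and its bi-free cumulant
   is the free cumulant of the permuted word.  It remains to show that the Y's and
   D's are asymptotically free: the limit moments are sums over noncrossing
   partitions of products of weights that vanish on mixed blocks, and Moebius
   inversion identifies these weights with the cumulants.

   The expected trace of a word is a sum over closed walks in {0..N}.  Call a
   vertex a leaf if it is visited once and is not the start.  A walk without
   leaves has at most (m+1)/2 vertices for m steps, so those walks contribute
   O(N^(-1/2)); the two steps at a leaf are independent of the rest, so removing
   leaves shows that the other walks contribute as in a sum over pairings of the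
   steps.  For a fixed pairing, contracting adjacent pairs gives the same
   recursion for the trace as for the noncrossing sum; when no adjacent pair is
   left the noncrossing sum is empty, and the trace is small because its walks
   have no leaves. *)

(** * Noncrossing partitions and Moebius inversion *)

(** Words are treated one at a time: for a fixed word of length n, moments and cumulants are
    functions of sets of positions in ['I_n], and a limit space is built only at the end, from the
    limits of all words. Trace and noncrossing sum are both split by the pairing of the random
    positions ([Wsum], [NCsum_at]), because only these pieces satisfy a common recursion. With r the
    square root of the size, the estimates all have the shape r^-m r^(m+1): m random letters have an
    expectation of order r^-m, at most (m+1)/2 vertices leave of the order of r^(m+1) walks, and the
    normalization r^-2 of the trace makes the product of order 1/r. The joint law of the D's is
    arbitrary, so their limit cumulants are recovered from their limit moments by inverting the
    moment-cumulant formula ([NCsum_inversion]). *)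

Section SetPartitions.
Variable X : finType.
Implicit Types (p q : {set {set X}}) (U V W B : {set X}).

Lemma partition_restrict p V U : partition p V -> U \subset V ->
  (forall B, B \in p -> (B \subset U) || [disjoint B & U]) ->
  partition [set B in p | B \subset U] U.
Proof.
move=> pV UV pU; apply/and3P; split.
- rewrite eqEsubset; apply/andP; split.
    by apply/bigcupsP => B; rewrite inE => /andP[].
  apply/subsetP => x xU; have xV := subsetP UV _ xU.
  rewrite -(cover_partition pV) in xV; have /bigcupP[B Bp xB] := xV.
  apply/bigcupP; exists B => //; rewrite inE Bp /=.
  by have /orP[//|/pred0P/(_ x)] := pU _ Bp; rewrite /= xB xU.
- by apply: trivIsetS (partition_trivIset pV); apply/subsetP => B; rewrite inE => /andP[].
- by rewrite inE (partition0 pV).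
Qed.

Lemma partition_bigcup (J : finType) (W : J -> {set X}) (f : J -> {set {set X}}) :
  (forall i j, i != j -> [disjoint W i & W j]) ->
  (forall j, partition (f j) (W j)) ->
  partition (\bigcup_j f j) (\bigcup_j W j).
Proof.
move=> dW fW; apply/and3P; split.
- rewrite eqEsubset; apply/andP; split.
    apply/bigcupsP => B /bigcupP[j _ Bj]; apply: subset_trans (bigcup_sup j _) => //.
    exact: partitionS (fW j) Bj.
  apply/bigcupsP => j _; rewrite -(cover_partition (fW j)).
  by apply/bigcupsP => B Bj; apply: bigcup_sup; apply/bigcupP; exists j.
- apply/trivIsetP => B1 B2 /bigcupP[i _ B1i] /bigcupP[j _ B2j] neq.
  case: (eqVneq i j) => [eij|nij].
    by apply: (trivIsetP (partition_trivIset (fW i))); rewrite ?eij in B1i *.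
  have s1 := partitionS (fW i) B1i; have s2 := partitionS (fW j) B2j.
  exact: disjointW s1 s2 (dW _ _ nij).
- by apply/bigcupP => -[j _]; rewrite (partition0 (fW j)).
Qed.

Lemma restrict_bigcup (J : finType) (W : J -> {set X}) (f : J -> {set {set X}}) j :
  (forall i j, i != j -> [disjoint W i & W j]) ->
  (forall j, partition (f j) (W j)) ->
  [set B in \bigcup_j f j | B \subset W j] = f j.
Proof.
move=> dW fW; apply/setP => B; rewrite inE; apply/andP/idP => [[/bigcupP[i _ Bi] BW]|Bj].
  case: (eqVneq i j) Bi => [->//|nij] Bi.
  have := disjointW (partitionS (fW i) Bi) BW (dW _ _ nij).
  by rewrite -setI_eq0 setIid (negbTE (partition_neq0 (fW i) Bi)).
by split; [apply/bigcupP; exists j | exact: partitionS (fW j) Bj].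
Qed.

(** Distributivity: choosing one partition for each [W j] amounts to choosing a partition of the
    union whose blocks each lie in some [W j], and restriction recovers the choices. Some [W j] may
    be empty, so a set of blocks can be treated as a family indexed by all sets; the predicates
    [Q j] carry a noncrossing condition or prescribe a block. *)
Lemma partition_distr (F : comPzRingType) (kap : {set X} -> F) (J : finType)
    (W : J -> {set X}) (Q : J -> pred {set {set X}}) :
  (forall i j, i != j -> [disjoint W i & W j]) ->
  \prod_j \sum_(p | partition p (W j) && Q j p) \prod_(B in p) kap B =
  \sum_(p | [&& partition p (\bigcup_j W j),
              [forall B in p, exists j, B \subset W j] &
              [forall j, Q j [set B in p | B \subset W j]]])
    \prod_(B in p) kap B.
Proof.
move=> dW; rewrite bigA_distr_big_dep /=.
pose h (f : {ffun J -> {set {set X}}}) := \bigcup_j f j.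
pose h' p : {ffun J -> {set {set X}}} := [ffun j => [set B in p | B \subset W j]].
symmetry; rewrite (reindex_onto h h'); last first.
  move=> p /and3P[pW /forallP pj _]; apply/setP => B.
  apply/bigcupP/idP => [[j _]|Bp]; first by rewrite ffunE inE => /andP[].
  have /existsP[j Bj] := implyP (pj B) Bp.
  by exists j => //; rewrite ffunE inE Bp.
apply: eq_big => [f|f /andP[/and3P[pf _ _] /eqP hf]].
  apply/andP/familyP => [[/and3P[pf /forallP fj /forallP fQ] /eqP hf] j|fP].
    have fjE : f j = [set B in h f | B \subset W j] by rewrite -{1}hf ffunE.
    rewrite unfold_in /= fjE fQ andbT; apply: partition_restrict pf _ _; first exact: bigcup_sup.
    move=> B Bf; have /existsP[i Bi] := implyP (fj B) Bf.
    case: (eqVneq i j) => [<-|nij]; first by rewrite Bi.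
    by rewrite (disjointWl Bi (dW _ _ nij)) orbT.
  have fW j : partition (f j) (W j) by have := fP j; rewrite unfold_in => /andP[].
  have hj j : [set B in h f | B \subset W j] = f j by apply: restrict_bigcup.
  split; last by apply/eqP/ffunP => j; rewrite ffunE hj.
  apply/and3P; split; first exact: partition_bigcup.
    apply/forallP => B; apply/implyP => /bigcupP[j _ Bj]; apply/existsP.
    by exists j; apply: partitionS Bj.
  by apply/forallP => j; rewrite hj; have := fP j; rewrite unfold_in => /andP[].
rewrite /h partition_disjoint_bigcup // => i j nij.
rewrite -setI_eq0; apply/eqP/setP => B; rewrite !inE; apply/negbTE.
apply/negP => /andP[]; rewrite -hf !ffunE !inE => /andP[Bf Bi] /andP[_ Bj].
have := disjointW Bi Bj (dW _ _ nij).
by rewrite -setI_eq0 setIid (negbTE (partition_neq0 pf Bf)).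
Qed.

End SetPartitions.

Section NoncrossingSums.
Variable n : nat.
Local Notation X := 'I_n.
Implicit Types (p q pi : {set {set X}}) (U V W B D : {set X}).

Lemma noncrossingP p :
  reflect (forall V W (a b c d : X), V \in p -> W \in p ->
             (a < b < c)%N -> (c < d)%N ->
             a \in V -> c \in V -> b \in W -> d \in W -> V = W)
          (noncrossing p).
Proof.
apply: (iffP forallP) => [h V W a b c d Vp Wp /andP[ab bc] cd aV cV bW dW|h V].
  have /forallP/(_ W)/implyP/(_ Wp) := implyP (h V) Vp.
  case: eqVneq => //= _ /existsP[]; exists a.
  apply/existsP; exists b; apply/existsP; exists c; apply/existsP; exists d.
  by rewrite ab bc cd aV cV bW dW.
apply/implyP => Vp; apply/forallP => W; apply/implyP => Wp; apply/implyP.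
apply: contra_neqN => /existsP[a /existsP[b /existsP[c /existsP[d]]]].
case/and5P=> ab bc cd aV /and3P[cV bW dW].
by apply: (h V W a b c d) => //; rewrite ab bc.
Qed.

Lemma noncrossingS p q : p \subset q -> noncrossing q -> noncrossing p.
Proof.
move=> /subsetP pq /noncrossingP ncq; apply/noncrossingP => V W a b c d Vp Wp.
by apply: ncq; apply: pq.
Qed.

Variable F : comPzRingType.
Implicit Types (kap : {set X} -> F).

(** The free moment-cumulant formula for the subword at the positions [V], when [kap B] is the free
    cumulant of the letters at [B]. *)
Definition NCsum kap V : F :=
  \sum_(p | partition p V && noncrossing p) \prod_(B in p) kap B.

Lemma NCsum0 kap : NCsum kap set0 = 1.
Proof.
rewrite /NCsum (big_pred1 set0) ?big_set0 // => p /=.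
rewrite partition_set0; case: eqP => // ->.
by apply/noncrossingP => V W a b c d; rewrite inE.
Qed.

(** Two crossing blocks of a refinement of [q] lie in blocks of [q] that cross or coincide. Since
    [q] is noncrossing they coincide, so a refinement is noncrossing as soon as it is so inside each
    block of [q]. *)
Lemma prod_NCsum kap q V : partition q V -> noncrossing q ->
  \prod_(W in q) NCsum kap W =
  \sum_(p | [&& partition p V, noncrossing p & refines p q])
    \prod_(B in p) kap B.
Proof.
move=> qV ncq; pose W B := if B \in q then B else set0.
rewrite big_mkcond /=.
transitivity (\prod_B \sum_(p | partition p (W B) && noncrossing p)
                \prod_(B in p) kap B).
  by apply: eq_bigr => B _; rewrite /W -/(NCsum _ _); case: ifP; rewrite ?NCsum0.
rewrite (partition_distr kap (fun _ : {set X} => @noncrossing n)); last first.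
  move=> i j nij; rewrite /W; case: ifP => iq; last by rewrite -setI_eq0 set0I.
  case: ifP => jq; last by rewrite -setI_eq0 setI0.
  exact: (trivIsetP (partition_trivIset qV)).
have -> : \bigcup_j W j = V.
  rewrite -(cover_partition qV) /cover [RHS]big_mkcond; apply: eq_bigr => j _.
  by rewrite /W; case: ifP.
apply: eq_bigl => p; case: (boolP (partition p V)) => //= pV.
have -> : [forall B in p, exists j, B \subset W j] = refines p q.
  apply: eq_forallb => B; case: (boolP (B \in p)) => //= Bp.
  apply/existsP/existsP => -[C].
    rewrite /W; case: ifP => [Cq BC|_]; first by exists C; rewrite Cq.
    by rewrite subset0 (negbTE (partition_neq0 pV Bp)).
  by case/andP=> Cq BC; exists C; rewrite /W Cq.
rewrite andbC; case: (boolP (refines p q)) => [pq|_]; last by rewrite !andbF.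
rewrite !andbT; apply/forallP/noncrossingP => [h U1 U2 a b c d U1p U2p|h B].
  have /existsP[C1 /andP[C1q UC1]] := implyP (forallP pq U1) U1p.
  have /existsP[C2 /andP[C2q UC2]] := implyP (forallP pq U2) U2p.
  move=> abc cd aU cU bU dU.
  have C12 : C1 = C2.
    by apply: (noncrossingP _ ncq C1 C2 a b c d) => //;
      [exact: (subsetP UC1)|exact: (subsetP UC1)|
       exact: (subsetP UC2)|exact: (subsetP UC2)].
  apply: (noncrossingP _ (h C1) U1 U2 a b c d) => //; rewrite inE /W C1q.
    by rewrite U1p UC1.
  by rewrite U2p C12 UC2.
apply: noncrossingS (introT (noncrossingP p) h).
by apply/subsetP => B'; rewrite inE => /andP[].
Qed.

(** Here [D] will be the set of positions of diagonal letters. When [kap] vanishes on mixed blocks,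
    [pi] is the partition induced on the random positions. *)
Definition NCsum_at kap D pi V : F :=
  \sum_(p | [&& partition p V, noncrossing p &
                [set B in p | ~~ (B \subset D)] == pi]) \prod_(B in p) kap B.

Lemma NCsum_decomp kap D V : NCsum kap V = \sum_pi NCsum_at kap D pi V.
Proof.
rewrite /NCsum (partition_big (fun p => [set B in p | ~~ (B \subset D)]) xpredT) //=.
by apply: eq_bigr => pi _; apply: eq_bigl => p; rewrite -andbA.
Qed.

Lemma NCsum_at0 kap D V : V \subset D -> NCsum_at kap D set0 V = NCsum kap V.
Proof.
move=> VD; apply: eq_bigl => p; case: (boolP (partition p V)) => //= pV.
rewrite andbC; case: eqP => // -[]; apply/setP => B; rewrite !inE.
apply/negbTE; apply/negP => /andP[Bp]; case/negP.
exact: subset_trans (partitionS pV Bp) VD.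
Qed.

(** The block [B0] separates the positions between [v] and [v'] from the others, so a noncrossing
    partition containing it is glued from three pieces. The inner one is an arbitrary noncrossing
    partition, because all its blocks lie in [D] and do not show in [pi]. *)
Lemma NCsum_at_recursion kap D pi V (v v' : X) (B0 := [set v; v'])
    (In := [set x in V | (v < x < v')%N]) :
  (v < v')%N -> v \in V -> v' \in V -> B0 \in pi -> ~~ (B0 \subset D) ->
  In \subset D ->
  NCsum_at kap D pi V =
  kap B0 * NCsum kap In * NCsum_at kap D (pi :\ B0) (V :\: (B0 :|: In)).
Proof.
move=> vv' vV v'V B0pi B0D InD.
set V' := V :\: _.
pose Ws := [:: B0; In; V'].
pose Qs : seq (pred {set {set X}}) := [:: fun p => p == [set B0]; @noncrossing n;
  fun p => noncrossing p && ([set B in p | ~~ (B \subset D)] == pi :\ B0)].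
pose W (j : 'I_3) := nth set0 Ws j; pose Q (j : 'I_3) := nth (fun=> false) Qs j.
have B0V : B0 \subset V by apply/subsetP => x; rewrite !inE => /orP[]/eqP->.
have B0n0 : B0 != set0 by apply/set0Pn; exists v; rewrite !inE eqxx.
have dB0In : [disjoint B0 & In].
  rewrite -setI_eq0; apply/eqP/setP => x; rewrite !inE; apply/negbTE/negP.
  by case/andP=> /orP[]/eqP-> /and3P[_]; rewrite ltnn // andbF.
have dV' U : U \subset B0 :|: In -> [disjoint U & V'].
  move=> /subsetP UB; rewrite -setI_eq0; apply/eqP/setP => x; rewrite [RHS]inE inE.
  by apply/negbTE/negP => /andP[/UB xU]; rewrite [in X in X -> _]inE xU.
have dW i j : i != j -> [disjoint W i & W j].
  wlog ij : i j / (i < j)%N.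
    move=> h nij; have := nij; rewrite neq_ltn => /orP[|] ij; first exact: h.
    by rewrite disjoint_sym h // eq_sym.
  case: i j ij => -[|[|[|//]]] i3 [[|[|[|//]]] j3] //= _ _; rewrite /W //=.
    by apply: dV'; exact: subsetUl.
  by apply: dV'; exact: subsetUr.
have cW : \bigcup_j W j = V.
  rewrite !big_ord_recl big_ord0 /W /= setU0 setUA /V'.
  rewrite setDE setUIr setUCr setIT; apply/setUidPr.
  by rewrite subUset B0V; apply/subsetP => x; rewrite inE => /andP[].
have := partition_distr kap Q dW; rewrite cW !big_ord_recl big_ord0 /W /Q /=.
rewrite mulr1 mulrA.
have -> : \sum_(p | partition p B0 && (p == [set B0])) \prod_(B in p) kap B = kap B0.
  rewrite (big_pred1 [set B0]) ?big_set1 // => p /=; case: eqP => [->|]; last by rewrite andbF.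
  rewrite andbT /partition /cover big_set1 eqxx inE eq_sym B0n0 andbT.
  by apply/trivIsetP => ? ? /set1P-> /set1P->; rewrite eqxx.
rewrite -/(NCsum kap In) -/(NCsum_at kap D (pi :\ B0) V') => ->.
apply: eq_bigl => p; case: (boolP (partition p V)) => //= pV.
have big3 (R : pred 'I_3) : [forall j, R j] = [&& R ord0, R (lift ord0 ord0) & R (lift ord0 (lift ord0 ord0))].
  apply/forallP/and3P => [h|[h0 h1 h2] j]; first by split; apply: h.
  case: (unliftP ord0 j) => [j' ->|-> //].
  case: (unliftP ord0 j') => [j'' ->|-> //].
  by case: (unliftP ord0 j'') => [[]|->].
have ex3 (R : pred 'I_3) : [exists j, R j] = [|| R ord0, R (lift ord0 ord0) | R (lift ord0 (lift ord0 ord0))].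
  by apply: negb_inj; rewrite negb_exists big3 !negb_or.
rewrite [in RHS]big3 /=.
have -> : [forall B in p, exists j : 'I_3, B \subset nth set0 Ws j] =
          [forall B in p, [|| B \subset B0, B \subset In | B \subset V']].
  by apply: eq_forallb => B; rewrite ex3.
have memIn x : x \in V -> (v < x < v')%N -> x \in In by rewrite inE => ->.
have eqB B C x : B \in p -> C \in p -> x \in B -> x \in C -> B = C.
  move=> Bp Cp xB xC; apply: contraTeq xC => nBC.
  have /pred0P/(_ x)/= := trivIsetP (partition_trivIset pV) B C Bp Cp nBC.
  by rewrite xB /= => ->.
have subB0 B : B \in p -> B0 \in p -> B \subset B0 -> B = B0.
  move=> Bp B0p BB0; have /set0Pn[x xB] := partition_neq0 pV Bp.
  by apply: (eqB _ _ x) => //; apply: (subsetP BB0).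
have V'In x : x \in V' -> ~~ (v < x < v')%N.
  by rewrite !inE; case: (x \in V); rewrite ?andbF // => /andP[]; rewrite negb_or => /andP[].
have dInV' x : x \in In -> x \in V' -> false by rewrite inE => /andP[_ h] /V'In; rewrite h.
apply/andP/and4P => -[].
- move=> ncp /eqP pip.
  have B0p : B0 \in p by move: B0pi; rewrite -pip inE => /andP[].
  (* A block meeting the interval between [v] and [v'] stays in it: a point beyond either end would
     make it cross [B0]. *)
  have other B : B \in p -> B != B0 -> (B \subset In) || (B \subset V').
    move=> Bp nB; have nv x : x \in B -> x != v /\ x != v'.
      by move=> xB; split; apply: contraNneq nB => xv; apply/eqP;
        apply: (eqB _ _ x) => //; rewrite xv !inE eqxx ?orbT.
    case: (boolP (B \subset V')) => [|/subsetPn[x xB xV']]; first by rewrite orbT.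
    have xV : x \in V by apply: (subsetP (partitionS pV Bp)).
    have [xv xv'] := nv _ xB.
    have xIn : (v < x < v')%N.
      by move: xV'; rewrite !inE xV (negbTE xv) (negbTE xv') /= andbT negbK.
    rewrite orbF; apply/subsetP => y yB; have yV : y \in V by apply: (subsetP (partitionS pV Bp)).
    have [yv yv'] := nv _ yB; apply: memIn => //; have /andP[vx xv'1] := xIn.
    case: (ltngtP v y) => [vy|yv1|/val_inj e] /=; last by rewrite e eqxx in yv.
      case: (ltngtP y v') => [//|v'y|/val_inj e]; last by rewrite e eqxx in yv'.
      case/eqP: nB; symmetry; apply: (noncrossingP _ ncp _ _ v x v' y) => //;
        by rewrite ?vx ?inE ?eqxx ?orbT.
    case/eqP: nB; apply: (noncrossingP _ ncp _ _ y v x v') => //;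
      by rewrite ?yv1 ?inE ?eqxx ?orbT.
  split.
  + apply/forallP => B; apply/implyP => Bp; case: (eqVneq B B0) => [->|nB].
      by rewrite subxx.
    by rewrite other ?orbT.
  + apply/eqP/setP => B; rewrite !inE; apply/andP/eqP => [[Bp BB0]|->].
      exact: subB0.
    by rewrite subxx.
  + by apply: noncrossingS ncp; apply/subsetP => B; rewrite inE => /andP[].
  rewrite (noncrossingS _ ncp); last by apply/subsetP => B; rewrite inE => /andP[].
  apply/eqP/setP => B; rewrite -pip !inE.
  case: (eqVneq B B0) => [->|nB] /=.
    apply/negbTE/negP => /andP[/andP[_ h] _].
    by have := subsetP h v; rewrite !inE eqxx /= => /(_ isT).
  case: (boolP (B \in p)) => //= Bp.
  have /orP[BIn|->//] := other B Bp nB.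
  by rewrite (subset_trans BIn InD) /= andbF.
move=> /forallP pj /eqP pB0 ncIn /andP[ncV' /eqP piV'].
have B0p : B0 \in p by have := set11 B0; rewrite -pB0 inE => /andP[].
have parts B : B \in p -> [\/ B = B0, B \subset In | B \subset V'].
  by move=> Bp; have /or3P[h|h|h] := implyP (pj B) Bp;
    [constructor 1; apply: subB0|constructor 2|constructor 3].
split.
- apply/noncrossingP => U1 U2 a b c d U1p U2p abc cd aU cU bU dU.
  have /andP[ab bc] := abc.
  have V2 x : x \in U2 -> x \in V by apply: (subsetP (partitionS pV U2p)).
  have V1 x : x \in U1 -> x \in V by apply: (subsetP (partitionS pV U1p)).
  case: (parts _ U1p) => [e1|s1|s1].
  + have [av cv'] : a = v /\ c = v'.
      by move: aU cU ab bc; rewrite e1 !inE => /orP[]/eqP-> /orP[]/eqP-> h1 h2; split => //;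
        exfalso; move: h1 h2 vv'; clear; lia.
    have bIn : b \in In by apply: memIn; rewrite ?V2 // -av -cv' ab.
    case: (parts _ U2p) => [->//|s2|s2].
      have := subsetP s2 _ dU; rewrite inE => /and3P[_ _].
      by rewrite -cv' => /(ltn_trans cd); rewrite ltnn.
    by have := dInV' _ bIn (subsetP s2 _ bU).
  + have aIn := subsetP s1 _ aU; have cIn := subsetP s1 _ cU.
    have bIn : b \in In.
      apply: memIn; first exact: V2.
      move: aIn cIn; rewrite !inE => /and3P[_ va _] /and3P[_ _ cv].
      by rewrite (ltn_trans va ab) (ltn_trans bc cv).
    case: (parts _ U2p) => [e2|s2|s2].
    * have /pred0P/(_ b)/= := dB0In; rewrite bIn andbT -e2 bU.
      by [].
    * by apply: (noncrossingP _ ncIn _ _ a b c d) => //; rewrite inE ?U1p ?U2p.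
    * by have := dInV' _ bIn (subsetP s2 _ bU).
  + case: (parts _ U2p) => [e2|s2|s2].
    * have [bv dv'] : b = v /\ d = v'.
        by move: bU dU bc cd; rewrite e2 !inE => /orP[]/eqP-> /orP[]/eqP-> h1 h2; split => //;
        exfalso; move: h1 h2 vv'; clear; lia.
      have cIn : c \in In by apply: memIn; rewrite ?V1 // -bv -dv' bc.
      by have := dInV' _ cIn (subsetP s1 _ cU).
    * have bIn := subsetP s2 _ bU; have dIn := subsetP s2 _ dU.
      have cIn : c \in In.
        apply: memIn; first exact: V1.
        move: bIn dIn; rewrite !inE => /and3P[_ va _] /and3P[_ _ cv].
        by rewrite (ltn_trans va bc) (ltn_trans cd cv).
      by have := dInV' _ cIn (subsetP s1 _ cU).
    * by apply: (noncrossingP _ ncV' _ _ a b c d) => //; rewrite inE ?U1p ?U2p.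
apply/eqP/setP => B; have /setP/(_ B) := piV'; rewrite !inE.
case: (eqVneq B B0) => [->|nB] /=; first by rewrite B0p B0D B0pi.
move=> <-; case: (boolP (B \in p)) => //= Bp.
case: (parts _ Bp) => [e|BIn|->//]; first by rewrite e eqxx in nB.
by rewrite (subset_trans BIn InD) andbF.
Qed.

(** A pair of [pi] at minimal distance encloses a position outside [D], whose own pair is different.
    By minimality the partner of that position lies outside the interval, and the two pairs cross;
    so the sum is empty. *)
Lemma NCsum_at_eq0 kap D pi V : pi != set0 -> partition pi (V :\: D) ->
  (forall B, B \in pi -> #|B| = 2) ->
  (forall v v' : X, (v < v')%N -> [set v; v'] \in pi ->
     ~~ ([set x in V | (v < x < v')%N] \subset D)) ->
  NCsum_at kap D pi V = 0.
Proof.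
move=> pi0 piY pi2 nadj; apply: big_pred0 => p; apply/negP => /and3P[pV ncp /eqP pip].
have two B : B \in pi -> exists v v' : X, (v < v')%N /\ B = [set v; v'].
  move=> /pi2 hB; have /cards2P[x [y [nxy ->]]] : #|B| == 2 by apply/eqP.
  case: (ltngtP x y) => [h|h|/val_inj e]; last by rewrite e eqxx in nxy.
    by exists x, y.
  by exists y, x; rewrite setUC.
pose P (u : X * X) := (u.1 < u.2)%N && ([set u.1; u.2] \in pi).
have [B0 B0pi] := set0Pn _ pi0.
have [v0 [v0' [lt0 e0]]] := two _ B0pi.
have P0 : P (v0, v0') by rewrite /P lt0 -e0.
case: (arg_minnP (fun u : X * X => u.2 - u.1)%N P0) => -[v v'] /andP[/= vv' vpi] vmin.
have /subsetPn[x] := nadj _ _ vv' vpi; rewrite inE => /andP[xV /andP[vx xv']] xD.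
have xY : x \in V :\: D by rewrite inE xD xV.
rewrite -(cover_partition piY) in xY; have /bigcupP[B Bpi xB] := xY.
have [w [w' [ww' eB]]] := two _ Bpi.
have B0p : [set v; v'] \in p by move: vpi; rewrite -pip inE => /andP[].
have Bp : [set w; w'] \in p by move: Bpi; rewrite eB -pip inE => /andP[].
have nBB : [set v; v'] <> [set w; w'].
  move=> e; move: xB; rewrite eB -e !inE => /orP[]/eqP e'; subst x.
    by rewrite ltnn in vx.
  by rewrite ltnn in xv'.
have trip := trivIsetP (partition_trivIset pV) _ _ B0p Bp.
have nvw y : y \in [set w; w'] -> y != v /\ y != v'.
  move=> yw; have /trip/pred0P/(_ y)/= : [set v; v'] != [set w; w'] by apply/eqP.
  by rewrite yw andbT !inE => /negbT; rewrite negb_or => /andP.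
have [nwv nwv'] := nvw w (set21 _ _); have [nw'v nw'v'] := nvw w' (set22 _ _).
have := vmin (w, w'); rewrite /P /= ww' -eB Bpi => /(_ isT) hmin.
move: xB; rewrite eB !inE => /orP[]/eqP e; subst x.
- case: (ltngtP w' v') => [h|h|/val_inj e]; last by rewrite e eqxx in nw'v'.
    by move: hmin vx xv' ww' vv' h; clear; lia.
  case: nBB; apply: (noncrossingP _ ncp _ _ v w v' w') => //;
    by rewrite ?vx ?set21 ?set22.
- case: (ltngtP w v) => [h|h|/val_inj e]; last by rewrite e eqxx in nwv.
    case: nBB; symmetry; apply: (noncrossingP _ ncp _ _ w v w' v') => //;
      by rewrite ?h ?set21 ?set22.
  by move: hmin vx xv' ww' vv' h; clear; lia.
Qed.

End NoncrossingSums.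

(* The other half of [mobius_sum]: a left inverse of a square matrix is a right
   inverse. *)
Lemma mobius_sum_right (T : finType) (S : {set T}) (le : rel T) x y :
  {in S, reflexive le} -> {in S &, antisymmetric le} ->
  {in S & &, transitive le} -> x \in S -> y \in S ->
  \sum_(z in S | le x z && le z y) mobius S le z y = (x == y)%:R.
Proof.
move=> rfl asym tr xS yS.
(* Off [S] the matrix is completed by the identity, to have square matrices indexed by all of
   [T]. *)
pose ext (f : T -> T -> int) :=
  \matrix_(i < #|T|, j < #|T|)
    if (enum_val i \in S) && (enum_val j \in S)
    then f (enum_val i) (enum_val j) *+ le (enum_val i) (enum_val j) else (i == j)%:R.
have extM f g i j : enum_val i \in S -> enum_val j \in S ->
    (ext f *m ext g) i j = \sum_(z in S | le (enum_val i) z && le z (enum_val j))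
       f (enum_val i) z * g z (enum_val j).
  move=> iS jS; rewrite mxE (reindex (enum_rank : T -> 'I_#|T|)) /=; last first.
    by apply: onW_bij; exact: enum_rank_bij.
  rewrite [RHS]big_mkcond; apply: eq_bigr => z _; rewrite !mxE enum_rankK iS jS /=.
  rewrite andbT; case: ifP => [zS|zS] /=.
    by case: (le _ z); case: (le z _); rewrite ?mulr1n ?mulr0n ?mulr0 ?mul0r.
  suff -> : (i == enum_rank z) = false by rewrite mul0r.
  by apply: contraFF zS => /eqP e; rewrite -[z]enum_rankK -e.
have inv : ext (mobius S le) *m ext (fun _ _ => 1) = 1%:M.
  apply/matrixP => i j; case: (boolP (enum_val i \in S)) => iS; last first.
    rewrite mxE (bigD1 i) //= big1 ?addr0; last first.
      by move=> k ki; rewrite mxE (negbTE iS) /= eq_sym (negbTE ki) mul0r.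
    by rewrite !mxE (negbTE iS) /= eqxx mul1r.
  case: (boolP (enum_val j \in S)) => jS; last first.
    rewrite mxE (bigD1 j) //= big1 ?addr0; last first.
      by move=> k kj; rewrite [X in _ * X]mxE (negbTE jS) andbF (negbTE kj) mulr0.
    by rewrite !mxE (negbTE jS) !andbF /= eqxx mulr1.
  rewrite extM // mxE.
  under eq_bigr do rewrite mulr1.
  have [leij|nleij] := boolP (le (enum_val i) (enum_val j)).
    by rewrite mobius_sum // (inj_eq enum_val_inj).
  rewrite big_pred0; last first.
    move=> z; apply/negbTE/negP => /andP[zS /andP[iz zj]].
    by case/negP: nleij; exact: (tr z).
  case: eqVneq => // ij; case/negP: nleij; rewrite ij; exact: rfl.
have := mulmx1C inv; move=> /matrixP/(_ (enum_rank x) (enum_rank y)).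
rewrite extM ?enum_rankK // mxE (inj_eq enum_rank_inj) => <-.
by under [RHS]eq_bigr do rewrite mul1r.
Qed.

Section RefinementOrder.
Variable n : nat.
Implicit Types (p q : {set {set 'I_n}}).

Lemma refines_refl : {in NC n, reflexive (@refines n)}.
Proof.
move=> p _; apply/forallP => B; apply/implyP => Bp; apply/existsP.
by exists B; rewrite Bp subxx.
Qed.

Lemma refines_trans : {in NC n & &, transitive (@refines n)}.
Proof.
move=> q p r _ _ _ pq qr; apply/forallP => B; apply/implyP => Bp.
have /existsP[C /andP[Cq BC]] := implyP (forallP pq B) Bp.
have /existsP[E /andP[Er CE]] := implyP (forallP qr C) Cq.
by apply/existsP; exists E; rewrite Er (subset_trans BC CE).
Qed.

Lemma refines_anti : {in NC n &, antisymmetric (@refines n)}.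
Proof.
have sub p q : p \in NC n -> q \in NC n -> refines p q -> refines q p -> p \subset q.
  rewrite !inE => /andP[pP _] /andP[qP _] pq qp; apply/subsetP => B Bp.
  have /existsP[C /andP[Cq BC]] := implyP (forallP pq B) Bp.
  have /existsP[E /andP[Ep CE]] := implyP (forallP qp C) Cq.
  have BE : B = E.
    apply: contraTeq (subset_trans BC CE) => nBE.
    have := trivIsetP (partition_trivIset pP) B E Bp Ep nBE; apply: contraL => sBE.
    by rewrite -setI_eq0 (setIidPl sBE) (partition_neq0 pP Bp).
  suff -> : B = C by [].
  by apply/eqP; rewrite eqEsubset BC /= BE.
move=> p q pS qS /andP[pq qp]; apply/eqP; rewrite eqEsubset.
by rewrite !sub.
Qed.

Lemma refines_top p : p \in NC n -> refines p (top_part n).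
Proof.
move=> _; apply/forallP => B; apply/implyP => _; apply/existsP.
by exists setT; rewrite inE eqxx subsetT.
Qed.

Lemma top_part_NC : (0 < n)%N -> top_part n \in NC n.
Proof.
move=> n0; rewrite inE; apply/andP; split.
  rewrite /partition /cover big_set1 eqxx inE eq_sym -card_gt0 cardsT card_ord n0 andbT.
  by apply/trivIsetP => ? ? /set1P-> /set1P->; rewrite eqxx.
by apply/noncrossingP => V W a b c d /set1P-> /set1P->.
Qed.

(** Expanding by [prod_NCsum] leaves for each [p] the sum of mu(q, 1) over the [q] above [p], which
    is 0 unless [p] is the top. The left side is the Moebius formula for the cumulant of a word with
    moments [NCsum kap]. For n = 0 the top partition has an empty block and is not in [NC]. *)
Lemma mobius_inversion_NC (F : comPzRingType) (kap : {set 'I_n} -> F) : (0 < n)%N ->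
  \sum_(q in NC n) (\prod_(W in q) NCsum kap W) *
     (mobius (NC n) (@refines n) q (top_part n))%:~R = kap [set: 'I_n].
Proof.
move=> n0; pose mu q := mobius (NC n) (@refines n) q (top_part n).
pose kp p := \prod_(B in p) kap B.
transitivity (\sum_(q in NC n) \sum_(p in NC n | refines p q) kp p * (mu q)%:~R).
  apply: eq_bigr => q; rewrite inE => /andP[qP ncq].
  rewrite (prod_NCsum kap qP ncq) big_distrl /=; apply: eq_bigl => p.
  by rewrite inE -andbA.
rewrite (exchange_big_dep [in NC n]) /=; last by move=> ? ? _ /andP[].
transitivity (\sum_(p in NC n) kp p * (p == top_part n)%:R).
  apply: eq_bigr => p pNC; rewrite -big_distrr /= -rmorph_sum /=; congr (_ * _).
  transitivity ((p == top_part n)%:R%:~R : F); last by case: (p == _).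
  rewrite -(mobius_sum_right refines_refl refines_anti refines_trans pNC (top_part_NC n0)).
  congr (_%:~R); apply: eq_bigl => q; case: (boolP (q \in NC n)) => //= qNC.
  by rewrite pNC refines_top // andbT.
rewrite (bigD1 (top_part n)) ?top_part_NC //= eqxx mulr1 big1 ?addr0.
  by rewrite /kp big_set1.
by move=> p /andP[_ /negbTE->]; rewrite mulr0.
Qed.

End RefinementOrder.

(** Recursion on the size of [V]: the one-block partition contributes [kap V], and every other
    partition involves smaller sets only. The condition on [tau] at the empty set is forced by
    [NCsum0]. *)
Lemma NCsum_inversion n (F : comPzRingType) (tau : {set 'I_n} -> F) : tau set0 = 1 ->
  exists kap : {set 'I_n} -> F, forall V, NCsum kap V = tau V.
Proof.
move=> tau0.
suff h k : exists kap : {set 'I_n} -> F,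
  forall V : {set 'I_n}, (#|V| <= k)%N -> NCsum kap V = tau V.
  by have [kap hk] := h #|'I_n|; exists kap => V; apply: hk; exact: max_card.
elim: k => [|k [kap IH]].
  exists tau => V; rewrite leqn0 cards_eq0 => /eqP->; by rewrite NCsum0 tau0.
exists (fun V : {set 'I_n} => if (#|V| <= k)%N then kap V else
  tau V - \sum_(p | (partition p V && noncrossing p) && (p != [set V])) \prod_(B in p) kap B).
have small (V : {set 'I_n}) : (#|V| <= k)%N -> NCsum (fun V : {set 'I_n} => if (#|V| <= k)%N then kap V else
  tau V - \sum_(p | (partition p V && noncrossing p) && (p != [set V])) \prod_(B in p) kap B) V
   = NCsum kap V.
  move=> Vk; apply: eq_bigr => p /andP[pV _]; apply: eq_bigr => B Bp.
  by rewrite (leq_trans (subset_leq_card (partitionS pV Bp)) Vk).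
move=> V; rewrite leq_eqVlt => /orP[/eqP Vk|]; last first.
  by rewrite ltnS => Vk; rewrite small // IH.
have V0 : V != set0 by rewrite -card_gt0 Vk.
rewrite /NCsum (bigD1 [set V]) /=; last first.
  apply/andP; split; last by apply/noncrossingP => ? ? ? ? ? ? /set1P-> /set1P->.
  rewrite /partition /cover big_set1 eqxx inE eq_sym V0 andbT.
  by apply/trivIsetP => ? ? /set1P-> /set1P->; rewrite eqxx.
rewrite big_set1 Vk ltnn -[RHS]addr0 -addrA; congr (_ + _).
apply/eqP; rewrite addrC subr_eq0; apply/eqP/eq_bigr => p /andP[/andP[pV _] npV].
apply: eq_bigr => B Bp; rewrite -ltnS -Vk proper_card //.
rewrite properEneq (partitionS pV Bp) andbT; apply: contraNneq npV => BV; subst B.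
apply/eqP/setP => B; rewrite inE; apply/idP/eqP => [B'p|-> //].
apply/eqP; apply: contraT => nBV.
have := trivIsetP (partition_trivIset pV) B V B'p Bp nBV.
by rewrite -setI_eq0 (setIidPl (partitionS pV B'p)) (negbTE (partition_neq0 pV B'p)).
Qed.

(** * Closed walks and pairings *)

Section PartitionSums.
Variables (X : finType) (F : comPzRingType) (w : {set X} -> F).
Implicit Types (V B : {set X}).

(** For a weight supported on two-element blocks this is the Wick sum over all pairings of [V],
    crossing or not. *)
Definition Psum V : F := \sum_(p | partition p V) \prod_(B in p) w B.

Lemma Psum0 : Psum set0 = 1.
Proof.
rewrite /Psum (big_pred1 set0) ?big_set0 // => p /=.
by rewrite partition_set0.
Qed.

Lemma Psum_eq0 V u : u \in V -> (forall B : {set X}, u \in B -> B \subset V -> w B = 0) ->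
  Psum V = 0.
Proof.
move=> uV wu; apply: big1 => p pV.
move: uV; rewrite -(cover_partition pV) => /bigcupP[B Bp uB].
by rewrite (bigD1 B) //= wu ?mul0r // (partitionS pV Bp).
Qed.

(** A block meeting [B0] has nonzero weight only if it is [B0] itself, so every contributing
    partition contains [B0]. *)
Lemma Psum_recursion V B0 : B0 \subset V -> B0 != set0 ->
  (forall B : {set X}, B \subset V -> ~~ [disjoint B & B0] -> B != B0 -> w B = 0) ->
  Psum V = w B0 * Psum (V :\: B0).
Proof.
move=> B0V B0n0 wB.
pose W (b : bool) := if b then B0 else V :\: B0.
pose Q (b : bool) (p : {set {set X}}) := b ==> (p == [set B0]).
have dW i j : i != j -> [disjoint W i & W j].
  have d : [disjoint B0 & V :\: B0].
    by rewrite -setI_eq0; apply/eqP/setP => x; rewrite !inE; case: (x \in B0).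
  by case: i j => -[] //= _; rewrite /W // disjoint_sym.
have := partition_distr w Q dW; rewrite !big_bool /= /Q /=.
have -> : \sum_(p | partition p B0 && (p == [set B0])) \prod_(B in p) w B = w B0.
  rewrite (big_pred1 [set B0]) ?big_set1 // => p /=; case: eqP => [->|]; last by rewrite andbF.
  rewrite andbT /partition /cover big_set1 eqxx inE eq_sym B0n0 andbT.
  by apply/trivIsetP => ? ? /set1P-> /set1P->; rewrite eqxx.
under [X in _ * X = _ -> _]eq_bigl do rewrite andbT.
rewrite -/(Psum (V :\: B0)) => ->.
have -> : B0 :|: V :\: B0 = V by rewrite setDE setUIr setUCr setIT; apply/setUidPr.
rewrite /Psum (bigID (fun p : {set {set X}} => [forall B in p, [exists j : bool, B \subset W j]] &&
   [forall j : bool, j ==> ([set B in p | B \subset W j] == [set B0])])) /=.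
rewrite [X in _ + X]big1 ?addr0 // => p /andP[pV]; rewrite negb_and => nc.
have eqB B C x : B \in p -> C \in p -> x \in B -> x \in C -> B = C.
  move=> Bp Cp xB xC; apply: contraTeq xC => nBC.
  have /pred0P/(_ x)/= := trivIsetP (partition_trivIset pV) B C Bp Cp nBC.
  by rewrite xB /= => ->.
have [x xB0] := set0Pn _ B0n0.
have := subsetP B0V _ xB0; rewrite -(cover_partition pV) => /bigcupP[B1 B1p xB1].
have kill B : B \in p -> ~~ [disjoint B & B0] -> B != B0 -> \prod_(B in p) w B = 0.
  by move=> Bp h1 h2; rewrite (bigD1 B) //= wB ?mul0r // (partitionS pV Bp).
case: (eqVneq B1 B0) => [e|ne]; last first.
  by apply: (kill _ B1p) => //; apply/pred0Pn; exists x; rewrite /= xB1.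
subst B1; have {}nc : ~~ [forall B in p, [exists j : bool, B \subset W j]].
  case/orP: nc => // /forallPn[[|]] //=; rewrite /W => /negP[].
  apply/eqP/setP => B; rewrite !inE; apply/andP/eqP => [[Bp BB0]|-> //].
  have /set0Pn[y yB] := partition_neq0 pV Bp.
  by apply: (eqB _ _ y) => //; apply: (subsetP BB0).
case/forallPn: nc => B; rewrite negb_imply => /andP[Bp /existsPn nB].
have := nB true; have := nB false; rewrite /W => h1 h2; apply: (kill B Bp).
  apply: contra h1 => dB; rewrite subsetD (partitionS pV Bp) //.
by apply: contraNneq h2 => ->.
Qed.

End PartitionSums.

Section ClosedWalks.
Variables (n : nat) (T : finType) (e : 'I_n -> T * T).
Local Notation X := 'I_n.
Implicit Types (u v : X) (s : seq X).

Definition arev (a : T * T) := (a.2, a.1).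
Definition step u v := (e u).2 == (e v).1.
Definition src v := (e v).1.
(** In a closed walk every vertex is the source of a step, so these are all its vertices. *)
Definition srcs s := [set src v | v in s].

(** Each source other than that of the head is shared by at least two steps, and that of the head by
    at least one: k sources take at least 1 + 2(k - 1) steps. *)
Lemma card_srcs_no_leaf s : uniq s ->
  (forall v, v \in behead s -> exists2 v', v' \in s & (v' != v) && (src v' == src v)) ->
  (0 < size s)%N -> (2 * #|srcs s| <= (size s).+1)%N.
Proof.
case: s => // h t us /= nl _; set s := h :: t in us nl *.
pose S := [set x in s]; have sS : srcs s = src @: S.
  by apply/setP => a; apply/imsetP/imsetP => -[v vs ->]; exists v; rewrite ?inE // in vs *.
have cS : (size t).+1 = #|S| by rewrite cardsE (card_uniqP us).
have hs : src h \in srcs s by apply/imsetP; exists h; rewrite // mem_head.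
have -> : (size t).+2 = #|S|.+1 by rewrite -cS.
have : #|S| = (\sum_(a in src @: S) #|[set v in S | src v == a]|)%N.
  rewrite -sum1_card (partition_big_imset src) /=; apply: eq_bigr => a _.
  by rewrite sum1dep_card; apply: eq_card => v; rewrite !inE.
rewrite -sS (bigD1 (src h)) //= => ->.
have := cardsD1 (src h) (srcs s); rewrite hs => ->.
have f1 : (1 <= #|[set v in S | src v == src h]|)%N.
  by apply/card_gt0P; exists h; rewrite !inE !eqxx.
have f2 : (\sum_(a in srcs s :\ src h) 2 <=
           \sum_(a in srcs s | a != src h) #|[set v in S | src v == a]|)%N.
  rewrite big_mkcond [X in (_ <= X)%N]big_mkcond; apply: leq_sum => a _.
  rewrite inE andbC inE; case: ifP => // /andP[/imsetP[v vs ea] nah]; subst a.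
  have vt : v \in t by move: vs; rewrite inE => /orP[/eqP e1|//]; rewrite e1 eqxx in nah.
  have [v' v's /andP[nv' /eqP sv']] := nl v vt.
  apply/card_gt1P; exists v, v'; rewrite !inE; split.
  - by rewrite inE in vs; rewrite vs eqxx.
  - by rewrite inE in v's; rewrite v's sv' eqxx.
  - by rewrite eq_sym.
rewrite sum_nat_const in f2; move: f1 f2.
move: #|srcs s :\ src h| (\sum_(a in srcs s | a != src h) _)%N #|[set v in S | src v == src h]| => x y z.
by rewrite (_ : (true : nat) = 1%N) //; lia.
Qed.

(** At most one term is nonzero; the sum avoids choosing the two elements of [B]. The pair is read
    in increasing order, and it counts only if its two steps traverse one edge in opposite
    directions. *)
Definition compat_weight (F : comPzRingType) (c : X -> X -> F) (B : {set X}) : F :=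
  \sum_(u : X) \sum_(v : X | [&& (u < v)%N, B == [set u; v] & e v == arev (e u)]) c u v.

Section Weight.
Variables (F : comPzRingType) (c : X -> X -> F).
Local Notation w := (compat_weight c).

Lemma set2_inj u v u' v' : (u < v)%N -> (u' < v')%N -> [set u; v] = [set u'; v'] ->
  u = u' /\ v = v'.
Proof.
move=> uv uv' E; have := set21 u v; have := set22 u v; rewrite E !inE.
move=> /orP[]/eqP ev /orP[]/eqP eu; subst u v => //; try by rewrite ltnn in uv.
by have := ltn_trans uv uv'; rewrite ltnn.
Qed.

Lemma compat_weight_set2 u v : (u < v)%N ->
  w [set u; v] = c u v *+ (e v == arev (e u)).
Proof.
move=> uv; rewrite /w (bigD1 u) //= [X in _ + X]big1 ?addr0; last first.
  move=> u' nu; apply: big1 => v' /and3P[uv' /eqP E _].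
  by have [h _] := set2_inj uv uv' E; rewrite h eqxx in nu.
case: eqP => E; last first.
  apply: big1 => v' /and3P[uv' /eqP E' /eqP h].
  by have [_ h'] := set2_inj uv uv' E'; rewrite -h' in h.
rewrite (big_pred1 v) // => v' /=; apply/and3P/eqP => [[uv' /eqP E' _]|->].
  by have [_ ->] := set2_inj uv uv' E'.
by rewrite uv eqxx E eqxx.
Qed.

Lemma compat_weight_neq0 B : w B != 0 ->
  exists u v, [/\ (u < v)%N, B = [set u; v] & e v = arev (e u)].
Proof.
case: (boolP [exists u : X, exists v : X, [&& (u < v)%N, B == [set u; v] & e v == arev (e u)]]).
  by move=> /existsP[u /existsP[v /and3P[uv /eqP eB /eqP E]]] _; exists u, v.
move=> /existsPn h; rewrite /w big1 ?eqxx // => u _; apply: big1 => v P.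
by have /existsPn/(_ v)/negP[] := h u.
Qed.

End Weight.

Section Factorization.
Variables (F : comPzRingType) (c : X -> X -> F) (eps : {set X} -> F) (Ys : {set X}).
(** [eps S] abstracts the expected product of the random entries at the steps in [S]: [epsM] is
    independence over different undirected edges, [eps1] centering, and [eps2] the covariance of
    opposite entries. *)
Hypothesis eps0 : eps set0 = 1.
Hypothesis epsM : forall S1 S2 : {set X}, S1 \subset Ys -> S2 \subset Ys ->
  [disjoint S1 & S2] ->
  (forall u v, u \in S1 -> v \in S2 -> e u <> e v /\ e u <> arev (e v)) ->
  eps (S1 :|: S2) = eps S1 * eps S2.
Hypothesis eps1 : forall u, u \in Ys -> eps [set u] = 0.
Hypothesis eps2 : forall u v, u \in Ys -> v \in Ys -> (u < v)%N ->
  e v = arev (e u) -> eps [set u; v] = c u v.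
Local Notation w := (compat_weight c).

Lemma arevK : involutive arev. Proof. by case. Qed.

Lemma eps2_sym u v : u \in Ys -> v \in Ys -> u != v ->
  e v = arev (e u) -> eps [set u; v] = w [set u; v].
Proof.
move=> uY vY; case: (ltngtP u v) => [h _ E|h _ E|/val_inj->]; last by rewrite eqxx.
  by rewrite compat_weight_set2 // E eqxx mulr1n eps2.
have E' : e u = arev (e v) by rewrite E arevK.
by rewrite setUC compat_weight_set2 // E' eqxx mulr1n eps2.
Qed.

(* Induction on the length of the walk, removing a leaf v together with the step
   u leading to it: either v does not return along u, and both sides vanish, or
   the pair {u, v} factors out of both. *)
Lemma eps_eq_Psum s : uniq s -> {subset s <= Ys} -> path.cycle step s ->
  (s == [::]) || ((size s).+1 < 2 * #|srcs s|)%N ->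
  eps [set x in s] = Psum w [set x in s].
Proof.
have [k] := ubnP (size s); elim: k s => // k IH s.
rewrite ltnS => sk us sY cs /orP[/eqP->|].
  have -> : [set x in [::]] = set0 :> {set X} by apply/setP => x; rewrite !inE.
  by rewrite eps0 Psum0.
case: s => [|h t] in sk us sY cs *.
  move=> hh; exfalso; move: hh; have -> : srcs [::] = set0 by apply/setP => x; rewrite inE; apply/imsetP => -[].
  by rewrite cards0.
set s := h :: t in sk us sY cs *.
(* A walk with this many vertices has a leaf, by [card_srcs_no_leaf]: some [v] past the head is the
   only step with its source. *)
have [|] := boolP [exists v in t, forall v' in s, (src v' == src v) ==> (v' == v)]; last first.
  rewrite negb_exists => /forallP nl; rewrite ltnNge => /negP[].
  apply: card_srcs_no_leaf => // v vt.
  have := nl v; rewrite vt /= negb_forall => /existsP[v'].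
  by rewrite !negb_imply => /and3P[v's h1 h2]; exists v' => //; rewrite h1 h2.
move=> /existsP[v /andP[vt /forallP leaf]] lt2.
have {}leaf v' : v' \in s -> src v' = src v -> v' = v.
  by move=> v's E; apply/eqP; have := leaf v'; rewrite v's E eqxx.
have [s1 [u [s2 Es]]] : exists s1 u s2, s = s1 ++ [:: u, v & s2].
  rewrite /s; case/splitPr: vt => p1 p2; case/lastP: p1 => [|p1 u].
    by exists [::], h, p2.
  by exists (h :: p1), u, p2; rewrite cat_rcons.
(* A closed walk may be rotated, so the step [u] into the leaf and the step [v] out of it can be
   taken to come first. *)
pose q := s2 ++ s1; set c' := [:: u, v & q].
have Ec : c' = rot (size s1) s by rewrite Es rot_size_cat.
have memc : c' =i s by move=> x; rewrite Ec mem_rot.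
have uc : uniq c' by rewrite Ec rot_uniq.
have cc : path.cycle step c' by rewrite Ec rot_cycle.
have -> : [set x in s] = u |: (v |: [set x in q]).
  by apply/setP => x; rewrite inE -memc !inE.
have srcE : srcs s = src u |: (src v |: srcs q).
  rewrite /srcs; apply/setP => a; rewrite !inE; apply/imsetP/or3P => [[x]|].
    rewrite -memc !inE => /or3P[/eqP->|/eqP->|xq] ->; rewrite ?eqxx; try by constructor.
    by constructor 3; apply/imsetP; exists x.
  case=> [/eqP->|/eqP->|/imsetP[x xq ->]]; [exists u|exists v|exists x] => //;
    by rewrite -memc !inE ?eqxx ?xq ?orbT.
have sz : size s = (size q).+2 by rewrite Es /q !size_cat /=; lia.
have [nuv uq vq uqq] : [/\ u != v, u \notin q, v \notin q & uniq q].
  by move: uc; rewrite /= inE negb_or => /and3P[/andP[-> ->] -> ->].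
have leafc x : x \in c' -> src x = src v -> x = v by rewrite memc; apply: leaf.
have [uY vY] : u \in Ys /\ v \in Ys by split; apply: sY; rewrite -memc !inE eqxx ?orbT.
have qY x : x \in q -> x \in Ys by move=> xq; apply: sY; rewrite -memc !inE xq !orbT.
have tgtu : (e u).2 = src v by move: cc => /= /andP[/eqP].
have eu : e u = (src u, src v) by rewrite -tgtu [LHS]surjective_pairing.
have ev : e v = (src v, (e v).2) by rewrite [LHS]surjective_pairing.
(* No other step uses the edge of [u]: a step out of the leaf is [v], and a step into the leaf is
   followed by [v], hence is [u]. *)
have nq x : x \in q -> e x <> e u /\ e x <> arev (e u).
  move=> xq; have xc : x \in c' by rewrite !inE xq !orbT.
  split=> E; last first.
    have sx : src x = src v by rewrite /src E /arev tgtu.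
    by move: vq; rewrite -(leafc x xc sx) xq.
  have /eqP := next_cycle cc xc; rewrite -/(src _) E tgtu => /esym sx.
  have nx : next c' x = v by apply: leafc sx; rewrite mem_next.
  have nu : next c' u = v by rewrite /= eqxx.
  have := prev_next uc x; rewrite nx -nu (prev_next uc) => xu.
  by move: uq; rewrite xu xq.
(* If [v] does not return to the source of [u], then [u] is alone on its edge: [eps] vanishes by
   independence and centering, and no pair of nonzero weight contains [u]. *)
have [euv|neuv] := eqVneq (e v).2 (src u); last first.
  have nv : e v <> e u /\ e v <> arev (e u).
    split=> E; last by move: neuv; rewrite E /arev /= eqxx.
    by case/eqP: nuv; apply: leafc; rewrite ?mem_head // /src E.
  have -> : eps (u |: (v |: [set x in q])) = eps [set u] * eps (v |: [set x in q]).
    apply: epsM.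
    - by apply/subsetP => x; rewrite inE => /eqP->.
    - by apply/subsetP => x; rewrite !inE => /orP[/eqP->|/qY].
    - by rewrite disjoints1 !inE negb_or nuv.
    - move=> x y; rewrite !inE => /eqP-> /orP[/eqP->|yq].
        by have [h1 h2] := nv; split=> [/esym//|E]; apply: h2; rewrite E arevK.
      by have [h1 h2] := nq _ yq; split=> [/esym//|E]; apply: h2; rewrite E arevK.
  rewrite eps1 // mul0r (@Psum_eq0 _ _ _ _ u) ?setU11 // => B uB BV.
  apply/eqP; apply: contraT => /compat_weight_neq0[u1 [v1 [uv1 eB E1]]].
  have other y : y \in B -> y != u -> e y = arev (e u) -> False.
    move=> yB yu ey; have := subsetP BV _ yB; rewrite !inE (negbTE yu) /= => /orP[/eqP yv|yq].
      by have [_] := nv; rewrite -yv.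
    by have [_] := nq _ yq.
  have nuv1 : u1 != v1 by rewrite neq_ltn uv1.
  move: uB; rewrite eB !inE => /orP[]/eqP eu1; subst u; exfalso.
    by apply: (other v1) => //; rewrite ?eB ?set22 // eq_sym.
  by apply: (other u1) => //; rewrite ?eB ?set21 // E1 arevK.
have evu : e v = arev (e u) by rewrite ev eu euv.
have nq' x : x \in q -> forall y, y \in [set u; v] -> e x <> e y /\ e x <> arev (e y).
  move=> /nq[h1 h2] y; rewrite !inE => /orP[]/eqP-> //.
  by rewrite evu arevK.
have -> : u |: (v |: [set x in q]) = [set u; v] :|: [set x in q] by rewrite setUA.
have dq : [disjoint [set u; v] & [set x in q]].
  rewrite -setI_eq0; apply/eqP/setP => x; rewrite !inE; apply/negbTE/negP.
  by case/andP=> /orP[]/eqP->; [rewrite (negbTE uq) | rewrite (negbTE vq)].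
have -> : eps ([set u; v] :|: [set x in q]) = eps [set u; v] * eps [set x in q].
  apply: epsM => //.
  - by apply/subsetP => x; rewrite !inE => /orP[]/eqP->.
  - by apply/subsetP => x; rewrite inE => /qY.
  - move=> x y xuv; rewrite inE => yq; have [h1 h2] := nq' _ yq _ xuv.
    by split=> [/esym//|E]; apply: h2; rewrite E arevK.
have -> : Psum w ([set u; v] :|: [set x in q]) =
    w [set u; v] * Psum w (([set u; v] :|: [set x in q]) :\: [set u; v]).
  apply: Psum_recursion; first exact: subsetUl.
    by apply/set0Pn; exists u; rewrite set21.
  move=> B BV /pred0Pn[x /= /andP[xB xuv]] nB.
  apply/eqP; apply: contraT => /compat_weight_neq0[u1 [v1 [uv1 eB E1]]].
  have BV' y : y \in B -> (y \in [set u; v]) || (y \in q).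
    by move=> yB; have := subsetP BV _ yB; rewrite !inE.
  exfalso; move: xB; rewrite eB !inE => /orP[]/eqP ex; subst x.
    have := BV' v1; rewrite eB set22 => /(_ isT)/orP[v1uv|v1q]; last first.
      by have [_] := nq' _ v1q _ xuv.
    case/eqP: nB; rewrite eB; have nuv1 : u1 != v1 by rewrite neq_ltn uv1.
    by move: xuv v1uv; rewrite !inE => /orP[]/eqP e1 /orP[]/eqP e2;
      rewrite e1 e2 ?eqxx // in nuv1 *; rewrite setUC.
  have := BV' u1; rewrite eB set21 => /(_ isT)/orP[u1uv|u1q]; last first.
    by have [_] := nq' _ u1q _ xuv; rewrite E1 arevK.
  case/eqP: nB; rewrite eB; have nuv1 : u1 != v1 by rewrite neq_ltn uv1.
  by move: xuv u1uv; rewrite !inE => /orP[]/eqP e1 /orP[]/eqP e2;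
    rewrite e1 e2 ?eqxx // in nuv1 *; rewrite setUC.
have -> : ([set u; v] :|: [set x in q]) :\: [set u; v] = [set x in q].
  by rewrite setDUl setDv set0U; apply/setDidPl; rewrite disjoint_sym.
rewrite (eps2_sym uY vY nuv evu); congr (_ * _); apply: IH => //.
- by move: sk; rewrite sz; exact: ltnW.
- case Eq: q => [//|x q']; move: cc; rewrite /c' Eq /= !rcons_path => /and3P[_ /eqP svx /andP[-> hx]].
  by rewrite /step (eqP hx) -svx euv /= eqxx.
(* Two steps are gone but only one vertex, [src v]: the source of [u] is also that of the next step.
   So the strict inequality persists. *)
case Eq: q => [//|x0 q0]; rewrite -Eq; apply/orP; right.
move: lt2; rewrite sz srcE.
have -> : src u |: (src v |: srcs q) = src v |: srcs q.
  rewrite setUCA; congr (_ |: _); apply/setUidPr; rewrite sub1set.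
  move: cc; rewrite /c' Eq /= => /and3P[_ /eqP svx _]; apply/imsetP; exists x0; rewrite ?mem_head //.
  by rewrite -euv svx.
rewrite cardsU1 mulnDr => h1.
have h2 : (2 * (src v \notin srcs q) <= 2)%N by case: (_ \notin _).
by rewrite -(ltn_add2l 2); apply: leq_trans h1 _; rewrite leq_add2r.
Qed.
End Factorization.
End ClosedWalks.

(** * Traces of words in matrix units and diagonal matrices *)

Lemma big_enum_nc (R : Type) (op : R -> R -> R) (x : R) (I : finType) (A : {pred I})
    (f : I -> R) :
  \big[op/x]_(i <- enum A) f i = \big[op/x]_(i in A) f i.
Proof. by rewrite -[RHS]big_filter deprecated_filter_index_enum. Qed.

Section MatrixWords.
Variables (n N : nat) (F : numFieldType).
Local Notation X := 'I_n.
Local Notation T := 'I_N.+1.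
Variables (Ys : {set X}) (D : X -> 'rV[F]_N.+1).
Implicit Types (V S : {set X}) (e : {ffun X -> T * T}) (s t : seq X).

(** The random matrices are expanded in matrix units, the unit at position [i] being the step [e i]
    of a walk; the diagonal letters are kept. *)
Definition letter_mx e i : 'M[F]_N.+1 :=
  if i \in Ys then delta_mx (e i).1 (e i).2 else diag_mx (D i).

Definition word_tr e V : F := \tr (\prod_(i in V) letter_mx e i).

Fixpoint walk e (p : T) s (q : T) : bool :=
  if s is i :: s' then ((e i).1 == p) && walk e (e i).2 s' q else p == q.

Lemma walk_cycle e p s : walk e p s p -> path.cycle (step e) s.
Proof.
case: s => //= i s /andP[/eqP <-].
suff h j s' : walk e (e j).2 s' (e i).1 -> path (step e) j (rcons s' i) by apply: h.
elim: s' j => [|k s' IH] j /=; first by move/eqP=> E; rewrite /step E eqxx.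
by case/andP=> /eqP Ek /IH->; rewrite /step Ek eqxx.
Qed.

Variable K : F.
Hypothesis K1 : 1 <= K.
Hypothesis DK : forall i a, i \notin Ys -> `|D i 0 a| <= K.

(** Diagonal letters do not move the vertex and cost a factor of at most [K]; the matrix units make
    the entry vanish unless the edges form a walk from [p] to [q]. The exponent also counts the
    matrix units, which is harmless for [K] at least 1. *)
Lemma walk_entry_bound e t p q :
  `|(\prod_(i <- t) letter_mx e i) p q| <=
    K ^+ size t *+ walk e p [seq i <- t | i \in Ys] q.
Proof.
have K0 : 0 <= K by apply: le_trans K1.
elim: t p => [|i t IH] p; first by rewrite big_nil mxE expr0 /=; case: (p == q); rewrite /= ?mulr1n ?mulr0n ?normr1 ?normr0.
rewrite big_cons /letter_mx /=; case: ifP => iY /=.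
  rewrite -mulmxE mxE (bigD1 (e i).2) //= big1 ?addr0; last first.
    by move=> k nk; rewrite mxE (negbTE nk) andbF mul0r.
  rewrite mxE eqxx andbT eq_sym; case: eqP => _ /=; last by rewrite mul0r normr0.
  rewrite mul1r; apply: le_trans (IH _) _; apply: ler_wMn2r.
  by rewrite exprS ler_peMl // exprn_ge0.
rewrite -mulmxE mul_diag_mx mxE normrM exprS -mulrnAr.
by apply: ler_pM => //; apply: DK; rewrite iY.
Qed.

Lemma enum_setI V : [seq i <- enum V | i \in Ys] = enum (V :&: Ys).
Proof.
rewrite /enum_mem -filter_predI; apply: eq_filter => i /=.
by rewrite !inE andbC.
Qed.

(** Only the source of the first random step contributes to the trace, so no sum over the starting
    vertex is left. *)
Lemma word_tr_bound e V : V :&: Ys != set0 ->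
  `|word_tr e V| <= K ^+ n *+ path.cycle (step e) (enum (V :&: Ys)).
Proof.
have K0 : 0 <= K by apply: le_trans K1.
move=> VY; rewrite /word_tr -big_enum_nc /mxtrace.
have [i [s Es]] : exists i s, enum (V :&: Ys) = i :: s.
  case Es: (enum (V :&: Ys)) => [|i s]; last by exists i, s.
  by move/set0Pn: VY => [x]; rewrite -mem_enum Es.
rewrite (bigD1 (e i).1) //= [X in _ + X]big1 ?addr0; last first.
  move=> p np; apply: normr0_eq0; apply: le_anti; rewrite normr_ge0 andbT; apply: le_trans (walk_entry_bound _ _ _ _) _.
  by rewrite enum_setI Es /= eq_sym (negbTE np).
apply: le_trans (walk_entry_bound _ _ _ _) _; rewrite enum_setI.
have sK : K ^+ size (enum V) <= K ^+ n.
  by apply: ler_weXn2l => //; rewrite -cardE -[X in (_ <= X)%N](card_ord n) max_card.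
apply: le_trans (ler_wMn2r _ sK) _.
case: (boolP (walk _ _ _ _)) => [/walk_cycle->//|_]; rewrite mulr0n.
by rewrite mulrn_wge0 // exprn_ge0.
Qed.

End MatrixWords.

Section Counting.
Variables (n : nat) (T : finType).
Local Notation X := 'I_n.

(** Positions outside [S] are frozen at [x0], so that walks on different sets of positions live in
    one finite type. *)
Definition supported (x0 : T * T) (S : {set X}) (e : {ffun X -> T * T}) : bool :=
  [forall i, (i \notin S) ==> (e i == x0)].

(* A closed walk through the positions of S is determined by its sources; those
   with at most k distinct sources factor through 'I_k. *)
Lemma card_closed_walks (S : {set X}) (x0 : T * T) k : S != set0 ->
  (#|[set e : {ffun X -> T * T} | [&& path.cycle (step e) (enum S),
       (#|srcs e (enum S)| <= k)%N & supported x0 S e]]| <= #|T| ^ k * k ^ n)%N.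
Proof.
move=> S_neq0; set Bad := [set e | _].
pose G : finType := ({ffun 'I_k -> T} * {ffun X -> 'I_k})%type.
pose mk (gh : G) : {ffun X -> T * T} := [ffun i => if i \in S then
  (gh.1 (gh.2 i), gh.1 (gh.2 (next (enum S) i))) else x0].
have [->|S0] := eqVneq Bad set0; first by rewrite cards0.
suff sub : Bad \subset mk @: [set: G].
  apply: leq_trans (subset_leq_card sub) _; apply: leq_trans (leq_imset_card _ _) _.
  by rewrite cardsT card_prod !card_ffun !card_ord.
apply/subsetP => e; rewrite inE => /and3P[ce ck /forallP eS].
pose s := enum S.
have srcin i : i \in S -> src e i \in srcs e s.
  by move=> iS; apply/imsetP; exists i; rewrite // mem_enum.
have [i0 i0S] := set0Pn _ S_neq0.
have k0 : (0 < k)%N by apply: leq_trans ck; apply/card_gt0P; exists (src e i0); exact: srcin.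
(* Sources are numbered by their place in the list of sources. The default [Ordinal k0] is not
   reached on them, since they are at most [k] in number. *)
pose emb (a : T) : 'I_k := insubd (Ordinal k0) (index a (enum (srcs e s))).
pose g : {ffun 'I_k -> T} := [ffun j => nth x0.1 (enum (srcs e s)) (val j)].
have gemb a : a \in srcs e s -> g (emb a) = a.
  move=> aS; rewrite ffunE /emb val_insubd.
  have lt : (index a (enum (srcs e s)) < k)%N.
    by apply: leq_trans ck; rewrite cardE index_mem mem_enum.
  by rewrite lt nth_index // mem_enum.
apply/imsetP; exists (g, [ffun i => emb (src e i)]); rewrite ?inE //.
apply/ffunP => i; rewrite ffunE /=; case: ifP => iS; last first.
  by have := eS i; rewrite iS /= => /eqP.
have hE j : [ffun i => emb (src e i)] j = emb (src e j) by rewrite ffunE.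
rewrite !hE !gemb ?srcin //; last by rewrite -mem_enum mem_next mem_enum.
rewrite [LHS]surjective_pairing; congr (_, _).
by have /eqP := next_cycle ce (etrans (mem_enum _ _) iS).
Qed.

End Counting.

(** The law may be noncommutative: the index runs in increasing order, so cutting at [v] keeps the
    order of the factors. *)
Lemma big_ord_split (R : Type) (idx : R) (op : Monoid.law idx) n (P : pred 'I_n)
    (f : 'I_n -> R) (v : nat) :
  \big[op/idx]_(i < n | P i) f i =
  op (\big[op/idx]_(i < n | P i && (i < v)%N) f i)
     (\big[op/idx]_(i < n | P i && (v <= i)%N) f i).
Proof.
have enumE (Q : pred 'I_n) : \big[op/idx]_(i | Q i) f i = \big[op/idx]_(i <- enum 'I_n | Q i) f i.
  by rewrite /index_enum unlock -enumT.
rewrite !enumE -[in RHS](cat_take_drop v (enum 'I_n)) -[in LHS](cat_take_drop v (enum 'I_n)).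
have lt i : i \in take v (enum 'I_n) -> (i < v)%N.
  move/(map_f val); rewrite map_take val_enum_ord take_iota mem_iota add0n.
  by move=> /leq_trans; apply; exact: geq_minl.
have ge i : i \in drop v (enum 'I_n) -> (v <= i)%N.
  by move/(map_f val); rewrite map_drop val_enum_ord drop_iota mem_iota add0n => /andP[].
rewrite !big_cat /=; congr (op _ _).
  rewrite [X in _ = op _ X]big_seq_cond [X in _ = op _ X]big_pred0 ?Monoid.mulm1; last first.
    by move=> i; apply/negP => /and3P[/ge]; rewrite leqNgt => /negbTE->.
  rewrite big_seq_cond [RHS]big_seq_cond; apply: eq_bigl => i.
  by case: (boolP (i \in _)) => //= /lt->; rewrite andbT.
rewrite [X in _ = op X _]big_seq_cond [X in _ = op X _]big_pred0 ?Monoid.mul1m; last first.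
  by move=> i; apply/negP => /and3P[/lt]; rewrite ltnNge => /negbTE->.
rewrite big_seq_cond [RHS]big_seq_cond; apply: eq_bigl => i.
by case: (boolP (i \in _)) => //= /ge->; rewrite andbT.
Qed.

Lemma big_ord_split1 (R : Type) (idx : R) (op : Monoid.law idx) n (P : pred 'I_n)
    (f : 'I_n -> R) (v : 'I_n) : P v ->
  \big[op/idx]_(i < n | P i && (v <= i)%N) f i =
  op (f v) (\big[op/idx]_(i < n | P i && (v < i)%N) f i).
Proof.
move=> Pv; rewrite (big_ord_split _ _ _ v.+1) (big_pred1 v); last first.
  move=> i /=; rewrite ltnS -andbA -eqn_leq eq_sym; case: eqP => [/val_inj->|]; rewrite ?andbF //.
    by rewrite Pv eqxx.
  by move=> ne; apply/esym/eqP => E; apply: ne; rewrite E.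
congr (op _ _); apply: eq_bigl => i.
by case: (P i) => //=; case: (ltngtP v i).
Qed.

Section PairContraction.
Variables (n N : nat) (F : comPzRingType).
Local Notation X := 'I_n.
Local Notation T := 'I_N.+1.

(** E_ab M E_ba is M_bb E_aa, and the sum over a and b is scalar. This is why a contracted pair
    splits one trace into two. *)
Lemma delta_sandwich (M : 'M[F]_N.+1) :
  \sum_(x : T * T) delta_mx x.1 x.2 * M * delta_mx x.2 x.1 = (\tr M)%:M :> 'M[F]_N.+1.
Proof.
apply/matrixP => i j; rewrite summxE !mxE.
transitivity (\sum_(x : T * T) (M x.2 x.2 *+ (x.1 == i)) *+ (i == j)).
  apply: eq_bigr => -[a b] _ /=; rewrite -!mulmxE mxE (bigD1 b) //= big1 ?addr0; last first.
    by move=> k nk; rewrite [X in _ * X]mxE (negbTE nk) mulr0.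
  rewrite [X in _ * X]mxE eqxx /= mxE (bigD1 b) //= big1 ?addr0; last first.
    by move=> k nk; rewrite [X in X * _]mxE (negbTE nk) andbF mul0r.
  rewrite mxE eqxx andbT (eq_sym a i).
  case: (eqVneq i a) => [->|_]; last by rewrite !mul0r mulr0n mul0rn.
  by rewrite mul1r (eq_sym a j) mulr_natr mulr1n.
rewrite sumrMnl; congr (_ *+ _).
rewrite -(pair_bigA _ (fun a b => M b b *+ (a == i))) /=.
rewrite (bigD1 i) //= [X in _ + X]big1 ?addr0; last first.
  by move=> a /negbTE->; apply: big1 => b _.
by under eq_bigr do rewrite eqxx mulr1n.
Qed.

(** The word reads A E_ab M E_ba B with M the product in between; the sandwich sums to the trace of
    M, and A B is the word with the pair and its interior removed. *)
Lemma contract_pair (f : X -> 'M[F]_N.+1) (V : {set X}) (v v' : X) : (v < v')%N ->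
  v \in V -> v' \in V ->
  \sum_(x : T * T) \tr (\prod_(i in V)
      (if i == v then delta_mx x.1 x.2 else if i == v' then delta_mx x.2 x.1 else f i)) =
  \tr (\prod_(i in [set i in V | (v < i < v')%N]) f i) *
  \tr (\prod_(i in V :\: ([set v; v'] :|: [set i in V | (v < i < v')%N])) f i).
Proof.
move=> vv' vV v'V; set In := [set i in V | _]; set V' := V :\: _.
pose A := \prod_(i in V | (i < v)%N) f i.
pose B := \prod_(i in V | (v' < i)%N) f i.
have splitV g : \prod_(i in V) g i =
    \prod_(i in V | (i < v)%N) g i * (g v * (\prod_(i in In) g i * (g v' *
    \prod_(i in V | (v' < i)%N) g i))) :> 'M[F]_N.+1.
  rewrite (@big_ord_split _ _ _ _ (fun i => i \in V) _ v).
  rewrite (@big_ord_split1 _ _ _ _ (fun i => i \in V)) //; congr (_ * (_ * _)).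
  rewrite (@big_ord_split _ _ _ _ (fun i => (i \in V) && (v < i)%N) _ v'); congr (_ * _).
    by apply: eq_bigl => i; rewrite inE andbA.
  transitivity (\prod_(i in V | (v' <= i)%N) g i).
    apply: eq_bigl => i; case: (i \in V) => //=; case: leqP => h; rewrite ?andbF //.
    by apply/esym/negbTE; rewrite -ltnNge; exact: leq_ltn_trans h vv'.
  by rewrite (@big_ord_split1 _ _ _ _ (fun i => i \in V)).
have AB : \prod_(i in V') f i = A * B.
  rewrite (@big_ord_split _ _ _ _ (fun i => i \in V') _ v); congr (_ * _); apply: eq_bigl => i; rewrite !inE.
    case: (i \in V) => /=; last by rewrite andbF.
    by rewrite andbT; case: eqP => [->|_]; case: eqP => [->|_] /=; lia.
  case: (i \in V) => /=; last by rewrite andbF.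
  rewrite andbT; case: (eqVneq i v) => [->|nv] /=; first lia.
  case: (eqVneq i v') => [->|nv'] /=; first lia.
  have : (i : nat) != v by []. have : (i : nat) != v' by [].
  lia.
transitivity (\sum_(x : T * T) \tr (A * (delta_mx x.1 x.2 * (\prod_(i in In) f i) * delta_mx x.2 x.1) * B)).
  apply: eq_bigr => x _; congr (\tr _); rewrite splitV eqxx.
  have -> : (v' == v) = false by apply/negbTE; rewrite neq_ltn vv' orbT.
  rewrite eqxx !mulrA; congr (_ * _ * _ * _ * _).
  - by apply: eq_bigr => i /andP[_ iv]; rewrite !ifN // neq_ltn ?iv ?(ltn_trans iv vv').
  - by apply: eq_bigr => i; rewrite inE => /and3P[_ vi iv]; rewrite !ifN // neq_ltn ?iv ?vi ?orbT.
  - by apply: eq_bigr => i /andP[_ iv]; rewrite !ifN // neq_ltn ?iv ?(ltn_trans vv' iv) orbT.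
rewrite -raddf_sum -big_distrl -big_distrr /= delta_sandwich AB.
by rewrite -!mulmxE mul_mx_scalar -scalemxAl mxtraceZ.
Qed.

End PairContraction.

Section PairingSums.
Variables (n N : nat) (F : numFieldType).
Local Notation X := 'I_n.
Local Notation T := 'I_N.+1.
Variables (Ys : {set X}) (D : X -> 'rV[F]_N.+1) (c : X -> X -> F) (x0 : T * T).
Implicit Types (V S : {set X}) (e : {ffun X -> T * T}) (pi : {set {set X}}).

Definition upd e u x : {ffun X -> T * T} := [ffun i => if i == u then x else e i].

Lemma sum_supported_split S u (Phi : {ffun X -> T * T} -> F) : u \notin S ->
  \sum_(e | supported x0 (u |: S) e) Phi e =
  \sum_(e | supported x0 S e) \sum_x Phi (upd e u x).
Proof.
move=> uS; rewrite pair_big /=.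
rewrite (reindex_onto (fun p : {ffun X -> T * T} * (T * T) => upd p.1 u p.2)
  (fun e => (upd e u x0, e u))) /=; last first.
  by move=> e _; apply/ffunP => i; rewrite !ffunE; case: eqP => [->|].
apply: eq_bigl => -[e x] /=; rewrite andbT ffunE eqxx.
apply/andP/idP => [[/forallP se /eqP[eu]]|/forallP se].
  apply/forallP => i; apply/implyP => iS; case: (eqVneq i u) => [->|iu].
    by have /ffunP/(_ u) := eu; rewrite !ffunE eqxx => <-.
  by have := se i; rewrite !inE negb_or iu iS /= ffunE (negbTE iu).
split; last first.
  apply/eqP; congr pair; apply/ffunP => i; rewrite !ffunE; case: eqP => // ->.
  by have := se u; rewrite uS => /eqP.
apply/forallP => i; apply/implyP; rewrite !inE negb_or => /andP[iu iS].
by rewrite ffunE (negbTE iu); have := se i; rewrite iS.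
Qed.

Lemma eq_compat_weight e e' (B : {set X}) : {in B, e =1 e'} ->
  compat_weight e c B = compat_weight e' c B.
Proof.
move=> ee; apply: eq_bigr => u _; apply: eq_bigl => v.
case: (eqVneq B [set u; v]) => [E|]; last by rewrite !andbF.
by rewrite !ee // E ?set21 ?set22.
Qed.

(** The contribution of one pairing [pi] to the unnormalized trace, the counterpart of
    [NCsum_at]. *)
Definition Wsum pi V : F :=
  \sum_(e | supported x0 (V :&: Ys) e)
     (\prod_(B in pi) compat_weight e c B) * word_tr Ys D e V.

(** The weight of [B0] forces the edge at [v'] to be the reverse of that at [v], and summing over
    this edge is [contract_pair]. The interior has diagonal letters only, so its trace does not
    depend on the walk and factors out. *)
Lemma Wsum_recursion pi V (v v' : X) (B0 := [set v; v'])
    (In := [set i in V | (v < i < v')%N]) :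
  (v < v')%N -> v \in V :&: Ys -> v' \in V :&: Ys -> B0 \in pi -> trivIset pi ->
  In \subset ~: Ys ->
  Wsum pi V = c v v' * \tr (\prod_(i in In) diag_mx (D i)) *
              Wsum (pi :\ B0) (V :\: (B0 :|: In)).
Proof.
move=> vv' vVY v'VY B0pi tpi InY; set V' := V :\: _.
have [vV vY] := setIP vVY; have [v'V v'Y] := setIP v'VY.
have InYF i : i \in In -> i \in Ys = false.
  by move/(subsetP InY); rewrite inE => /negbTE.
have nvv' : v' != v by rewrite neq_ltn vv' orbT.
have VYE : V :&: Ys = v |: (v' |: (V' :&: Ys)).
  apply/setP => i; rewrite !inE; have := InYF i; rewrite !inE.
  case: (eqVneq i v) => [->|_]; first by rewrite vV vY.
  case: (eqVneq i v') => [->|_]; first by rewrite v'V v'Y.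
  by case: (i \in V) => //=; case: (_ && _) => //= ->.
have nv : v \notin v' |: (V' :&: Ys) by rewrite !inE eq_sym (negbTE nvv') eqxx.
have nv' : v' \notin V' :&: Ys by rewrite !inE eqxx orbT.
rewrite /Wsum VYE (sum_supported_split _ nv) (sum_supported_split _ nv').
rewrite big_distrr /=; apply: eq_bigr => e se.
pose wr := \prod_(B in pi :\ B0) compat_weight e c B.
transitivity (\sum_y \sum_x (c v v' *+ (y == arev x)) * wr *
   word_tr Ys D (upd (upd e v' y) v x) V).
  apply: eq_bigr => y _; apply: eq_bigr => x _; congr (_ * _).
  rewrite (big_setD1 B0) //= compat_weight_set2 //; congr (_ *+ nat_of_bool _ * _).
    by rewrite !ffunE eqxx (negbTE nvv') eqxx.
  apply: eq_bigr => B; rewrite !inE => /andP[nB Bpi]; apply: eq_compat_weight => i iB.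
  have /trivIsetP/(_ _ _ Bpi B0pi nB)/pred0P/(_ i)/= := tpi.
  by rewrite iB !inE !ffunE /=; do 2!case: eqP.
rewrite exchange_big /=.
transitivity (\sum_(x : T * T) c v v' * wr * \tr (\prod_(i in V)
      (if i == v then delta_mx x.1 x.2 else if i == v' then delta_mx x.2 x.1
       else letter_mx Ys D e i))).
  apply: eq_bigr => x _; rewrite (bigD1 (arev x)) //= big1 ?addr0; last first.
    by move=> y /negbTE->; rewrite mulr0n !mul0r.
  rewrite eqxx mulr1n; congr (_ * \tr _); apply: eq_bigr => i _.
  rewrite /letter_mx !ffunE; case: (eqVneq i v) => [->|_]; first by rewrite vY.
  by case: (eqVneq i v') => [->|_]; first by rewrite v'Y.
rewrite -big_distrr /= contract_pair // -/In -/V' -!mulrA; congr (_ * _).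
rewrite mulrCA; congr (\tr _ * _).
by apply: eq_bigr => i /InYF iY; rewrite /letter_mx iY.
Qed.
End PairingSums.

(** The enumeration of [S] is increasing, so the cyclic predecessor of an element other than the
    first is its nearest smaller neighbour in [S]. *)
Lemma enum_ord_next n (S : {set 'I_n}) (v : 'I_n) : v \in behead (enum S) ->
  exists2 u, u \in S & [/\ (u < v)%N, next (enum S) u = v &
    forall x, x \in S -> ~~ (u < x < v)%N].
Proof.
have pw : pairwise (fun a b : 'I_n => (a < b)%N) (enum S).
  have -> : enum S = [seq i <- enum 'I_n | i \in S].
    by rewrite {1}/enum_mem -enumT.
  apply: pairwise_filter.
  rewrite -(pairwise_map val ltn) val_enum_ord -sorted_pairwise; last exact: ltn_trans.
  exact: iota_ltn_sorted.
have us := enum_uniq S; have memS x : (x \in enum S) = (x \in S) by rewrite mem_enum.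
move: (enum S) pw us memS => s pw us memS vs.
have [s1 [u [s2 Es]]] : exists s1 u s2, s = s1 ++ [:: u, v & s2].
  case: s vs {pw us memS} => //= h t; case/splitPr => p1 p2; case/lastP: p1 => [|p1 u].
    by exists [::], h, p2.
  by exists (h :: p1), u, p2; rewrite cat_rcons.
exists u; first by rewrite -memS Es mem_cat inE eqxx orbT.
move: pw; rewrite {1}Es pairwise_cat => /and3P[/allrelP h1 _ /= /and3P[/andP[uv /allP uq] /allP vq _]].
split=> //.
  have -> : next s u = next (rot (size s1) s) u by rewrite next_rot.
  by rewrite Es rot_size_cat /= eqxx.
move=> x; rewrite -memS Es mem_cat !inE => /or4P[xs1|/eqP->|/eqP->|xs2].
- have : (x < u)%N by apply: h1; rewrite // inE eqxx.
  by move=> xu; rewrite negb_and -leqNgt ltnW.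
- by rewrite ltnn.
- by rewrite ltnn andbF.
- by have := vq _ xs2; rewrite negb_and -!leqNgt => /ltnW->; rewrite orbT.
Qed.

Section Bounds.
Variables (n N : nat) (F : numFieldType).
Local Notation X := 'I_n.
Local Notation T := 'I_N.+1.
Variables (Ys : {set X}) (D : X -> 'rV[F]_N.+1) (c : X -> X -> F) (x0 : T * T).
Implicit Types (V S : {set X}) (e : {ffun X -> T * T}) (pi : {set {set X}}).
(** [r] is the square root of the size, which turns half-integer powers of the size into integer
    ones; [K] bounds the diagonal entries and [Cc] the rescaled covariances. *)
Variables (K r Cc : F).
Hypothesis K1 : 1 <= K.
Hypothesis DK : forall i a, i \notin Ys -> `|D i 0 a| <= K.
Hypothesis r_gt0 : 0 < r.
Hypothesis r2 : r ^+ 2 = N.+1%:R.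
Hypothesis Cc1 : 1 <= Cc.
Hypothesis c_bound : forall u v, `|c u v| <= Cc * r^-1 ^+ 2.

Lemma r_ge1 : 1 <= r.
Proof. by rewrite -(@expr_ge1 _ 2) ?(ltW r_gt0) // r2 ler1n. Qed.

(** Only closed walks with at most (m+1)/2 vertices survive, where m is the number of random
    positions. [card_closed_walks] counts them, and each term is at most [A * K ^+ n]. *)
Lemma sum_word_tr_bound V (G : {ffun X -> T * T} -> F) (A : F) : 0 <= A ->
  V :&: Ys != set0 ->
  (forall e, supported x0 (V :&: Ys) e -> `|G e| <= A) ->
  (forall e, path.cycle (step e) (enum (V :&: Ys)) ->
     (#|V :&: Ys|.+1 < 2 * #|srcs e (enum (V :&: Ys))|)%N -> G e = 0) ->
  `|\sum_(e | supported x0 (V :&: Ys) e) G e * word_tr Ys D e V| <=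
    A * K ^+ n * (n ^ n)%:R * r ^+ #|V :&: Ys|.+1.
Proof.
move=> A0 VY0 GA G0; set S := V :&: Ys in VY0 GA G0 *; set m := #|S|.
have K0 : 0 <= K by apply: le_trans K1.
(* The largest number of vertices with 2k at most m + 1; rounding down costs nothing, as r^(2k) is
   at most r^(m+1). *)
pose k := m.+1./2.
pose Bad := [set e : {ffun X -> T * T} | [&& path.cycle (step e) (enum S),
       (#|srcs e (enum S)| <= k)%N & supported x0 S e]].
apply: le_trans (ler_norm_sum _ _ _) _.
apply: (@le_trans _ _ (\sum_(e in Bad) A * K ^+ n)).
  rewrite big_mkcond [X in _ <= X]big_mkcond; apply: ler_sum => e _; rewrite inE.
  case: (boolP (supported x0 S e)) => se; last by rewrite !andbF.
  rewrite andbT normrM; have wb := word_tr_bound K1 DK e VY0.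
  case: (boolP (path.cycle (step e) (enum S))) wb => [ce|_]; last first.
    by rewrite mulr0n normr_le0 => /eqP->; rewrite normr0 mulr0.
  rewrite mulr1n => wb; case: leqP => kb; first by apply: ler_pM => //; exact: GA.
  rewrite G0 ?normr0 ?mul0r //; rewrite -/m; apply: (@leq_trans (2 * k.+1)).
    rewrite -[X in (X < _)%N]odd_double_half -/k mul2n doubleS ltnS -[X in (_ <= X)%N]add1n.
    by rewrite leq_add2r leq_b1.
  by rewrite leq_mul2l.
rewrite sumr_const -[X in X <= _]mulr_natr -[X in _ <= X]mulrA ler_wpM2l ?mulr_ge0 ?exprn_ge0 //.
have m0 : (0 < m)%N by rewrite card_gt0.
have mn : (m <= n)%N by rewrite -[X in (_ <= X)%N](card_ord n) max_card.
have kn : (k <= n)%N.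
  apply: leq_trans mn; rewrite /k; move: m0; case: (m) => // j _.
  by rewrite -{2}(half_double j.+1); apply: half_leq; rewrite -addnn; lia.
have cB : (#|Bad| <= n ^ n * N.+1 ^ k)%N.
  have := card_closed_walks x0 k VY0; rewrite -/Bad card_ord => h; apply: leq_trans h _.
  by rewrite mulnC leq_mul // leq_exp2r // (leq_trans m0 mn).
rewrite -(ler_nat F) natrM in cB; apply: le_trans cB _.
rewrite ler_wpM2l // natrX -r2 -exprM ler_weXn2l ?r_ge1 //.
by rewrite mul2n -[X in (_ <= X)%N](odd_double_half m.+1) leq_addl.
Qed.

(** Nonzero weights occur on pairs only, so the factor r^-2 can be written with exponent [#|B|];
    these exponents add up over the blocks of a partition. *)
Lemma compat_weight_bound e B : `|compat_weight e c B| <= Cc * r^-1 ^+ #|B|.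
Proof.
have r0 : 0 <= r^-1 by rewrite invr_ge0 ltW.
have Cc0 : 0 <= Cc by apply: le_trans Cc1.
have [->|/compat_weight_neq0[u [v [uv -> E]]]] := eqVneq (compat_weight e c B) 0.
  by rewrite normr0 mulr_ge0 ?exprn_ge0.
by rewrite compat_weight_set2 // E eqxx mulr1n cards2 neq_ltn uv.
Qed.

Lemma prod_compat_weight_bound e p S : partition p S ->
  `|\prod_(B in p) compat_weight e c B| <= Cc ^+ n * r^-1 ^+ #|S|.
Proof.
move=> pS; have Cc0 : 0 <= Cc by apply: le_trans Cc1.
rewrite normr_prod; apply: (@le_trans _ _ (\prod_(B in p) (Cc * r^-1 ^+ #|B|))).
  by apply: ler_prod => B _; rewrite normr_ge0 compat_weight_bound.
rewrite big_split /= prodr_const -expr_sum -(card_partition pS).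
rewrite ler_wpM2r ?exprn_ge0 ?invr_ge0 ?(ltW r_gt0) // ler_weXn2l //.
apply: (@leq_trans #|S|); last by rewrite -[X in (_ <= X)%N](card_ord n) max_card.
rewrite (card_partition pS) -sum1_card; apply: leq_sum => B Bp.
by rewrite card_gt0 (partition_neq0 pS Bp).
Qed.

Lemma Psum_bound e S :
  `|Psum (compat_weight e c) S| <= #|{set {set X}}|%:R * (Cc ^+ n * r^-1 ^+ #|S|).
Proof.
have Cc0 : 0 <= Cc by apply: le_trans Cc1.
have r0 : 0 <= r^-1 by rewrite invr_ge0 ltW.
apply: le_trans (ler_norm_sum _ _ _) _; rewrite mulr_natl -sumr_const big_mkcond.
apply: ler_sum => p _; case: ifP => [/prod_compat_weight_bound h|_]; first exact: h.
by rewrite mulr_ge0 ?exprn_ge0.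
Qed.

(** When the weight is nonzero, the partner of a step [v] runs back to the source of [v], so the
    step following the partner has that source too. It can be [v] itself only if the partner
    immediately precedes [v], an adjacent pair. Hence there is no leaf, and [card_srcs_no_leaf]
    bounds the number of vertices. *)
Lemma Wsum_nonadjacent_bound pi V : V :&: Ys != set0 -> partition pi (V :&: Ys) ->
  (forall B, B \in pi -> #|B| = 2%N) ->
  (forall v v' : X, (v < v')%N -> [set v; v'] \in pi ->
     ~~ ([set x in V | (v < x < v')%N] \subset ~: Ys)) ->
  `|Wsum Ys D c x0 pi V| <=
    Cc ^+ n * r^-1 ^+ #|V :&: Ys| * K ^+ n * (n ^ n)%:R * r ^+ #|V :&: Ys|.+1.
Proof.
move=> VY0 pY pi2 nadj; apply: sum_word_tr_bound => //.
- by rewrite mulr_ge0 ?exprn_ge0 ?invr_ge0 ?(ltW r_gt0) // (le_trans _ Cc1).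
- by move=> e _; apply: prod_compat_weight_bound.
move=> e ce lt2; apply/eqP; apply: contraTT lt2 => w0; rewrite -leqNgt [X in (_ <= X.+1)%N]cardE.
apply: card_srcs_no_leaf; rewrite ?enum_uniq //; last by rewrite -cardE card_gt0.
move=> v vb; have [u uS [uv nu btw]] := enum_ord_next vb.
have vS : v \in V :&: Ys by rewrite -mem_enum; apply: mem_behead vb.
have /bigcupP[B Bpi vB] : v \in cover pi by rewrite (cover_partition pY).
have wB : compat_weight e c B != 0.
  by apply: contraNneq w0 => E; rewrite (bigD1 B) //= E mul0r.
have [v2 [v2B nv2 E]] : exists v2, [/\ v2 \in B, B = [set v; v2] & e v2 = arev (e v)].
  have [a [b [ab EB Eab]]] := compat_weight_neq0 wB.
  move: vB; rewrite EB !inE => /orP[]/eqP->; first by exists b; rewrite set22.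
  by exists a; rewrite set21 setUC Eab arevK.
have v2S : v2 \in V :&: Ys by rewrite -(cover_partition pY); apply/bigcupP; exists B.
exists (next (enum (V :&: Ys)) v2); first by rewrite mem_next mem_enum.
have v2e : v2 \in enum (V :&: Ys) by rewrite mem_enum.
apply/andP; split; last first.
  by have /eqP := next_cycle ce v2e; rewrite /src E => <-.
apply/eqP => nx; have := prev_next (enum_uniq (V :&: Ys)) v2.
rewrite nx -nu prev_next ?enum_uniq // => uv2; subst v2.
have := nadj u v uv; rewrite setUC -nv2 => /(_ Bpi)/subsetPn[x].
rewrite !inE negbK => /andP[xV uxv] xY.
have xS : x \in V :&: Ys by rewrite inE xV.
by have := btw x xS; rewrite uxv.
Qed.

(** After exchanging the sums the difference is a single sum over walks, with weight [eps] minus the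
    Wick sum [Psum]. By [eps_eq_Psum] this weight vanishes on walks with many vertices, so
    [sum_word_tr_bound] applies. *)
Lemma eps_sum_approx (eps : {ffun X -> T * T} -> {set X} -> F) (M : F) V :
  V :&: Ys != set0 -> 0 <= M ->
  (forall e, eps e set0 = 1) ->
  (forall e (S1 S2 : {set X}), S1 \subset Ys -> S2 \subset Ys -> [disjoint S1 & S2] ->
     (forall u v, u \in S1 -> v \in S2 -> e u <> e v /\ e u <> arev (e v)) ->
     eps e (S1 :|: S2) = eps e S1 * eps e S2) ->
  (forall e u, u \in Ys -> eps e [set u] = 0) ->
  (forall e u v, u \in Ys -> v \in Ys -> (u < v)%N -> e v = arev (e u) ->
     eps e [set u; v] = c u v) ->
  (forall e S, S \subset Ys -> `|eps e S| <= M * r^-1 ^+ #|S|) ->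
  `|\sum_(e | supported x0 (V :&: Ys) e) eps e (V :&: Ys) * word_tr Ys D e V -
    \sum_(pi | partition pi (V :&: Ys)) Wsum Ys D c x0 pi V| <=
   (M + #|{set {set X}}|%:R * Cc ^+ n) * r^-1 ^+ #|V :&: Ys| * K ^+ n * (n ^ n)%:R *
     r ^+ #|V :&: Ys|.+1.
Proof.
move=> VY0 M0 e0 eM e1 e2 eb.
rewrite exchange_big /= -sumrB.
under eq_bigr => e _ do rewrite -big_distrl /= -/(Psum _ _) -mulrBl.
have r0 : 0 <= r^-1 by rewrite invr_ge0 ltW.
have Cc0 : 0 <= Cc by apply: le_trans Cc1.
apply: sum_word_tr_bound => //.
- by rewrite mulr_ge0 ?exprn_ge0 // addr_ge0 // mulr_ge0 ?exprn_ge0.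
- move=> e _; apply: le_trans (ler_normB _ _) _; rewrite mulrDl lerD //.
    by apply: eb; exact: subsetIr.
  by rewrite -mulrA Psum_bound.
move=> e ce lt2.
have SE : [set x in enum (V :&: Ys)] = V :&: Ys by apply/setP => x; rewrite inE mem_enum.
rewrite -SE (@eps_eq_Psum _ _ e F c (eps e) Ys) ?subrr ?enum_uniq //.
- exact: eM.
- exact: e1.
- exact: e2.
- by move=> x; rewrite mem_enum => /setIP[].
by rewrite -cardE lt2 orbT.
Qed.
End Bounds.

(** * The limit of the trace moments *)

Section Limits.
Variable R : realType.
Local Notation C := R[i].
Implicit Types (f g : nat -> C) (a b l : C).

(* Convergence in C^o (see [tendstoP]), kept free of filters because unification
   through the topology of R[i] diverges. *)
Definition tendsto f l : Prop :=
  forall eps : R, 0 < eps -> exists N0, forall N, (N0 <= N)%N -> `|f N - l| <= eps%:C.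

Definition cabs (x : C) : R := complex.Re `|x|.

Lemma cabsE x : `|x| = (cabs x)%:C.
Proof. by rewrite /cabs normc_def. Qed.

Lemma cabs_ge0 x : 0 <= cabs x.
Proof. by rewrite /cabs normc_def /= sqrtr_ge0. Qed.

Lemma cabsD x y : cabs (x + y) <= cabs x + cabs y.
Proof. by rewrite -lecR [(_ + _)%:C]rmorphD /= -!cabsE ler_normD. Qed.

Lemma cabsM x y : cabs (x * y) = cabs x * cabs y.
Proof. by apply: (@complexI R); rewrite [RHS]rmorphM /= -!cabsE normrM. Qed.

Lemma tendsto_ext f g l : (forall N, f N = g N) -> tendsto f l -> tendsto g l.
Proof.
move=> fg fl eps e0; have [N0 h] := fl eps e0.
by exists N0 => N /h; rewrite fg.
Qed.

Lemma tendsto_cst a : tendsto (fun=> a) a.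
Proof. by move=> eps e0; exists 0%N => N _; rewrite subrr normr0 lecR ltW. Qed.

Lemma tendstoD f g a b : tendsto f a -> tendsto g b ->
  tendsto (fun N => f N + g N) (a + b).
Proof.
move=> fa gb eps e0; have e2 : 0 < eps / 2 by rewrite divr_gt0.
have [N1 h1] := fa _ e2; have [N2 h2] := gb _ e2.
exists (maxn N1 N2) => N; rewrite geq_max => /andP[/h1 l1 /h2 l2].
rewrite opprD addrACA (le_trans (ler_normD _ _)) //.
by rewrite [eps]splitr [(_ + _)%:C]rmorphD /= lerD.
Qed.

Lemma tendstoM f g a b : tendsto f a -> tendsto g b ->
  tendsto (fun N => f N * g N) (a * b).
Proof.
move=> fa gb eps e0.
pose k := cabs a + cabs b + 1.
have k0 : 0 < k by rewrite /k ltr_wpDl // addr_ge0 ?cabs_ge0.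
(* With both errors at most [d] the total is at most [d * k]; the minimum with 1 makes the product
   of the two errors linear in [d]. *)
pose d := Num.min 1 (eps / (2 * k)).
have d0 : 0 < d by rewrite lt_min ltr01 divr_gt0 // mulr_gt0.
have [N1 h1] := fa _ d0; have [N2 h2] := gb _ d0.
exists (maxn N1 N2) => N; rewrite geq_max => /andP[/h1 l1 /h2 l2].
have -> : f N * g N - a * b = (f N - a) * (g N - b) + ((f N - a) * b + a * (g N - b)).
  by ring.
move: l1 l2; rewrite !cabsE !lecR; set x := f N - a; set y := g N - b => l1 l2.
apply: le_trans (cabsD _ _) _.
apply: le_trans (lerD (lexx _) (cabsD _ _)) _; rewrite !cabsM.
have dl1 : d <= 1 by rewrite ge_min lexx.
have dle : d * (2 * k) <= eps by rewrite -ler_pdivlMr ?mulr_gt0 // ge_min lexx orbT.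
have xy : cabs x * cabs y <= d * 1.
  by apply: ler_pM; rewrite ?cabs_ge0 // (le_trans l2).
have xb : cabs x * cabs b <= d * cabs b by rewrite ler_wpM2r // cabs_ge0.
have ay : cabs a * cabs y <= d * cabs a by rewrite mulrC ler_wpM2r // cabs_ge0.
apply: le_trans (lerD xy (lerD xb ay)) _; rewrite -!mulrDr.
apply: le_trans dle; rewrite ler_wpM2l ?(ltW d0) // /k.
have := cabs_ge0 a; have := cabs_ge0 b; lra.
Qed.

Lemma tendsto_sum (I : Type) (s : seq I) (P : pred I) (f : I -> nat -> C) (l : I -> C) :
  (forall i, P i -> tendsto (f i) (l i)) ->
  tendsto (fun N => \sum_(i <- s | P i) f i N) (\sum_(i <- s | P i) l i).
Proof.
move=> fl; elim: s => [|i s IH].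
  by rewrite big_nil; apply: tendsto_ext (tendsto_cst 0) => N; rewrite big_nil.
rewrite big_cons; case: ifP => Pi; last first.
  by apply: tendsto_ext IH => N; rewrite big_cons Pi.
by apply: tendsto_ext (tendstoD (fl _ Pi) IH) => N; rewrite big_cons Pi.
Qed.

Lemma tendsto_unique f a b : tendsto f a -> tendsto f b -> a = b.
Proof.
move=> fa fb; apply/eqP; rewrite -subr_eq0 -normr_eq0 cabsE.
apply/eqP; congr (_%:C); apply/eqP; rewrite eq_le cabs_ge0 andbT.
apply/ler_addgt0Pr => eps e0; rewrite add0r.
have e2 : 0 < eps / 2 by rewrite divr_gt0.
have [N1 h1] := fa _ e2; have [N2 h2] := fb _ e2.
have := h1 (maxn N1 N2) (leq_maxl _ _); have := h2 (maxn N1 N2) (leq_maxr _ _).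
set x := f _ => l2 l1; rewrite -lecR -cabsE.
have -> : a - b = (x - b) - (x - a) by ring.
apply: le_trans (ler_normB _ _) _; rewrite [eps]splitr [(_ + _)%:C]rmorphD /=.
exact: lerD.
Qed.

Lemma tendsto0_bound f (k : R) : 0 <= k ->
  (exists N0, forall N, (N0 <= N)%N -> `|f N| <= (k * (Num.sqrt N.+1%:R)^-1)%:C) ->
  tendsto f 0.
Proof.
move=> k0 [N0 h] eps e0.
have e2 : 0 <= (k / eps) ^+ 2 by rewrite sqr_ge0.
exists (maxn N0 (Num.bound ((k / eps) ^+ 2))) => N.
rewrite geq_max => /andP[/h l1 l2]; rewrite subr0 (le_trans l1) // lecR.
have s0 : 0 < Num.sqrt N.+1%:R :> R by rewrite sqrtr_gt0 ltr0n.
rewrite ler_pdivrMr // mulrC -ler_pdivrMr //.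
rewrite -[leLHS]ger0_norm ?divr_ge0 ?(ltW e0) // -sqrtr_sqr ler_wsqrtr //.
apply: le_trans (ltW (archi_boundP e2)) _; rewrite ler_nat.
exact: leq_trans l2 (leqnSn _).
Qed.

Lemma tendsto_near f g l : tendsto g l -> tendsto (fun N => f N - g N) 0 -> tendsto f l.
Proof.
move=> gl fg; rewrite -[l]add0r; apply: tendsto_ext (tendstoD fg gl) => N.
by rewrite subrK.
Qed.
End Limits.

Section MomentLimit.
Variables (R : realType) (n : nat).
Local Notation C := R[i].
Local Notation X := 'I_n.
Variables (Ys : {set X}) (D : forall N : nat, X -> 'rV[C]_N.+1) (c0 : X -> X -> C).
Variables (K : R) (kD : {set X} -> C).
Implicit Types (V S B : {set X}) (pi p : {set {set X}}).
Hypothesis K1 : 1 <= K.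
Hypothesis DK : forall N i a, i \notin Ys -> `|D N i 0 a| <= K%:C.
Hypothesis D_lim : forall V, V \subset ~: Ys ->
  tendsto (fun N => N.+1%:R^-1 * \tr (\prod_(i in V) diag_mx (D N i))) (NCsum kD V).

Let root N : C := (Num.sqrt N.+1%:R)%:C.

Let root_gt0 N : 0 < root N.
Proof. by rewrite /root ltcR sqrtr_gt0 ltr0n. Qed.

Let root2 N : root N ^+ 2 = N.+1%:R.
Proof. by rewrite /root -rmorphXn /= sqr_sqrtr ?ler0n // rmorph_nat. Qed.

Let c N (u v : X) : C := N.+1%:R^-1 * c0 u v.
Let x0 N : 'I_N.+1 * 'I_N.+1 := (ord0, ord0).
Let Cc : C := 1 + \sum_u \sum_v `|c0 u v|.

Let Cc1 : 1 <= Cc.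
Proof. by rewrite lerDl; do 2!apply: sumr_ge0 => ? _. Qed.

Let KC1 : 1 <= K%:C.
Proof. by rewrite -[1]/(1%:C) lecR. Qed.

Let c_bound N u v : `|c N u v| <= Cc * (root N)^-1 ^+ 2.
Proof.
rewrite exprVn root2 mulrC normrM ger0_norm ?invr_ge0 ?ler0n //.
rewrite ler_wpM2l ?invr_ge0 ?ler0n // /Cc.
rewrite (bigD1 u) //= (bigD1 v) //= -addrA [leRHS]addrCA lerDl.
by rewrite !addr_ge0 // ?sumr_ge0 // => i _; rewrite sumr_ge0.
Qed.

(** Here a r^-m r^(m+1) / r^2 = a / r, with r = [root N]: this is the shape in which both counting
    bounds arrive. *)
Lemma tendsto0_scaled m (a : C) (x : nat -> C) : 0 <= a ->
  (exists N0, forall N, (N0 <= N)%N -> `|x N| <= a * (root N)^-1 ^+ m * root N ^+ m.+1) ->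
  tendsto (fun N => N.+1%:R^-1 * x N) 0.
Proof.
move=> a0 [N0 h]; apply: (@tendsto0_bound _ _ (cabs a)); first exact: cabs_ge0.
exists N0 => N /h xN; rewrite normrM [`|_^-1|]ger0_norm ?invr_ge0 ?ler0n //.
have rn0 : root N != 0 by rewrite gt_eqF.
rewrite [X in _ <= X]rmorphM /= fmorphV /= -/(root N) -cabsE (ger0_norm a0).
rewrite -root2 -[leRHS]mul1r -(mulVf (expf_neq0 2 rn0)) -mulrA.
rewrite ler_wpM2l ?invr_ge0 ?exprn_ge0 ?(ltW (root_gt0 N)) //.
apply: le_trans xN _.
have -> : root N ^+ 2 * (a / root N) = a * root N by field.
by rewrite -mulrA exprVn exprS [X in a * X]mulrCA mulVf ?expf_neq0 // mulr1.
Qed.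

(* The limit cumulants: those of the D's on blocks without Y, the covariance on
   pairs of Y's, and 0 elsewhere. *)
Definition mixed_kappa B : C :=
  if B \subset ~: Ys then kD B
  else if B \subset Ys then compat_weight (fun=> (tt, tt)) c0 B else 0.

(** The constant walk on the one-point graph makes every pair of steps compatible, so
    [compat_weight] reduces to the covariance. *)
Lemma mixed_kappa_pair (v v' : X) : (v < v')%N -> v \in Ys -> v' \in Ys ->
  mixed_kappa [set v; v'] = c0 v v'.
Proof.
move=> vv' vY v'Y; rewrite /mixed_kappa.
rewrite subUset !sub1set !inE vY /= subUset !sub1set vY v'Y /=.
by rewrite compat_weight_set2.
Qed.

Lemma NCsum_mixed_kappa V : V \subset ~: Ys -> NCsum mixed_kappa V = NCsum kD V.
Proof.
move=> VD; apply: eq_bigr => p /andP[pV _]; apply: eq_bigr => B Bp.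
by rewrite /mixed_kappa (subset_trans (partitionS pV Bp) VD).
Qed.

Lemma Wsum_tendsto pi V : partition pi (V :&: Ys) -> (forall B, B \in pi -> #|B| = 2%N) ->
  tendsto (fun N => N.+1%:R^-1 * Wsum Ys (D N) (c N) (x0 N) pi V)
    (NCsum_at mixed_kappa (~: Ys) pi V).
Proof.
have [k] := ubnP #|pi|; elim: k pi V => // k IH pi V; rewrite ltnS => pik piY pi2.
have [pi0|pi_neq0] := eqVneq pi set0.
  subst pi; have VY0 : V :&: Ys = set0.
    by rewrite -(cover_partition piY) /cover big_set0.
  have VD : V \subset ~: Ys by rewrite -disjoints_subset -setI_eq0 VY0.
  rewrite NCsum_at0 // NCsum_mixed_kappa //; apply: tendsto_ext (D_lim VD) => N.
  rewrite /Wsum VY0 (big_pred1 [ffun=> x0 N]) => [|e]; last first.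
    apply/forallP/eqP => [h|-> i]; last by rewrite ffunE eqxx implybT.
    by apply/ffunP => i; have := h i; rewrite ffunE inE => /eqP.
  rewrite big_set0 mul1r; congr (_ * \tr _); apply: eq_bigr => i iV.
  by rewrite /letter_mx ifN //; have := subsetP VD _ iV; rewrite inE.
have VY0 : V :&: Ys != set0.
  by apply: contraNneq pi_neq0 => E; rewrite E partition_set0 in piY.
have [|] := boolP [exists v : X, exists v' : X, [&& (v < v')%N, [set v; v'] \in pi &
   [set i in V | (v < i < v')%N] \subset ~: Ys]]; last first.
  rewrite negb_exists => /forallP nadj.
  have {}nadj (v v' : X) : (v < v')%N -> [set v; v'] \in pi ->
      ~~ ([set i in V | (v < i < v')%N] \subset ~: Ys).
    move=> vv' vpi; have := nadj v; rewrite negb_exists => /forallP/(_ v').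
    by rewrite vv' vpi.
  rewrite NCsum_at_eq0 ?setDE ?setCK //.
  apply: (@tendsto0_scaled #|V :&: Ys| (Cc ^+ n * K%:C ^+ n * (n ^ n)%:R)).
    rewrite !mulr_ge0 ?exprn_ge0 ?ler0n //; first exact: le_trans Cc1.
    exact: le_trans KC1.
  exists 0%N => N _.
  apply: le_trans (Wsum_nonadjacent_bound (x0 N) KC1 (@DK N) (root_gt0 N) (root2 N) Cc1
     (c_bound N) VY0 piY pi2 nadj) _.
  rewrite le_eqVlt; apply/orP; left; apply/eqP.
  by congr (_ * _); rewrite -!mulrA; congr (_ * _); rewrite mulrC -mulrA.
case/existsP=> v /existsP[v' /and3P[vv' B0pi InY]].
set B0 := [set v; v'] in B0pi; set In := [set i in V | _] in InY.
have B0VY : B0 \subset V :&: Ys by exact: partitionS piY B0pi.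
have vVY : v \in V :&: Ys by rewrite (subsetP B0VY) ?set21.
have v'VY : v' \in V :&: Ys by rewrite (subsetP B0VY) ?set22.
have [vV vY] := setIP vVY; have [v'V v'Y] := setIP v'VY.
rewrite (@NCsum_at_recursion _ _ _ _ _ _ v v') //; last first.
  by rewrite -/B0; apply/subsetPn; exists v; rewrite ?set21 // inE vY.
rewrite -/B0 -/In mixed_kappa_pair // NCsum_mixed_kappa //.
have IHV : tendsto (fun N => N.+1%:R^-1 * Wsum Ys (D N) (c N) (x0 N) (pi :\ B0) (V :\: (B0 :|: In)))
    (NCsum_at mixed_kappa (~: Ys) (pi :\ B0) (V :\: (B0 :|: In))).
  apply: IH.
  - by move: pik; rewrite (cardsD1 B0) B0pi.
  - have -> : (V :\: (B0 :|: In)) :&: Ys = (V :&: Ys) :\: B0; last exact: partitionD1.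
    apply/setP => i; rewrite !inE; have := subsetP InY i; rewrite !inE.
    case: (i \in Ys); rewrite ?andbF // !andbT; case: (i \in V); rewrite ?andbF // !andbT /=.
    by case: (_ && _) => [/(_ isT)//|_]; rewrite orbF.
  - by move=> B; rewrite inE => /andP[_ /pi2].
(* Removing a pair yields two traces: the factor 1/N of the covariance normalizes that of the
   interior, and the outer 1/N that of the remaining word. *)
apply: tendsto_ext (tendstoM (tendstoM (tendsto_cst (c0 v v')) (D_lim InY)) IHV) => N.
rewrite (@Wsum_recursion _ _ _ _ _ _ _ pi V v v') ?(partition_trivIset piY) //.
rewrite -/B0 -/In /c /=. set y := Wsum _ _ _ _ _ _; set x := \tr _; set z := _^-1.
by ring.
Qed.

Lemma Wsum_eq0 N pi V : (exists2 B, B \in pi & #|B| != 2%N) ->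
  Wsum Ys (D N) (c N) (x0 N) pi V = 0.
Proof.
case=> B Bpi B2; apply: big1 => e _; rewrite (bigD1 B) //=.
suff -> : compat_weight e (c N) B = 0 by rewrite !mul0r.
apply/eqP; apply: contraNT B2 => /compat_weight_neq0[u [v [uv -> _]]].
by rewrite cards2 neq_ltn uv.
Qed.

(** A block not contained in the diagonal positions has nonzero [mixed_kappa] only if it is a pair
    of random positions. If all blocks of [pi] are such pairs, they are the blocks of a partition of
    [V] that meet [Ys], hence they partition [V :&: Ys]. *)
Lemma NCsum_at_mixed_eq0 pi V :
  (exists2 B, B \in pi & #|B| != 2%N) \/ ~~ partition pi (V :&: Ys) ->
  NCsum_at mixed_kappa (~: Ys) pi V = 0.
Proof.
move=> h; apply: big1 => p /and3P[pV ncp /eqP pip].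
have [] := boolP [forall B in pi, (B \subset Ys) && (#|B| == 2%N)]; last first.
  case/forallPn => B; rewrite negb_imply => /andP[Bpi nB].
  have /andP[Bp BD] : (B \in p) && ~~ (B \subset ~: Ys) by move: Bpi; rewrite -pip inE.
  rewrite (bigD1 B) //= (_ : mixed_kappa B = 0) ?mul0r // /mixed_kappa (negbTE BD).
  move: nB; case: ifP => //= _ B2; apply/eqP; apply: contraNT B2.
  by case/compat_weight_neq0=> u [v [uv -> _]]; rewrite cards2 neq_ltn uv.
move=> /forallP piP; exfalso; case: h => [[B Bpi]|/negP[]].
  by have := implyP (piP B) Bpi => /andP[_ ->].
have -> : pi = [set B in p | B \subset V :&: Ys].
  apply/setP => B; rewrite -pip !inE; case: (boolP (B \in p)) => //= Bp.
  rewrite subsetI (partitionS pV Bp) /=; apply/idP/idP => [BD|BY].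
    by have := piP B; rewrite -pip inE Bp BD /= => /andP[].
  have [x xB] := set0Pn _ (partition_neq0 pV Bp).
  by apply/subsetPn; exists x; rewrite // inE (subsetP BY).
apply: (partition_restrict pV (subsetIl _ _)) => B Bp.
case: (boolP (B \subset ~: Ys)) => [BD|BD].
  rewrite orbC -setI_eq0; apply/orP; left; apply/eqP/setP => x; rewrite !inE.
  by apply/negbTE/negP => /and3P[/(subsetP BD)]; rewrite inE => /negbTE->.
have := piP B; rewrite -pip inE Bp BD /= => /andP[BY _].
by rewrite subsetI (partitionS pV Bp) BY.
Qed.

(** [eps_sum_approx] replaces the expectations by a sum over partitions up to a vanishing error, and
    [Wsum_tendsto] treats each pairing; partitions with other blocks contribute 0 on both sides.
    Without random letters the claim is [D_lim]. *)
Lemma moment_tendsto (eps : forall N, {ffun X -> 'I_N.+1 * 'I_N.+1} -> {set X} -> C)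
    (M : C) (N0 : nat) V :
  0 <= M ->
  (forall N e, eps N e set0 = 1) ->
  (forall N (e : {ffun X -> 'I_N.+1 * 'I_N.+1}) (S1 S2 : {set X}), S1 \subset Ys -> S2 \subset Ys -> [disjoint S1 & S2] ->
     (forall u v, u \in S1 -> v \in S2 -> e u <> e v /\ e u <> arev (e v)) ->
     eps N e (S1 :|: S2) = eps N e S1 * eps N e S2) ->
  (forall N (e : {ffun X -> 'I_N.+1 * 'I_N.+1}) u, u \in Ys -> eps N e [set u] = 0) ->
  (forall N (e : {ffun X -> 'I_N.+1 * 'I_N.+1}) u v, u \in Ys -> v \in Ys -> (u < v)%N -> e v = arev (e u) ->
     eps N e [set u; v] = N.+1%:R^-1 * c0 u v) ->
  (forall N e S, (N0 <= N)%N -> S \subset Ys ->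
     `|eps N e S| <= M * (root N)^-1 ^+ #|S|) ->
  tendsto (fun N => N.+1%:R^-1 *
     \sum_(e | supported (ord0, ord0) (V :&: Ys) e)
        eps N e (V :&: Ys) * word_tr Ys (D N) e V)
    (NCsum mixed_kappa V).
Proof.
move=> M0 e0 eM e1 e2 eb.
have [VY0|VY0] := eqVneq (V :&: Ys) set0.
  have VD : V \subset ~: Ys by rewrite -disjoints_subset -setI_eq0 VY0.
  rewrite NCsum_mixed_kappa //; apply: tendsto_ext (D_lim VD) => N.
  rewrite VY0 (big_pred1 [ffun=> x0 N]) => [|e]; last first.
    apply/forallP/eqP => [h|-> i]; last by rewrite ffunE eqxx implybT.
    by apply/ffunP => i; have := h i; rewrite ffunE inE => /eqP.
  rewrite e0 mul1r; congr (_ * \tr _); apply: eq_bigr => i iV.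
  by rewrite /letter_mx ifN //; have := subsetP VD _ iV; rewrite inE.
have lim2 : tendsto (fun N => N.+1%:R^-1 *
    \sum_(pi | partition pi (V :&: Ys)) Wsum Ys (D N) (c N) (x0 N) pi V)
    (NCsum mixed_kappa V).
  rewrite (NCsum_decomp _ (~: Ys)) (bigID (fun pi => partition pi (V :&: Ys))) /=.
  rewrite [X in _ + X]big1 ?addr0 => [|pi npi]; last by apply: NCsum_at_mixed_eq0; right.
  have lim pi : partition pi (V :&: Ys) ->
      tendsto (fun N => N.+1%:R^-1 * Wsum Ys (D N) (c N) (x0 N) pi V)
        (NCsum_at mixed_kappa (~: Ys) pi V).
    move=> piY; have [/forallP h|/forallPn[B]] := boolP [forall B in pi, #|B| == 2%N].
      by apply: Wsum_tendsto => // B Bpi; apply/eqP; exact: implyP (h B) Bpi.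
    rewrite negb_imply => /andP[Bpi nB]; rewrite NCsum_at_mixed_eq0; last by left; exists B.
    by apply: tendsto_ext (tendsto_cst 0) => N; rewrite Wsum_eq0 ?mulr0 //; exists B.
  apply: tendsto_ext (tendsto_sum (index_enum _) lim) => N.
  by rewrite big_distrr.
apply: tendsto_near lim2 _.
pose k := (M + #|{set {set X}}|%:R * Cc ^+ n) * K%:C ^+ n * (n ^ n)%:R.
have K0 : 0 <= K%:C by exact: le_trans KC1.
have Cc0 : 0 <= Cc by exact: le_trans Cc1.
have k0 : 0 <= k.
  by rewrite !mulr_ge0 ?exprn_ge0 ?ler0n // addr_ge0 // mulr_ge0 ?exprn_ge0.
apply: tendsto_ext (@tendsto0_scaled #|V :&: Ys| k (fun N =>
    \sum_(e | supported (ord0, ord0) (V :&: Ys) e) eps N e (V :&: Ys) * word_tr Ys (D N) e V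
    - \sum_(pi | partition pi (V :&: Ys)) Wsum Ys (D N) (c N) (x0 N) pi V) k0 _) => [N|].
  by rewrite mulrBr.
exists N0 => N N0N.
apply: le_trans (eps_sum_approx (x0 N) KC1 (@DK N) (root_gt0 N) (root2 N) Cc1
     (c_bound N) VY0 M0 (e0 N) (eM N) (e1 N) (e2 N) (fun e S => eb N e S N0N)) _.
rewrite le_eqVlt; apply/orP; left; apply/eqP.
by congr (_ * _); rewrite /k -!mulrA; congr (_ * _); rewrite mulrC -mulrA.
Qed.
End MomentLimit.

(* Imported only now: the finite-set notations used above clash with those of
   classical sets. *)
From mathcomp Require Import all_classical all_reals all_analysis.
From mathcomp Require Import measurable_realfun.
Import numFieldNormedType.Exports.
Local Open Scope classical_set_scope.
Local Open Scope ring_scope.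
Local Open Scope complex_scope.

(** * Independence and expectations of products *)

Section RealIndependence.
Context (d : measure_display) (T : measurableType d) (R : realType).
Variables (P : probability T R) (gen : set (set T)).
Hypothesis gen_measurable : forall A, gen A -> measurable A.
Local Notation T' := (g_sigma_algebraType gen).
Local Notation integrable u := (P.-integrable setT (EFin \o u)).

Lemma gen_sigma_measurable A : <<s gen >> A -> measurable A.
Proof.
apply: (smallest_sub (X := @measurable d T)); last exact: gen_measurable.
split; first exact: measurable0.
  by move=> B mB; rewrite setTD; exact: measurableC.
by move=> F mF; exact: bigcup_measurable.
Qed.

Lemma measurable_fun_gen d' (U : measurableType d') (f : T -> U) :
  measurable_fun (setT : set T') f -> measurable_fun (setT : set T) f.
Proof.
move=> mf _ B mB; apply: gen_sigma_measurable.
exact: mf measurableT B mB.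
Qed.

Variable g : T -> R.
Hypothesis ig : integrable g.
Hypothesis g_indep : forall A, <<s gen >> A ->
  \int[P]_t (g t * \1_A t) = (\int[P]_t g t) * fine (P A).

(** The functions against which [g] factors. They include the indicators of the generated
    sigma-algebra and are stable under linear combinations, hence include its simple functions. *)
Let ok (f : T -> R) := [/\ integrable f, integrable (fun t => g t * f t) &
  \int[P]_t (g t * f t) = (\int[P]_t g t) * (\int[P]_t f t)].

Let integrableZ (f : T -> R) k : integrable f -> integrable (fun t => k * f t).
Proof. by move=> i; apply: eq_integrable (integrableZl _ k i). Qed.

Let integrableD' (f h : T -> R) : integrable f -> integrable h ->
  integrable (fun t => f t + h t).
Proof. by move=> i j; apply: eq_integrable (integrableD _ i j). Qed.

Let measurable_integrable (f : T -> R) : integrable f -> measurable_fun setT f.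
Proof. by move/measurable_int/measurable_EFinP. Qed.

Let ok_ind A : <<s gen >> A -> ok (fun t => \1_A t).
Proof.
move=> gA; have mA := gen_sigma_measurable gA.
have i1 : integrable (fun t => \1_A t) by exact: integrable_indic.
split=> //.
  apply: le_integrable ig => //.
    apply/measurable_EFinP; apply: measurable_funM; first exact: measurable_integrable.
    exact: measurable_integrable.
  move=> t _ /=; rewrite lee_fin normrM ler_piMr // indicE.
  by case: (t \in A); rewrite ?normr1 ?normr0.
by rewrite g_indep // /Rintegral [in RHS]integral_indic // setIT.
Qed.

Let okZ f k : ok f -> ok (fun t => k * f t).
Proof.
move=> [i j E]; have j' : integrable (fun t => k * (g t * f t)) by exact: integrableZ.
have gkf : (fun t => g t * (k * f t)) = (fun t => k * (g t * f t)).
  by apply/funext => t; rewrite mulrCA.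
split; [exact: integrableZ | by rewrite gkf |].
by rewrite gkf !RintegralZl // E mulrCA.
Qed.

Let okD f h : ok f -> ok h -> ok (fun t => f t + h t).
Proof.
move=> [i j E] [i' j' E'].
have gfh : (fun t => g t * (f t + h t)) = (fun t => g t * f t + g t * h t).
  by apply/funext => t; rewrite mulrDr.
split; [exact: integrableD' | by rewrite gfh; exact: integrableD' |].
by rewrite gfh !RintegralD // E E' mulrDr.
Qed.

Let ok_sum m (f : nat -> T -> R) : (forall k, (k < m)%N -> ok (f k)) ->
  ok (fun t => \sum_(k < m) f k t).
Proof.
elim: m => [|m IH] okf.
  have -> : (fun t => \sum_(k < 0) f k t) = (fun t => 0 * \1_set0 t).
    by apply/funext => t; rewrite big_ord0 mul0r.
  by apply/okZ/ok_ind; exact: sigma_algebra0.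
have -> : (fun t => \sum_(k < m.+1) f k t) = (fun t => \sum_(k < m) f k t + f m t).
  by apply/funext => t; rewrite big_ord_recr.
by apply: okD; [apply: IH => k km; apply: okf; exact: ltnW | exact: okf].
Qed.

(** The dyadic approximations of [h] are simple for the generated sigma-algebra and increase to [h].
    Dominated convergence, with dominating functions |g h| and h, carries the factorization to the
    limit. *)
Lemma Rintegral_indep_nonneg (h : T -> R) : measurable_fun (setT : set T') h ->
  (forall t, 0 <= h t) -> integrable h -> integrable (fun t => g t * h t) ->
  \int[P]_t (g t * h t) = (\int[P]_t g t) * (\int[P]_t h t).
Proof.
move=> mh h0 ih igh.
pose H m : T -> R := approx (setT : set T') (EFin \o h) m.
have mEh : measurable_fun (setT : set T') (EFin \o h) by exact/measurable_EFinP.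
have okH m : ok (H m).
  rewrite /H /approx; apply: okD.
    apply: (ok_sum (f := fun k t => k%:R * 2 ^- m * \1_(dyadic_approx (setT : set T') (EFin \o h) m k) t)).
    move=> k km; apply/okZ/ok_ind; rewrite /dyadic_approx km.
    by rewrite -preimage_comp; apply: mEh => //; apply: measurable_image_EFin; exact: measurable_itv.
  apply/okZ/ok_ind; rewrite /integer_approx.
  have -> : [set x : T' | (m%:R%:E <= (EFin \o h) x)%E] = h @^-1` `[m%:R, +oo[%classic.
    by apply/seteqP; split=> x /=; rewrite in_itv /= andbT lee_fin.
  by apply: mh => //; exact: measurable_itv.
have Hcvg t : H ^~ t @ \oo --> h t.
  by apply: (@cvg_approx _ T' _ setT (EFin \o h) t) => // [x _|]; rewrite ?lee_fin ?ltry.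
have Hle m t : H m t <= h t.
  have nd : nondecreasing_seq (H ^~ t).
    by move=> p q pq; have /lefP := nd_approx (setT : set T') (EFin \o h) pq; exact.
  by rewrite -(cvg_lim _ (Hcvg t)) //; apply: nondecreasing_cvgn_le => //; apply/cvg_ex; exists (h t).
have H0 m t : 0 <= H m t.
  by rewrite /H /approx addr_ge0 ?sumr_ge0 // => [k _|]; rewrite !mulr_ge0.
have lim (u : T -> R) : integrable u -> integrable (fun t => u t * h t) ->
    (forall m, measurable_fun setT (fun t => u t * H m t)) ->
    (fun m => \int[P]_t (u t * H m t)) @ \oo --> \int[P]_t (u t * h t).
  move=> iu iuh mu.
  have cvgt t : (u t * H m t)%:E @[m --> \oo] --> (u t * h t)%:E.
    apply: cvg_EFin; first exact: nearW.
    exact: cvgM (cvg_cst _) (Hcvg t).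
  have bnd t m : (`|(u t * H m t)%:E| <= `|u t * h t|%:E)%E.
    rewrite lee_fin !normrM ler_wpM2l // !ger0_norm //; exact: Hle.
  have [_ _] := dominated_convergence measurableT
     (f_ := fun m t => (u t * H m t)%:E) (fun m => (measurable_EFinP _ _).2 (mu m))
     (measurable_int _ iuh) (aeW P (fun t _ => cvgt t)) (integrable_norm iuh)
     (aeW P (fun t m _ => bnd t m)).
  have fin : (\int[P]_t (u t * h t)%:E)%E \is a fin_num.
    exact: integrable_fin_num iuh.
  by rewrite /comp /= -(fineK fin) => /fine_cvg.
have l1 := lim g ig igh (fun m => measurable_integrable (let: And3 _ i _ := okH m in i)).
have i1 : integrable (fun t => 1 : R) by exact: finite_measure_integrable_cst.
have l2 : (fun m => \int[P]_t H m t) @ \oo --> \int[P]_t h t.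
  have mulE (f : T -> R) : (fun t => 1 * f t) = f by apply/funext => t; rewrite mul1r.
  have mH m : measurable_fun setT (fun t => 1 * H m t).
    by rewrite mulE; apply: measurable_integrable; case: (okH m).
  have ih1 : integrable (fun t => 1 * h t) by rewrite mulE.
  have := lim (fun=> 1) i1 ih1 mH; rewrite mulE.
  have -> // : (fun m => \int[P]_t (1 * H m t)) = (fun m => \int[P]_t H m t).
  by apply/funext => m; rewrite mulE.
have l3 : (fun m => (\int[P]_t g t) * \int[P]_t H m t) @ \oo -->
    (\int[P]_t g t) * \int[P]_t h t by exact: cvgM (cvg_cst _) l2.
have E : (fun m => \int[P]_t (g t * H m t)) = (fun m => (\int[P]_t g t) * \int[P]_t H m t).
  by apply/funext => m; case: (okH m).
by rewrite E in l1; apply: cvg_unique l1 l3.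
Qed.
End RealIndependence.

Section SignedIndependence.
Context (d : measure_display) (T : measurableType d) (R : realType).
Variables (P : probability T R) (gen : set (set T)).
Hypothesis gen_measurable : forall A, gen A -> measurable A.
Local Notation T' := (g_sigma_algebraType gen).
Local Notation integrable u := (P.-integrable setT (EFin \o u)).

(** Positive and negative parts of [h], handled together as the maximum of [s * h] and 0 for [s]
    equal to 1 and to -1. *)
Lemma Rintegral_indep (g h : T -> R) : integrable g ->
  (forall A, <<s gen >> A ->
     \int[P]_t (g t * \1_A t) = (\int[P]_t g t) * fine (P A)) ->
  measurable_fun (setT : set T') h -> integrable h -> integrable (fun t => g t * h t) ->
  \int[P]_t (g t * h t) = (\int[P]_t g t) * (\int[P]_t h t).
Proof.
move=> ig gA mh ih igh.
have mgh := (measurable_EFinP _ _).1 (measurable_int _ ig).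
have mh' := measurable_fun_gen gen_measurable mh.
have part (s : R) (hs : T -> R := fun t => Num.max (s * h t) 0) : `|s| = 1 ->
    [/\ integrable hs, integrable (fun t => g t * hs t) &
        \int[P]_t (g t * hs t) = (\int[P]_t g t) * (\int[P]_t hs t)].
  move=> s1.
  have mhs : measurable_fun (setT : set T') hs.
    by apply: measurable_maxr => //; apply: measurable_funM.
  have mhs' := measurable_fun_gen gen_measurable mhs.
  have le t : `|hs t| <= `|h t|.
    rewrite /hs; case: (leP (s * h t) 0) => _; first by rewrite normr0.
    by rewrite normrM s1 mul1r.
  have i1 : integrable hs.
    by apply: le_integrable ih => // [|t _]; [exact/measurable_EFinP | rewrite lee_fin].
  have i2 : integrable (fun t => g t * hs t).
    apply: le_integrable igh => //; first by apply/measurable_EFinP; exact: measurable_funM.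
    by move=> t _ /=; rewrite lee_fin !normrM ler_wpM2l.
  split=> //; apply: (Rintegral_indep_nonneg gen_measurable) => // t.
  by rewrite /hs le_max lexx orbT.
have [p1 p2 p3] := part 1 (normr1 _).
have [n1 n2 n3] := part (-1) (normrN1 _).
have hE : h = (fun t => Num.max (1 * h t) 0 - Num.max (-1 * h t) 0).
  apply/funext => t; rewrite mul1r mulN1r.
  by case: (leP (h t) 0) => h1; case: (leP (- h t) 0) => h2; lra.
rewrite [in LHS]hE [in RHS]hE RintegralB // mulrBr -p3 -n3 -RintegralB //.
by apply: eq_Rintegral => t _; rewrite mulrBr.
Qed.

End SignedIndependence.

Section ComplexIndependence.
Context (d : measure_display) (T : measurableType d) (R : realType).
Variable P : probability T R.
Local Notation C := R[i].
Local Notation L := (Linfty P).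
Local Notation integrable u := (P.-integrable setT (EFin \o u)).

Lemma LinftyM_E (f g : L) t : (f * g : L) t = f t * g t. Proof. by []. Qed.

Lemma integrable_le_cmod (f : L) (u : T -> R) : measurable_fun setT u ->
  (forall t, `|u t| <= cmod f t) -> integrable u.
Proof.
move=> mu le; have [mr mi /(_ 1 (lexx _)) L1] := Linfty_predP _ _ (Linfty_funP f).
apply/Lfun1_integrable; apply: Lfun_le L1 => // t.
by rewrite (ger0_norm (cmod_ge0 _ _)).
Qed.

Lemma norm_Re_le_cmod (f : T -> C) t : `|complex.Re (f t)| <= cmod f t.
Proof. by rewrite -lecR cmodE; exact: normc_ge_Re. Qed.

Lemma norm_Im_le_cmod (f : T -> C) t : `|complex.Im (f t)| <= cmod f t.
Proof.
by rewrite -lecR cmodE normc_def lecR -sqrtr_sqr ler_wsqrtr // lerDr sqr_ge0.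
Qed.

Lemma cmodM (f g : L) t : cmod (f * g : L) t = cmod f t * cmod g t.
Proof.
by apply: (@complexI R); rewrite [RHS]rmorphM !cmodE LinftyM_E normrM.
Qed.

Definition indC (A : set T) (t : T) : C := (\1_A t : R)%:C.

Lemma in_Linfty_indC A : measurable A -> in_Linfty P (indC A).
Proof.
move=> mA; have m1 : measurable_fun setT (\1_A : T -> R) by exact: measurable_indic.
split=> [||p p1]; [exact: m1 | exact: measurable_cst |].
apply: (@Lfun_le _ _ _ P _ (cst 1)) => //; last exact: Lfun_cst.
  by apply: measurable_cmod; [exact: m1 | exact: measurable_cst].
move=> t; rewrite ger0_norm ?cmod_ge0 // normr1 -lecR cmodE /indC.
by rewrite indicE; case: (t \in A); rewrite ?normr1 ?normr0.
Qed.

(* Junk value 0 if A is not measurable. *)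
Definition ind (A : set T) : L := insubd (0 : L) (indC A).

Lemma indE A t : measurable A -> ind A t = indC A t.
Proof.
move=> mA; rewrite /ind -[Linfty_fun _]/(val _) val_insubd.
by have /(Linfty_predP P _) -> := in_Linfty_indC mA.
Qed.

Lemma Ex_ind A : measurable A -> Ex (ind A) = (fine (P A))%:C.
Proof.
move=> mA; rewrite /Ex; congr (_ +i* _).
  have -> : (fun t => complex.Re (ind A t)) = (\1_A : T -> R).
    by apply/funext => t; rewrite indE.
  by rewrite /Rintegral integral_indic // setIT.
have -> : (fun t => complex.Im (ind A t)) = cst 0.
  by apply/funext => t; rewrite indE.
by rewrite Rintegral_cst // mul0r.
Qed.

Definition Re_Im_measurable (gen : set (set T)) (f : T -> C) : Prop :=
  measurable_fun (setT : set (g_sigma_algebraType gen)) (fun t => complex.Re (f t)) /\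
  measurable_fun (setT : set (g_sigma_algebraType gen)) (fun t => complex.Im (f t)).

(** Indicators are real, so the hypothesis splits into one for the real and one for the imaginary
    part of [g]. The four real products making up [g * h] then factor and recombine. *)
Lemma Ex_indep (gen : set (set T)) (g h : L) : (forall A, gen A -> measurable A) ->
  (forall A, <<s gen >> A -> Ex (g * ind A) = Ex g * (fine (P A))%:C) ->
  Re_Im_measurable gen h -> Ex (g * h) = Ex g * Ex h.
Proof.
move=> gm gA [mr mi].
have [igr igi] := Linfty_integrable g; have [ihr ihi] := Linfty_integrable h.
have mE (u : T -> R) : integrable u -> measurable_fun setT u.
  by move/measurable_int/measurable_EFinP.
have gAri A : <<s gen >> A ->
    \int[P]_t (complex.Re (g t) * \1_A t) = (\int[P]_t complex.Re (g t)) * fine (P A) /\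
    \int[P]_t (complex.Im (g t) * \1_A t) = (\int[P]_t complex.Im (g t)) * fine (P A).
  move=> sA; have mA := gen_sigma_measurable gm sA; have := gA A sA.
  rewrite {1}/Ex.
  have -> : (fun t => complex.Re ((g * ind A : L) t)) = (fun t => complex.Re (g t) * \1_A t).
    by apply/funext => t; rewrite LinftyM_E indE //; case: (g t) => a b /=; rewrite mulr0 subr0.
  have -> : (fun t => complex.Im ((g * ind A : L) t)) = (fun t => complex.Im (g t) * \1_A t).
    by apply/funext => t; rewrite LinftyM_E indE //; case: (g t) => a b /=; rewrite mulr0 add0r.
  by move=> [-> ->]; rewrite /= !mulr0 subr0 add0r.
have im (u v : T -> R) : integrable u -> integrable v ->
    (forall t, `|u t| <= cmod g t) -> (forall t, `|v t| <= cmod h t) ->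
    integrable (fun t => u t * v t).
  move=> iu iv ule vle; apply: (@integrable_le_cmod (g * h)).
    by apply: measurable_funM; exact: mE.
  by move=> t; rewrite cmodM normrM ler_pM.
have indep (u v : T -> R) : integrable u -> integrable v ->
    (forall t, `|u t| <= cmod g t) -> (forall t, `|v t| <= cmod h t) ->
    (forall A, <<s gen >> A ->
       \int[P]_t (u t * \1_A t) = (\int[P]_t u t) * fine (P A)) ->
    measurable_fun (setT : set (g_sigma_algebraType gen)) v ->
    \int[P]_t (u t * v t) = (\int[P]_t u t) * (\int[P]_t v t).
  move=> iu iv ule vle uA mv; apply: (Rintegral_indep gm) => //; exact: im.
have gr := norm_Re_le_cmod g; have gi := norm_Im_le_cmod g.
have hr := norm_Re_le_cmod h; have hi := norm_Im_le_cmod h.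
rewrite /Ex.
have -> : (fun t => complex.Re ((g * h : L) t)) = (fun t =>
    complex.Re (g t) * complex.Re (h t) - complex.Im (g t) * complex.Im (h t)).
  by apply/funext => t; rewrite LinftyM_E; case: (g t) (h t) => ? ? [].
have -> : (fun t => complex.Im ((g * h : L) t)) = (fun t =>
    complex.Re (g t) * complex.Im (h t) + complex.Im (g t) * complex.Re (h t)).
  by apply/funext => t; rewrite LinftyM_E; case: (g t) (h t) => ? ? [].
rewrite RintegralB ?RintegralD //; try exact: im.
rewrite !indep //; try by move=> A /gAri[].
Qed.
End ComplexIndependence.

Section ProductIndependence.
Context (d : measure_display) (T : measurableType d) (R : realType).
Variable P : probability T R.
Local Notation C := R[i].
Local Notation L := (Linfty P).

(** The generating class inside [generated_sigma], which is by definition the sigma-algebra it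
    generates. *)
Definition sigma_generators (F : set (T -> C)) : set (set T) :=
  [set A | exists f B, [/\ F f, measurable B &
     A = (fun t => complex.Re (f t)) @^-1` B \/ A = (fun t => complex.Im (f t)) @^-1` B]].

Lemma sigma_generators_measurable (F : set (T -> C)) :
  (forall f, F f -> in_Linfty P f) -> forall A, sigma_generators F A -> measurable A.
Proof.
move=> FL A [f [B [/FL[mr mi _] mB [->|->]]]].
  by rewrite -[X in measurable X]setTI; exact: mr.
by rewrite -[X in measurable X]setTI; exact: mi.
Qed.

Lemma Re_Im_measurable_generator (F : set (T -> C)) f : F f ->
  Re_Im_measurable (sigma_generators F) f.
Proof.
move=> Ff; split=> _ B mB; rewrite setTI; apply: sub_sigma_algebra;
  exists f, B; split=> //; by [left|right].
Qed.

Section Closure.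
Variable gen : set (set T).
Implicit Types f g : T -> C.

Lemma Re_Im_measurableM f g : Re_Im_measurable gen f -> Re_Im_measurable gen g ->
  Re_Im_measurable gen (fun t => f t * g t).
Proof.
move=> [fr fi] [gr gi]; split.
  have -> : (fun t => complex.Re (f t * g t)) = fun t =>
      complex.Re (f t) * complex.Re (g t) - complex.Im (f t) * complex.Im (g t).
    by apply/funext => t; case: (f t) (g t) => ? ? [].
  by apply: measurable_funB; apply: measurable_funM.
have -> : (fun t => complex.Im (f t * g t)) = fun t =>
    complex.Re (f t) * complex.Im (g t) + complex.Im (f t) * complex.Re (g t).
  by apply/funext => t; case: (f t) (g t) => ? ? [].
by apply: measurable_funD; apply: measurable_funM.
Qed.

Lemma Re_Im_measurable_conj f : Re_Im_measurable gen f ->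
  Re_Im_measurable gen (fun t => conjc (f t)).
Proof.
move=> [fr fi]; split.
  have -> : (fun t => complex.Re (conjc (f t))) = (fun t => complex.Re (f t)) => //.
  by apply/funext => t; case: (f t).
have -> : (fun t => complex.Im (conjc (f t))) = (fun t => - complex.Im (f t)).
  by apply/funext => t; case: (f t).
exact: measurable_funN.
Qed.

Lemma Re_Im_measurable_prod (I : Type) (s : seq I) (Q : pred I) (h : I -> L) :
  (forall i, Q i -> Re_Im_measurable gen (h i)) ->
  Re_Im_measurable gen (\prod_(i <- s | Q i) h i : L).
Proof.
move=> hm; elim: s => [|i s IH].
  by rewrite big_nil; split; exact: measurable_cst.
rewrite big_cons; case: ifP => // Qi.
have -> : (h i * \prod_(j <- s | Q j) h j : L) =
   (fun t => h i t * (\prod_(j <- s | Q j) h j : L) t) :> (T -> C) by [].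
by apply: Re_Im_measurableM => //; exact: hm.
Qed.
End Closure.

Lemma ind_prod (I : finType) (S : {set I}) (A : I -> set T) :
  (forall i, i \in S -> measurable (A i)) ->
  \prod_(i in S) ind P (A i) = ind P (\bigcap_(i in [set` S]) A i).
Proof.
move=> mA; have mI : measurable (\bigcap_(i in [set` S]) A i).
  by apply: fin_bigcap_measurable => // i; exact: mA.
apply/val_inj/funext => t; rewrite -[val (ind _ _)]/(Linfty_fun _) indE // /indC.
have -> : val (\prod_(i in S) ind P (A i)) t = \prod_(i in S) (\1_(A i) t : R)%:C.
  transitivity (\prod_(i in S) (ind P (A i) t)).
    by elim/big_rec2 : _ => // i x y _ <-.
  by apply: eq_bigr => i iS; rewrite indE //; exact: mA.
rewrite -rmorph_prod; congr (_%:C); rewrite indicE.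
have [tI|tI] := boolP (t \in \bigcap_(i in [set` S]) A i).
  rewrite big1 // => i iS; rewrite indicE mem_set //.
  by move: tI; rewrite inE; apply.
have [i iS ti] : exists2 i, i \in S & ~ A i t.
  move: tI; rewrite notin_setE => h; apply: contrapT => k; apply: h => i iS.
  by apply: contrapT => ti; apply: k; exists i.
by rewrite (bigD1 i) //= indicE memNset // mul0r.
Qed.

Variables (I : finType) (F : I -> set (T -> C)).
Hypothesis F_Linfty : forall p f, F p f -> in_Linfty P f.
Hypothesis F_indep : independent_sets P F.

Let sigma_meas p A : generated_sigma (F p) A -> measurable A.
Proof.
by apply: gen_sigma_measurable; apply: sigma_generators_measurable; exact: F_Linfty.
Qed.

(** Functions at the indices in [s] and indicators at those in [S]: induction on [s] trades one
    indicator for a function. The hypothesis of [Ex_indep] at [p] is the induction hypothesis with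
    an arbitrary event [B] placed at [p]; with [s] empty the statement is the independence of
    events. *)
Let Ex_prod_indep_seq (h : I -> L) (s : seq I) (S : {set I}) (A : I -> set T) :
  (forall p, Re_Im_measurable (sigma_generators (F p)) (h p)) ->
  uniq s -> (forall p, p \in s -> p \notin S) ->
  (forall p, p \in S -> generated_sigma (F p) (A p)) ->
  Ex ((\prod_(p <- s) h p) * \prod_(p in S) ind P (A p)) =
  (\prod_(p <- s) Ex (h p)) * \prod_(p in S) (fine (P (A p)))%:C.
Proof.
move=> hm; elim: s S A => [|p s IH] S A us sS AF.
  rewrite !big_nil !mul1r ind_prod => [|i /AF/sigma_meas //].
  rewrite Ex_ind; last first.
    by apply: fin_bigcap_measurable => // i /= iS; exact: sigma_meas (AF _ iS).
  rewrite F_indep // -rmorph_prod; congr (_%:C).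
  suff -> : (\prod_(i in S) P (A i))%E = (\prod_(i in S) fine (P (A i)))%:E by [].
  elim/big_rec2 : _ => // i x y iS ->; rewrite EFinM fineK //.
  by apply: fin_num_measure; exact: sigma_meas (AF _ iS).
move: us; rewrite !big_cons /= => /andP[ps us].
have sS' q : q \in s -> q \notin S by move=> qs; apply: sS; rewrite inE qs orbT.
have pS : p \notin S by apply: sS; rewrite mem_head.
rewrite -mulrA mulrC (Ex_indep (gen := sigma_generators (F p))) //.
- by rewrite IH // mulrC mulrA.
- by apply: sigma_generators_measurable; exact: F_Linfty.
move=> B sB; pose A' q := if q == p then B else A q.
have A'E q : q \in S -> A' q = A q.
  by rewrite /A'; case: eqP => // ->; rewrite (negbTE pS).
have -> : (\prod_(q <- s) h q) * (\prod_(q in S) ind P (A q)) * ind P B =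
    (\prod_(q <- s) h q) * \prod_(q in p |: S) ind P (A' q).
  rewrite -mulrA big_setU1 //= mulrC [in RHS]mulrC; congr (_ * _).
  rewrite {1}/A' eqxx mulrC; congr (_ * _).
  by apply: eq_bigr => q /A'E->.
rewrite IH //; last 2 first.
- by move=> q qs; rewrite !inE negb_or sS' // andbT; apply: contraNneq ps => <-.
- by move=> q; rewrite !inE /A' => /orP[/eqP->|qS]; rewrite ?eqxx //;
    case: eqP => [->//|_]; exact: AF.
rewrite IH // big_setU1 //= {1}/A' eqxx -mulrA; congr (_ * _); rewrite mulrC; congr (_ * _).
by apply: eq_bigr => q /A'E->.
Qed.

Lemma Ex_prod_indep (h : I -> L) :
  (forall p, Re_Im_measurable (sigma_generators (F p)) (h p)) ->
  Ex (\prod_p h p) = \prod_p Ex (h p).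
Proof.
move=> hm.
have := @Ex_prod_indep_seq h (index_enum I) finset.set0 (fun=> set0) hm (index_enum_uniq I).
by rewrite !big_set0 !mulr1; apply=> p; rewrite inE.
Qed.
End ProductIndependence.

Section AlmostEverywhere.
Context (d : measure_display) (T : measurableType d) (R : realType).
Variable P : probability T R.
Local Notation C := R[i].
Local Notation L := (Linfty P).

Definition ae_equal (f g : L) : Prop := \forall t \ae P, f t = g t.

Lemma Ex_ae (f g : L) : ae_equal f g -> Ex f = Ex g.
Proof.
move=> fg; rewrite /Ex; have [fr fi] := Linfty_integrable f.
have [gr gi] := Linfty_integrable g.
congr (_ +i* _); rewrite /Rintegral; congr fine; apply: ae_eq_integral => //.
- exact: measurable_int fr.
- exact: measurable_int gr.
- by apply: (filterS _ fg) => t E _ /=; rewrite E.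
- exact: measurable_int fi.
- exact: measurable_int gi.
- by apply: (filterS _ fg) => t E _ /=; rewrite E.
Qed.

Lemma ae_equal_prod (I : Type) (s : seq I) (Q : pred I) (f g : I -> L) :
  (forall i, Q i -> ae_equal (f i) (g i)) ->
  ae_equal (\prod_(i <- s | Q i) f i) (\prod_(i <- s | Q i) g i).
Proof.
move=> fg; elim: s => [|i s IH]; first by rewrite !big_nil; exact: aeW.
rewrite !big_cons; case: ifP => // Qi.
have := fg i Qi; apply: filterS2 IH => t E1 E2.
by rewrite !LinftyM_E E1 E2.
Qed.

Lemma in_Linfty_conj (f : L) : in_Linfty P (fun t => conjc (f t)).
Proof.
have [mr mi fp] := Linfty_predP _ _ (Linfty_funP f).
have mr' : measurable_fun setT (fun t => complex.Re (conjc (f t))).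
  have -> : (fun t => complex.Re (conjc (f t))) = (fun t => complex.Re (f t)) => //.
  by apply/funext => t; case: (f t).
have mi' : measurable_fun setT (fun t => complex.Im (conjc (f t))).
  have -> : (fun t => complex.Im (conjc (f t))) = (fun t => - complex.Im (f t)).
    by apply/funext => t; case: (f t).
  exact: measurable_funN.
split=> // p p1; have -> : cmod (fun t => conjc (f t)) = cmod f; last exact: fp.
by apply/funext => t; apply: (@complexI R); rewrite !cmodE norm_conjC.
Qed.

Definition conjL (f : L) : L := MkLinfty (introT (Linfty_predP P _) (in_Linfty_conj f)).
End AlmostEverywhere.

Section EntryMoments.
Context (d : measure_display) (T : measurableType d) (R : realType).
Variable P : probability T R.
Local Notation C := R[i].
Local Notation L := (Linfty P).
Variables (n N : nat).
Local Notation X := 'I_n.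
Local Notation idx := ('I_N.+1 * 'I_N.+1)%type.
Local Notation edge_type := {p : idx | (p.1 <= p.2)%N}.
Variables (Ys : {set X}) (entry : X -> idx -> L) (F : edge_type -> set (T -> C)).
Implicit Types a b : idx.
Hypothesis F_Linfty : forall p f, F p f -> in_Linfty P f.
Hypothesis F_indep : independent_sets P F.
Hypothesis entry_F : forall i (p : edge_type), i \in Ys -> F p (entry i (val p)).
Hypothesis entry_conj : forall i a, i \in Ys ->
  {ae P, forall t, entry i (arev a) t = conjc (entry i a t)}.

Let edge0 : edge_type := exist _ (ord0, ord0) (leqnn _).
(** The undirected edge, represented by its pair with i <= j, which indexes the independent
    families. The default [edge0] is never reached ([val_edge]). *)
Definition edge (a : idx) : edge_type :=
  insubd edge0 (if (a.1 <= a.2)%N then a else arev a).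

Lemma val_edge a : val (edge a) = if (a.1 <= a.2)%N then a else arev a.
Proof.
rewrite /edge val_insubd ifT //; case: ifP => // /negbT.
by rewrite -ltnNge => /ltnW.
Qed.

Lemma edge_inj a b : edge a = edge b -> a = b \/ a = arev b.
Proof.
move/(congr1 val); rewrite !val_edge; case: ifP => _; case: ifP => _ E.
- by left.
- by right.
- by right; rewrite -E arevK.
- by left; rewrite -[a]arevK E arevK.
Qed.

Lemma edge_arev a : edge (arev a) = edge a.
Proof.
apply/val_inj; rewrite !val_edge arevK /=; case: ltngtP => // /val_inj.
by case: a => x y /= ->.
Qed.

(* Y_{ji} is only almost everywhere the conjugate of Y_{ij}, hence need not be
   measurable for the sigma-algebra of the edge {i,j}; this modification is. *)
Let entry_sa i a : L := if (a.1 <= a.2)%N then entry i a else conjL (entry i (arev a)).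

Let entry_sa_ae i a : i \in Ys -> ae_equal (entry i a) (entry_sa i a).
Proof.
move=> iY; rewrite /entry_sa; case: ifP => _; first exact: aeW.
have := entry_conj (arev a) iY; rewrite /ae_equal arevK; exact: filterS.
Qed.

Let entry_sa_measurable i a : i \in Ys ->
  Re_Im_measurable (sigma_generators (F (edge a))) (entry_sa i a).
Proof.
move=> iY; have := entry_F (edge a) iY; rewrite val_edge /entry_sa.
case: ifP => _ Fa; first exact: Re_Im_measurable_generator.
by apply: Re_Im_measurable_conj; exact: Re_Im_measurable_generator.
Qed.

Definition entry_moment (e : X -> idx) (S : {set X}) : C := Ex (\prod_(i in S) entry i (e i)).

Lemma entry_moment0 e : entry_moment e finset.set0 = 1.
Proof. by rewrite /entry_moment big_set0 Ex1. Qed.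

(** Modifying the entries on null sets and grouping the positions by edge gives one factor per edge,
    measurable for the sigma-algebra of that edge. *)
Let entry_moment_edges e (S : {set X}) : S \subset Ys ->
  entry_moment e S = \prod_p Ex (\prod_(i in S | edge (e i) == p) entry_sa i (e i)).
Proof.
move=> /fintype.subsetP SY; rewrite /entry_moment.
rewrite (Ex_ae (g := \prod_(i in S) entry_sa i (e i))); last first.
  by apply: ae_equal_prod => i /SY; exact: entry_sa_ae.
rewrite (partition_big (fun i => edge (e i)) xpredT) //=.
apply: (Ex_prod_indep F_Linfty F_indep) => p.
apply: Re_Im_measurable_prod => i /andP[/SY iY /eqP <-].
exact: entry_sa_measurable.
Qed.

(** No edge carries positions of both sets, so in [entry_moment_edges] one of the two factors at
    each edge is an empty product. *)
Lemma entry_momentM e (S1 S2 : {set X}) : S1 \subset Ys -> S2 \subset Ys ->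
  fintype.disjoint (mem S1) (mem S2) ->
  (forall u v, u \in S1 -> v \in S2 -> e u <> e v /\ e u <> arev (e v)) ->
  entry_moment e (S1 :|: S2) = entry_moment e S1 * entry_moment e S2.
Proof.
move=> S1Y S2Y dS ne; have S12Y : S1 :|: S2 \subset Ys by rewrite finset.subUset S1Y.
rewrite (entry_moment_edges _ S12Y) (entry_moment_edges _ S1Y) (entry_moment_edges _ S2Y).
rewrite -big_split /=.
apply: eq_bigr => p _.
have -> : \prod_(i in S1 :|: S2 | edge (e i) == p) entry_sa i (e i) =
    (\prod_(i in S1 | edge (e i) == p) entry_sa i (e i)) *
    (\prod_(i in S2 | edge (e i) == p) entry_sa i (e i)).
  rewrite (@big_setIDcond _ _ _ _ (S1 :|: S2) S1) /=; congr (_ * _); apply: eq_bigl => i; rewrite !inE.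
    by case: (i \in S1); rewrite ?andbF.
  case: (boolP (i \in S1)) => //= iS1.
  have /fintype.pred0P/(_ i)/= := dS; rewrite iS1 /= => ->; by [].
have [/existsP[u /andP[uS /eqP up]]|/existsPn no] :=
    boolP [exists u, (u \in S1) && (edge (e u) == p)].
  have -> : \prod_(i in S2 | edge (e i) == p) entry_sa i (e i) = 1.
    apply: big_pred0 => v; apply/negbTE/negP => /andP[vS /eqP vp].
    have [h1 h2] := ne u v uS vS.
    by case: (@edge_inj (e u) (e v)) => //; rewrite up vp.
  by rewrite Ex1 !mulr1.
have -> : \prod_(i in S1 | edge (e i) == p) entry_sa i (e i) = 1.
  by apply: big_pred0 => v; apply/negbTE; exact: no.
by rewrite Ex1 !mul1r.
Qed.

(* Splitting off the class of positions sharing an edge reduces the bound to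
   products over a single edge. *)
Lemma entry_moment_bound e (M r : R) : 1 <= M -> 0 <= r ->
  (forall S p, S != finset.set0 -> S \subset Ys -> (forall i, i \in S -> edge (e i) = p) ->
     `|entry_moment e S| <= (M * r ^+ #|S|)%:C) ->
  forall S : {set X}, S \subset Ys -> `|entry_moment e S| <= (M ^+ #|S| * r ^+ #|S|)%:C.
Proof.
move=> M1 r0 single S; have M0 : 0 <= M by exact: le_trans M1.
have [k] := ubnP #|S|; elim: k S => // k IH S; rewrite ltnS => Sk SY.
have [->|/finset.set0Pn[u uS]] := eqVneq S finset.set0.
  by rewrite entry_moment0 cards0 !expr0 mulr1 normr1.
pose S1 := finset (fun i => (i \in S) && (edge (e i) == edge (e u))).
have S1S : S1 \subset S by apply/fintype.subsetP => i; rewrite inE => /andP[].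
have uS1 : u \in S1 by rewrite inE uS eqxx.
have -> : S = S1 :|: (S :\: S1).
  by rewrite finset.setDE finset.setUIr finset.setUCr finset.setIT; apply/esym/finset.setUidPr.
have dS : fintype.disjoint (mem S1) (mem (S :\: S1)).
  by rewrite -finset.setI_eq0; apply/eqP/finset.setP => x; rewrite !inE; case: (x \in S); case: (_ == _).
have S2Y : S :\: S1 \subset Ys by exact: fintype.subset_trans (finset.subsetDl _ _) SY.
rewrite entry_momentM //; last 2 first.
- exact: fintype.subset_trans S1S SY.
- move=> x v; rewrite !inE => /andP[xS /eqP ex] /andP[+ vS]; rewrite vS /= => nv.
  by split=> E; move: nv; rewrite -ex E ?edge_arev eqxx.
have cS : #|S1 :|: (S :\: S1)| = (#|S1| + #|S :\: S1|)%N.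
  by rewrite cardsU disjoint_setI0 // cards0 subn0.
rewrite normrM cS !exprD mulrACA rmorphM /=.
apply: ler_pM => //.
  apply: (le_trans (single S1 (edge (e u)) _ _ _)).
  - by apply/finset.set0Pn; exists u.
  - exact: fintype.subset_trans S1S SY.
  - by move=> i; rewrite inE => /andP[_ /eqP].
  rewrite lecR ler_wpM2r ?exprn_ge0 //.
  rewrite -[X in X <= _]expr1 ler_weXn2l // card_gt0.
  by apply/finset.set0Pn; exists u.
apply: IH => //; apply: leq_trans Sk; apply: proper_card.
apply/fintype.properP; split; first exact: finset.subsetDl.
by exists u; rewrite // !inE uS eqxx.
Qed.
End EntryMoments.

(** * Words in the matrices Y and D *)

Section WordExpansion.
Context (d : measure_display) (T : measurableType d) (R : realType).
Variable P : probability T R.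
Local Notation C := R[i].
Local Notation L := (Linfty P).
Local Notation const := (const_Linfty P).

Lemma const_LinftyB : {morph const : x y / x - y}.
Proof. by move=> x y; apply/val_inj/funext. Qed.

Lemma const_LinftyM : GRing.monoid_morphism const.
Proof. by split=> [|x y]; apply/val_inj/funext. Qed.

HB.instance Definition _ := GRing.isZmodMorphism.Build C L const const_LinftyB.
HB.instance Definition _ := GRing.isMonoidMorphism.Build C L const const_LinftyM.

Lemma Ex_mul_const (f : L) (x : C) : Ex (f * const x) = Ex f * x.
Proof.
have -> : f * const x = x *: f by rewrite mulrC; apply/val_inj/funext.
by rewrite linearZ /= mulrC.
Qed.

Variables (n N : nat).
Local Notation X := 'I_n.
Local Notation idx := ('I_N.+1 * 'I_N.+1)%type.
Variables (Ys : {set X}) (entry : X -> idx -> L) (D : X -> 'rV[C]_N.+1).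

Definition random_letter (i : X) : 'M[L]_N.+1 :=
  if i \in Ys then \matrix_(p, q) entry i (p, q) else map_mx const (diag_mx (D i)).

(** A diagonal letter is written as a sum over the single index [x0], so that expanding a word runs
    exactly over the configurations [supported] on its random positions. *)
Lemma random_letter_sum i (x0 : idx) :
  random_letter i = \sum_(a | (i \in Ys) || (a == x0))
    (if i \in Ys then entry i a *: map_mx const (delta_mx a.1 a.2)
     else map_mx const (diag_mx (D i))).
Proof.
rewrite /random_letter; case: ifP => iY /=; last by rewrite big_pred1_eq.
rewrite [LHS]matrix_sum_delta pair_bigA /=; apply: eq_bigr => a _.
by rewrite mxE map_delta_mx -surjective_pairing.
Qed.

Lemma random_word_expansion (x0 : idx) (W : {set X}) :
  \prod_(i in W) random_letter i =
  \sum_(e | supported x0 (W :&: Ys) e)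
    (\prod_(i in W :&: Ys) entry i (e i)) *:
      map_mx const (\prod_(i in W) letter_mx Ys D e i).
Proof.
under eq_bigr => i _ do rewrite (random_letter_sum i x0).
rewrite (big_distr_big_dep x0); apply: eq_big => [e|e _].
  apply/familyP/forallP => eW i; move: (eW i); rewrite !inE /=.
    case: (i \in W); rewrite unfold_in /=; first by case: (i \in Ys).
    by [].
  case: ifP; rewrite unfold_in /= => iW; last by [].
  by rewrite -[e i \in _]/((i \in Ys) || (e i == x0)); case: (i \in Ys).
have -> : \prod_(i in W :&: Ys) entry i (e i) =
    \prod_(i in W) (if i \in Ys then entry i (e i) else 1).
  rewrite -big_mkcondr; apply: eq_bigl => i; by rewrite inE.
elim/big_rec3: _ => [|i A y B iW ->]; first by rewrite scale1r map_mx1.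
have mM (M1 M2 : 'M[C]_N.+1) : map_mx const (M1 * M2) = map_mx const M1 *m map_mx const M2.
  by rewrite -map_mxM.
rewrite mM /letter_mx; case: ifP => iY.
  rewrite -[LHS]/(_ *m _) -scalemxAl -scalemxAr scalerA.
  by [].
by rewrite -[LHS]/(_ *m _) -scalemxAr mul1r.
Qed.

Lemma Ex_random_word (x0 : idx) (W : {set X}) :
  \sum_p Ex ((\prod_(i in W) random_letter i) p p) =
  \sum_(e | supported x0 (W :&: Ys) e)
    entry_moment entry e (W :&: Ys) * word_tr Ys D e W.
Proof.
rewrite (random_word_expansion x0) -(linear_sum (@Ex d T R P)) /=.
under eq_bigr do rewrite summxE.
rewrite exchange_big /= linear_sum /=; apply: eq_bigr => e _.
rewrite /entry_moment /word_tr -Ex_mul_const /mxtrace rmorph_sum mulr_sumr /=.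
by congr Ex; apply: eq_bigr => p _; rewrite !mxE.
Qed.

End WordExpansion.

Section OperatorWords.
Context (d : measure_display) (T : measurableType d) (R : realType).
Variable P : probability T R.
Local Notation C := R[i].
Local Notation L := (Linfty P).
Variable N : nat.

Lemma LfnE (A : 'M[L]_N.+1) eta : Lfn A eta = A *m eta.
Proof. by apply/matrixP => i j; rewrite !mxE. Qed.

Lemma RfnE (A : 'M[L]_N.+1) eta : Rfn A eta = eta *m A.
Proof. by apply/matrixP => i j; rewrite !mxE; apply: eq_bigr => k _; rewrite mulrC. Qed.

(* A word of left and right multiplications applied to the identity matrix
   multiplies the left letters in order, then the right ones in reverse order. *)
Lemma LR_word_apply (Z : Type) (lft : Z -> bool) (M : Z -> 'M[L]_N.+1) (w : seq Z) eta :
  (\prod_(z <- w) (if lft z then Lop (M z) else Rop (M z)) : linop (Xmat P N.+1)) eta =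
  (\prod_(z <- [seq z <- w | lft z]) M z) *m eta *m
  (\prod_(z <- rev [seq z <- w | ~~ lft z]) M z).
Proof.
elim: w => [|z w IH]; first by rewrite /= !big_nil mul1mx mulmx1.
rewrite big_cons /=; case: (lft z) => /=.
  transitivity (M z *m ((\prod_(z <- w) (if lft z then Lop (M z) else Rop (M z)) : linop (Xmat P N.+1)) eta)).
    exact: LfnE.
  by rewrite IH big_cons !mulmxA.
transitivity (((\prod_(z <- w) (if lft z then Lop (M z) else Rop (M z)) : linop (Xmat P N.+1)) eta) *m M z).
  exact: RfnE.
by rewrite IH rev_cons big_rcons /= !mulmxA.
Qed.

Lemma trE_LR_word (Z : Type) (lft : Z -> bool) (M : Z -> 'M[L]_N.+1) (w : seq Z) :
  trE (\prod_(z <- w) (if lft z then Lop (M z) else Rop (M z))) =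
  N.+1%:R^-1 * \sum_i Ex ((\prod_(z <- [seq z <- w | lft z] ++ rev [seq z <- w | ~~ lft z]) M z) i i).
Proof.
rewrite /trE /ELX; congr (_ * _); apply: eq_bigr => i _; rewrite mxE LR_word_apply.
by rewrite mulmx1 big_cat.
Qed.
End OperatorWords.

(** Left positions upwards, then right positions downwards, is the order of [schi_seq], and it
    restricts to every subset. So the multiplication order of [trE_LR_word] is the natural order of
    the permuted word on each block, not only on the full word. *)
Lemma schi_word (n : nat) (chi : 'I_n -> bool) (W : {set 'I_n}) :
  [seq i <- enum (schi chi @: W) | chi i] ++
  rev [seq i <- enum (schi chi @: W) | ~~ chi i] =
  [seq schi chi k | k <- enum W].
Proof.
have sE : [seq schi chi k | k <- enum 'I_n] = schi_seq chi.
  have size_s : size (schi_seq chi) = n.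
    rewrite /schi_seq size_cat size_rev !size_filter count_predC.
    by rewrite size_enum_ord.
  have size_e : size [seq schi chi k | k <- enum 'I_n] = n by rewrite size_map size_enum_ord.
  have [n0|n0] := posnP n.
    by rewrite (size0nil (etrans size_e n0)) (size0nil (etrans size_s n0)).
  pose x0 := Ordinal n0; apply: (@eq_from_nth _ x0); first by rewrite size_e size_s.
  move=> i; rewrite size_e => ltin; rewrite (nth_map x0) ?size_enum_ord //.
  rewrite (_ : nth x0 (enum 'I_n) i = Ordinal ltin); last first.
    by apply/val_inj; rewrite /= nth_enum_ord.
  by rewrite permE /=; apply: set_nth_default; rewrite size_s.
have enumF (U : {set 'I_n}) : enum U = [seq i <- enum 'I_n | i \in U].
  by rewrite {1}/enum_mem -enumT.
rewrite (enumF W) (enumF (schi chi @: W)).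
have -> : [seq schi chi k | k <- [seq i <- enum 'I_n | i \in W]] =
    [seq i <- schi_seq chi | i \in schi chi @: W].
  rewrite -sE filter_map; congr map; apply: eq_filter => i /=.
  by rewrite mem_imset //; exact: perm_inj.
rewrite /schi_seq filter_cat filter_rev -!filter_predI.
congr (_ ++ rev _); apply: eq_filter => i /=; congr (_ && _); exact: andbC.
Qed.

(* A unital function m on words is the joint moment function of the operators
   (z . g)(w) = g (rcons w z) on the space of all functions of words, in the
   state f |-> (f m) [::]. *)
Section WordSpace.
Variables (R : realType) (Z : Type).
Local Notation C := R[i].

Definition word_fun : Type := seq Z -> C.
HB.instance Definition _ := GRing.Lmodule.on word_fun.

Definition word_alg : Type := linop word_fun.
HB.instance Definition _ := GRing.PzRing.on word_alg.
HB.instance Definition _ := GRing.Lmodule.on word_alg.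

Lemma word_alg_neq0 : (1 : word_alg) != 0.
Proof.
apply/eqP => /(congr1 (fun f : linop word_fun => f (fun=> 1) [::])) /eqP.
by rewrite /= oner_eq0.
Qed.

HB.instance Definition _ := GRing.PzSemiRing_isNonZero.Build word_alg word_alg_neq0.
HB.instance Definition _ :=
  GRing.LSemiModule_isLSemiAlgebra.Build C word_alg (@linop_scaleAl R word_fun).
HB.instance Definition _ :=
  GRing.LSemiAlgebra_isSemiAlgebra.Build C word_alg (@linop_scaleAr R word_fun).

Lemma append_linear (z : Z) :
  (fun (g : word_fun) w => g (rcons w z)) \in @linop_pred R word_fun.
Proof. by apply/linop_predP. Qed.

Definition append_op (z : Z) : word_alg := MkLinop (append_linear z).

Variables (m : word_fun) (m1 : m [::] = 1).

Definition word_state (f : word_alg) : C := (f : linop word_fun) m [::].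

Lemma word_state_is_scalar : scalar word_state.
Proof. by []. Qed.

HB.instance Definition _ :=
  GRing.isLinear.Build C word_alg C _ word_state word_state_is_scalar.

Definition word_space : ncps R := NCPS (ncps_alg := word_alg) (ncps_state := word_state) m1.

Lemma moment_word_space (w : seq Z) : moment (A := word_space) append_op w = m w.
Proof.
rewrite /moment -[RHS]/(m ([::] ++ w)) -[LHS]/((_ : linop word_fun) m [::]).
(* Generalized from the empty word to a prefix [v]: the outermost operator appends its letter to [v]
   before the remaining ones do. *)
elim: w [::] => [|z w IH] v; first by rewrite big_nil cats0.
by rewrite big_cons -cat_rcons -IH.
Qed.
End WordSpace.

Section TwoFacedWordSpace.
Variables (R : realType) (T : Type) (lx rx : T -> Type).
Local Notation letter := (letter lx rx).

Definition word_families (m : word_fun R letter) (m1 : m [::] = 1) (t : T) :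
    two_faced (word_space m1) (lx t) (rx t) :=
  TwoFaced (A := word_space m1) (fun i => append_op R (existT _ t (inl i)))
    (fun j => append_op R (existT _ t (inr j))).

Lemma element_word_families m m1 z :
  element (@word_families m m1) z = append_op R z.
Proof. by case: z => t []. Qed.
End TwoFacedWordSpace.

(** A positive element of R[i] is real, so real tolerances suffice; halving makes the inequality
    strict. *)
Lemma tendstoP (R : realType) (f : nat -> R[i]) (l : R[i]) :
  tendsto f l <-> ((fun N => f N : R[i]^o) @ \oo --> (l : R[i]^o)).
Proof.
split=> [fl|/(@cvgrPdist_lt R[i] R[i]^o) fl].
  apply/(@cvgrPdist_lt R[i] R[i]^o) => eps eps0.
  have [e0 E] : 0 < complex.Re eps /\ eps = (complex.Re eps)%:C.
    by case: eps eps0 => a b /=; rewrite ltcE /= => /andP[/eqP -> ->].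
  have [|N0 h] := fl (complex.Re eps / 2); first by rewrite divr_gt0.
  exists N0 => // N /= /h; rewrite distrC => le; apply: le_lt_trans le _.
  by rewrite E ltcR /= ltr_pdivrMr // ltr_pMr // ltr1n.
move=> eps e0; have [|N0 _ h] := fl eps%:C; first by rewrite ltcR.
by exists N0 => N /h /ltW; rewrite distrC.
Qed.

(** * Convergence of the words of the bi-matrix model *)

Section BiMatrixLimit.
Variables (R : realType) (d : measure_display) (Omega : measurableType d).
Variables (P : probability Omega R) (I J K K' : Type).
Variable c : K -> I + J -> I + J -> R.
Variable Y : forall N : nat, K -> I + J -> 'M[Linfty P]_N.+1.
Hypothesis Y_centered : forall N k l i j, Ex (Y N k l i j) = 0.
Hypothesis Y_selfadjoint : forall N k l i j,
  {ae P, forall t, Y N k l j i t = conjc (Y N k l i j t)}.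
Hypothesis Y_independent : forall N, independent_sets P
  (fun p : {p : 'I_N.+1 * 'I_N.+1 | (p.1 <= p.2)%N} =>
     [set f | exists l k, f = Y N k l (val p).1 (val p).2 :> (_ -> _)]).
Hypothesis Y_covariance : forall N k l1 l2 i j,
  Ex (Y N k l1 i j * Y N k l2 j i) = N.+1%:R^-1 * (c k l1 l2)%:C.
Hypothesis Y_covariance0 : forall N k1 k2 l1 l2 i j, k1 <> k2 ->
  Ex (Y N k1 l1 i j * Y N k2 l2 j i) = 0.
Hypothesis Y_moment_bound : forall m (chi : 'I_m -> I + J) (eps : 'I_m -> K),
  exists2 M : R, 0 < M & exists N0 : nat, forall N : nat, (N0 < N.+1)%N ->
    forall (i j : 'I_N.+1) (s : 'I_m -> bool), (i <= j)%N ->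
      `|Ex (\prod_(q < m) (if s q then Y N (eps q) (chi q) i j
                                  else Y N (eps q) (chi q) j i))|
        <= (M * N.+1%:R `^ (- (m%:R / 2)))%:C.
Variable D : forall N : nat, K' -> 'rV[R[i]]_N.+1.
Variables (A : ncps R) (a : K' -> A).
Hypothesis D_limit : cvg_joint_distr (fun N k' => diag_mx (D N k') : MXspace R N) a.
Hypothesis D_bounded : forall k', exists M : R, forall N i, `|D N k' 0 i| <= M%:C.

Local Notation C := R[i].
Local Notation L := (Linfty P).
Local Notation matrix_letter := (K * (I + J) + K')%type.

Definition letter_family (s : matrix_letter) : option K :=
  if s is inl (k, _) then Some k else None.

Definition letter_matrix N (s : matrix_letter) : 'M[L]_N.+1 :=
  match s with
  | inl (k, l) => Y N k l
  | inr k' => map_mx (const_Linfty P) (diag_mx (D N k'))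
  end.

Section FixedWord.
Variables (n : nat) (b : 'I_n -> matrix_letter).
Local Notation X := 'I_n.
Implicit Types (S V W : {set X}).

Definition random_positions : {set X} :=
  finset (fun i => if b i is inl _ then true else false).

(** The value 0 at diagonal letters is a placeholder: entries are read at random positions only. *)
Definition word_entry N (i : X) (x : 'I_N.+1 * 'I_N.+1) : L :=
  if b i is inl (k, l) then Y N k l x.1 x.2 else 0.

Definition word_diag N (i : X) : 'rV[C]_N.+1 := if b i is inr k' then D N k' else 0.

(** [K] is an arbitrary type, so equality of its labels is decided classically. *)
Definition letter_covariance (u v : X) : C :=
  match b u, b v with
  | inl (k, l), inl (k', l') => if `[< k = k' >] then (c k l l')%:C else 0
  | _, _ => 0
  end.

Local Notation Ys := random_positions.

Lemma random_letterE N i :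
  random_letter Ys (@word_entry N) (@word_diag N) i = letter_matrix N (b i).
Proof.
rewrite /random_letter inE /word_entry /word_diag /letter_matrix.
by case: (b i) => [[k l]|k'] //; apply/matrixP => p q; rewrite mxE.
Qed.

Local Notation family N := (fun p : {p : 'I_N.+1 * 'I_N.+1 | (p.1 <= p.2)%N} =>
  [set f | exists l k, f = Y N k l (val p).1 (val p).2 :> (Omega -> C)]).

Lemma family_Linfty N p f : family N p f -> in_Linfty P f.
Proof. by move=> [l [k ->]]; apply/Linfty_predP; exact: Linfty_funP. Qed.

Lemma word_entry_family N i (p : {p : 'I_N.+1 * 'I_N.+1 | (p.1 <= p.2)%N}) : i \in Ys ->
  family N p (word_entry i (val p)).
Proof.
rewrite inE /word_entry; case: (b i) => // -[k l] _.
by exists l, k.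
Qed.

Lemma word_entry_conj N i (x : 'I_N.+1 * 'I_N.+1) : i \in Ys ->
  {ae P, forall t, word_entry i (arev x) t = conjc (word_entry i x t)}.
Proof. by rewrite inE /word_entry; case: (b i) => // -[k l] _; exact: Y_selfadjoint. Qed.

Lemma word_moment1 N (e : X -> 'I_N.+1 * 'I_N.+1) u : u \in Ys ->
  entry_moment (@word_entry N) e [set u]%SET = 0.
Proof.
rewrite inE /entry_moment big_set1 /word_entry; case: (b u) => // -[k l] _.
exact: Y_centered.
Qed.

Lemma word_moment2 N (e : X -> 'I_N.+1 * 'I_N.+1) u v : u \in Ys -> v \in Ys ->
  (u < v)%N -> e v = arev (e u) ->
  entry_moment (@word_entry N) e [set u; v]%SET = N.+1%:R^-1 * letter_covariance u v.
Proof.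
move=> uY vY uv E; have nuv : u \notin [set v]%SET by rewrite inE neq_ltn uv.
rewrite /entry_moment big_setU1 // big_set1 E /word_entry /letter_covariance.
move: uY vY; rewrite !inE; case: (b u) => // -[k l] _; case: (b v) => // -[k' l'] _.
by case: asboolP => [<-|nk]; rewrite /= ?Y_covariance // Y_covariance0 // mulr0.
Qed.

Lemma sqrt_powR (m N : nat) :
  N.+1%:R `^ (- (m%:R / 2)) = (Num.sqrt N.+1%:R)^-1 ^+ m :> R.
Proof.
rewrite powRN mulrC powRrM powR12_sqrt ?ler0n // powR_mulrn ?sqrtr_ge0 //.
by rewrite exprVn.
Qed.

(** On a single edge every entry is x_ij or x_ji with the same i <= j, so the assumed moment bound
    of length [#|S|] applies. Its constants depend on [S], but not on the size, the walk or the
    edge. *)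
Lemma single_edge_bound S : exists MN : R * nat, 1 <= MN.1 /\
  forall N (e : X -> 'I_N.+1 * 'I_N.+1) p, (MN.2 <= N)%N -> S != finset.set0 ->
    S \subset Ys -> (forall i, i \in S -> edge (e i) = p) ->
    `|entry_moment (@word_entry N) e S| <= (MN.1 * (Num.sqrt N.+1%:R)^-1 ^+ #|S|)%:C.
Proof.
have [->|/finset.set0Pn[i0 i0S]] := eqVneq S finset.set0.
  by exists (1, 0%N); split=> // N e p _; rewrite eqxx.
have [SY|nSY] := boolP (S \subset Ys); last first.
  by exists (1, 0%N).
have := fintype.subsetP SY _ i0S; rewrite inE; case b0: (b i0) => [[k0 l0]|//] _.
(* [l0] and [k0] are placeholders: all positions of [S] are random. *)
pose chi (q : 'I_#|S|) := if b (enum_val q) is inl (k, l) then l else l0.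
pose eps (q : 'I_#|S|) := if b (enum_val q) is inl (k, l) then k else k0.
have [M M0 [N0 HM]] := Y_moment_bound chi eps.
exists (1 + M, N0); split; first by rewrite /= lerDl ltW.
move=> N e p /= N0N _ _ eS.
(* The matrices have size N + 1, so the strict condition on the size is [N0 <= N]. *)
have Np : (N0 < N.+1)%N by [].
have := HM N Np (val p).1 (val p).2 (fun q => e (enum_val q) == val p) (valP p).
rewrite sqrt_powR /entry_moment => h.
have r0 : 0 <= (Num.sqrt N.+1%:R : R)^-1 ^+ #|S|.
  by rewrite exprn_ge0 // invr_ge0 sqrtr_ge0.
have -> : \prod_(i in S) word_entry i (e i) =
    \prod_(q < #|S|) (if e (enum_val q) == val p then Y N (eps q) (chi q) (val p).1 (val p).2
                      else Y N (eps q) (chi q) (val p).2 (val p).1).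
  rewrite big_enum_val; apply: eq_bigr => q _; have qS := enum_valP q.
  have := fintype.subsetP SY _ qS; rewrite inE /word_entry /eps /chi.
  case: (b (enum_val q)) => [[k l]|//] _.
  have := congr1 val (eS _ qS); rewrite val_edge.
  case: ifP => _ E; first by rewrite E eqxx.
  by rewrite -E /=; case: eqP => [h1|//]; rewrite {1 2}h1.
by apply: le_trans h _; rewrite lecR ler_wpM2r // lerDr.
Qed.

(** There are finitely many sets of positions, so the sums of the constants of [single_edge_bound]
    serve for all of them; [entry_moment_bound] then multiplies over the edges. *)
Lemma word_moment_bound : exists (M : C) (N0 : nat), 0 <= M /\
  forall N (e : {ffun X -> 'I_N.+1 * 'I_N.+1}) S, (N0 <= N)%N -> S \subset Ys ->
    `|entry_moment (@word_entry N) e S| <= M * ((Num.sqrt N.+1%:R)%:C)^-1 ^+ #|S|.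
Proof.
have [MN HMN] := choice single_edge_bound.
pose M := 1 + \sum_(S : {set X}) (MN S).1.
pose N0 := (\sum_(S : {set X}) (MN S).2)%N.
have M0 S : 0 <= (MN S).1 by have [h _] := HMN S; exact: le_trans h.
have M1 : 1 <= M by rewrite lerDl sumr_ge0.
exists ((M ^+ n)%:C), N0; split; first by rewrite lecR exprn_ge0 // (le_trans _ M1).
move=> N e S N0N SY.
have r0 : 0 <= (Num.sqrt N.+1%:R : R)^-1 by rewrite invr_ge0 sqrtr_ge0.
have single S' p : S' != finset.set0 -> S' \subset Ys ->
    (forall i, i \in S' -> edge (e i) = p) ->
    `|entry_moment (@word_entry N) e S'| <= (M * (Num.sqrt N.+1%:R)^-1 ^+ #|S'|)%:C.
  move=> S'0 S'Y eS'; have [_ h] := HMN S'.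
  apply: le_trans (h N e p _ S'0 S'Y eS') _.
    by apply: leq_trans N0N; rewrite /N0 (bigD1 S') //= leq_addr.
  rewrite lecR ler_wpM2r ?exprn_ge0 // /M (bigD1 S') //= addrCA lerDl.
  by rewrite addr_ge0 // sumr_ge0.
have h := entry_moment_bound (@family_Linfty N) (@Y_independent N)
  (@word_entry_family N) (@word_entry_conj N) M1 r0 single SY.
apply: le_trans h _; rewrite -fmorphV -rmorphXn -rmorphM lecR ler_wpM2r ?exprn_ge0 //.
by rewrite ler_weXn2l // -[X in (_ <= X)%N](card_ord n) max_card.
Qed.

Lemma word_diag_bound : exists2 M : R, 1 <= M &
  forall N i x, i \notin Ys -> `|@word_diag N i 0 x| <= M%:C.
Proof.
have bnd i : exists M : R, 0 <= M /\ forall N x, `|@word_diag N i 0 x| <= M%:C.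
  rewrite /word_diag; case: (b i) => [_|k'].
    by exists 0; split=> // N x; rewrite mxE normr0.
  have [M HM] := D_bounded k'; exists M; split=> //.
  by rewrite -lecR; exact: le_trans (normr_ge0 _) (HM 0%N ord0).
have [M HM] := choice bnd; exists (1 + \sum_i M i).
  by rewrite lerDl sumr_ge0 // => i _; case: (HM i).
move=> N i x _; have [_ h] := HM i; apply: le_trans (h N x) _.
rewrite lecR (bigD1 i) //= addrCA lerDl addr_ge0 // sumr_ge0 // => j _.
by case: (HM j).
Qed.

Definition diag_word V : seq K' := pmap (fun i => if b i is inr k' then Some k' else None) (enum V).

Lemma diag_word_tendsto V : V \subset ~: Ys ->
  tendsto (fun N => N.+1%:R^-1 * \tr (\prod_(i in V) diag_mx (@word_diag N i)))
    (moment a (diag_word V)).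
Proof.
move=> /fintype.subsetP VD; have /tendstoP := D_limit (w := diag_word V).
apply: tendsto_ext => N; rewrite /moment /= /ntr; congr (_ * \tr _).
rewrite -big_enum_nc /diag_word.
have : forall i, i \in enum V -> i \notin Ys.
  by move=> i; rewrite mem_enum => /VD; rewrite inE.
elim: (enum V) => [|i s IH] sY; first by rewrite !big_nil.
have iY := sY i (mem_head _ _).
rewrite big_cons -IH; last by move=> j js; apply: sY; rewrite inE js orbT.
by move: iY; rewrite inE /word_diag /=; case: (b i) => // k' _; rewrite /= big_cons.
Qed.

(** [kap] is [mixed_kappa], with diagonal part from [NCsum_inversion]. On a mixed word the full set
    has weight 0: it contains both kinds of letters, or only random ones, and then it is not a pair
    or is a pair with distinct labels in [K] and zero covariance. *)
Lemma matrix_word_tendsto : exists kap : {set X} -> C,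
  (forall W, tendsto (fun N => N.+1%:R^-1 *
     \sum_p Ex ((\prod_(i in W) letter_matrix N (b i)) p p)) (NCsum kap W)) /\
  ((2 <= n)%N -> ~ (forall i j, letter_family (b i) = letter_family (b j)) ->
   kap finset.setT = 0).
Proof.
have [M [N0 [M0 HM]]] := word_moment_bound.
have [Kd Kd1 HK] := word_diag_bound.
pose tau V := if V == finset.set0 then 1 else moment a (diag_word V).
have [kD HkD] := @NCsum_inversion n C tau (ifT _ _ (eqxx _)).
have D_lim V : V \subset ~: Ys -> tendsto (fun N => N.+1%:R^-1 *
    \tr (\prod_(i in V) diag_mx (@word_diag N i))) (NCsum kD V).
  move=> VD; rewrite HkD /tau; case: eqP => [->|_]; last exact: diag_word_tendsto.
  apply: tendsto_ext (tendsto_cst 1) => N; rewrite big_set0 mxtrace1.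
  by apply/esym/mulVf; rewrite pnatr_eq0.
exists (mixed_kappa Ys letter_covariance kD); split=> [W|n2 mixed].
  have h : tendsto (fun N => N.+1%:R^-1 *
      \sum_(e | supported (ord0, ord0) (W :&: Ys) e)
        entry_moment (@word_entry N) e (W :&: Ys) * word_tr Ys (@word_diag N) e W)
      (NCsum (mixed_kappa Ys letter_covariance kD) W).
    apply: (moment_tendsto Kd1 HK D_lim
      (eps := fun N e S => entry_moment (@word_entry N) e S) _ M0).
    - by move=> N e; exact: entry_moment0.
    - by move=> N e; exact: (entry_momentM (@family_Linfty N) (@Y_independent N)
        (@word_entry_family N) (@word_entry_conj N)).
    - by move=> N e u; exact: word_moment1.
    - by move=> N e u v; exact: word_moment2.
    - exact: HM.
  apply: tendsto_ext h => N; congr (_ * _).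
  rewrite -(Ex_random_word _ _ _ (ord0, ord0)).
  suff -> : \prod_(i in W) random_letter Ys (@word_entry N) (@word_diag N) i =
      \prod_(i in W) letter_matrix N (b i) by [].
  by apply: eq_bigr => i _; exact: random_letterE.
rewrite /mixed_kappa; case: ifP => [/fintype.subsetP TD|_].
  case: mixed => i j; have := TD i (finset.in_setT i); have := TD j (finset.in_setT j).
  by rewrite !inE /letter_family; case: (b i) => // ?; case: (b j).
case: ifP => // _; apply: big1 => u _; apply: big1 => v /and3P[uv /eqP E _].
rewrite /letter_covariance; case bu: (b u) => [[k l]|//]; case bv: (b v) => [[k' l']|//].
case: asboolP => // kk'; case: mixed => i j.
have fam x : letter_family (b x) = Some k.
  have := finset.in_setT x; rewrite E !inE => /orP[]/eqP->; rewrite ?bu ?bv //=.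
  by rewrite kk'.
by rewrite !fam.
Qed.
End FixedWord.
End BiMatrixLimit.

(** * From permuted words to bi-free cumulants *)

Section Collapse.
Variables I J K K' : Type.

(** L(T) and R(T) have the same matrix T; the side of a letter is forgotten here and survives only
    in the permutation [schi]. *)
Definition underlying_matrix (z : letter (left_index I K' (K := K)) (right_index J K' (K := K))) :
    (K * (I + J) + K')%type :=
  let: existT t x := z in
  match t return (left_index I K' t + right_index J K' t)%type -> (K * (I + J) + K')%type with
  | Some k => fun x => inl (k, match x with inl i => inl i | inr j => inr j end)
  | None => fun x => inr (match x with inl k' => k' | inr k' => k' end)
  end x.

Lemma letter_family_underlying z : letter_family (underlying_matrix z) = projT1 z.
Proof. by case: z => -[k|] x. Qed.

Variables (R : realType) (d : measure_display) (Omega : measurableType d).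
Variables (P : probability Omega R).
Variable Y : forall N : nat, K -> I + J -> 'M[Linfty P]_N.+1.
Variable D : forall N : nat, K' -> 'rV[R[i]]_N.+1.

Local Notation fam N := (bimatrix_families (Y N) (fun k' => diag_mx (D N k'))).

Lemma element_bimatrix N z : element (fam N) z =
  if is_left_letter z then Lop (letter_matrix Y D N (underlying_matrix z))
  else Rop (letter_matrix Y D N (underlying_matrix z)).
Proof. by case: z => -[k|] []. Qed.

(** The mixed moment reads s(W) in the natural order, the trace reads the permuted word along [W]:
    moments over blocks of a bi-noncrossing partition become those over a noncrossing one. *)
Lemma moment_bimatrix N n (z : 'I_n -> letter (left_index I K' (K := K)) (right_index J K' (K := K)))
    (W : {set 'I_n}) (s := schi (fun i => is_left_letter (z i))) :
  moment (A := LXspace P N) (element (fam N)) [seq z i | i <- enum (s @: W)] =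
  N.+1%:R^-1 * \sum_p Ex ((\prod_(k in W) letter_matrix Y D N (underlying_matrix (z (s k)))) p p).
Proof.
rewrite /moment big_map /=.
under eq_bigr do rewrite element_bimatrix.
rewrite (trE_LR_word (fun i => is_left_letter (z i))
  (fun i => letter_matrix Y D N (underlying_matrix (z i)))).
by rewrite schi_word big_map big_enum_nc.
Qed.
End Collapse.

Lemma part_actK n (s : {perm 'I_n}) : cancel (part_act s) (part_act s^-1%g).
Proof.
move=> p; rewrite /part_act -imset_comp -[RHS]finset.imset_id; apply: eq_imset => V /=.
by rewrite -imset_comp -[RHS]finset.imset_id; apply: eq_imset => i /=; rewrite permK.
Qed.

(** [part_act] is injective, so the sum over [BNC] can be reindexed by [NC]; the Moebius factor then
    loses its permutation and the blocks acquire it. *)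
Lemma cumulant_NC (R : realType) (A : ncps R) n (chi : 'I_n -> bool) (x : 'I_n -> A) :
  cumulant chi x = \sum_(q in NC n)
    (\prod_(W in q) ncps_state A (\prod_(i in schi chi @: W) x i)) *
    (mobius (NC n) (@refines n) q (top_part n))%:~R.
Proof.
rewrite /cumulant /BNC big_imset /=; last by move=> p q _ _; exact: (can_inj (@part_actK n _)).
apply: eq_bigr => q _; rewrite part_actK; congr (_ * _).
rewrite /state_part big_imset //= => V W _ _; apply: imset_inj; exact: perm_inj.
Qed.

Theorem corollary2p8 (R : realType) (d : measure_display)
    (Omega : measurableType d) (P : probability Omega R)
    (I J K K' : Type)
    (c : K -> I + J -> I + J -> R)
    (c_posdef : forall k, posdef (fun i j => (c k i j)%:C))
    (Y : forall N : nat, K -> I + J -> 'M[Linfty P]_N.+1)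
    (Y_centered : forall N k l i j, Ex (Y N k l i j) = 0)
    (Y_selfadjoint : forall N k l i j,
       {ae P, forall t, Y N k l j i t = conjc (Y N k l i j t)})
    (Y_independent : forall N,
       independent_sets P
         (fun p : {p : 'I_N.+1 * 'I_N.+1 | (p.1 <= p.2)%N} =>
            [set f | exists l k, f = Y N k l (val p).1 (val p).2 :> (_ -> _)]))
    (Y_covariance : forall N k l1 l2 i j,
       Ex (Y N k l1 i j * Y N k l2 j i) = N.+1%:R^-1 * (c k l1 l2)%:C)
    (Y_covariance0 : forall N k1 k2 l1 l2 i j, k1 <> k2 ->
       Ex (Y N k1 l1 i j * Y N k2 l2 j i) = 0)
    (Y_moment_bound : forall m (chi : 'I_m -> I + J) (eps : 'I_m -> K),
       exists2 M : R, 0 < M & exists N0 : nat, forall N : nat, (N0 < N.+1)%N ->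
         forall (i j : 'I_N.+1) (s : 'I_m -> bool), (i <= j)%N ->
           `|Ex (\prod_(q < m) (if s q then Y N (eps q) (chi q) i j
                                       else Y N (eps q) (chi q) j i))|
             <= (M * N.+1%:R `^ (- (m%:R / 2)))%:C)
    (D : forall N : nat, K' -> 'rV[R[i]]_N.+1)
    (A : ncps R) (A_tracial : tracial A) (a : K' -> A)
    (D_limit : cvg_joint_distr
       (fun N k' => diag_mx (D N k') : MXspace R N) a)
    (D_bounded : forall k', exists M : R, forall N i, `|D N k' 0 i| <= M%:C) :
  asymptotically_bifree
    (fun N => bimatrix_families (Y N) (fun k' => diag_mx (D N k'))).
Proof.
pose letters := letter (left_index I K' (K := K)) (right_index J K' (K := K)).
pose mom N (w : seq letters) := moment (A := LXspace P N)
  (element (bimatrix_families (Y N) (fun k' => diag_mx (D N k')))) w.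
(* One [kap] serves the full word and all its subwords s(W), as Moebius inversion over the blocks
   requires. *)
have lim n (z : 'I_n -> letters) (s := schi (fun i => is_left_letter (z i))) :
    exists kap : {set 'I_n} -> R[i],
    (forall W : {set 'I_n}, tendsto (mom ^~ [seq z i | i <- enum (s @: W)]) (NCsum kap W)) /\
    ((2 <= n)%N -> ~ (forall i j, projT1 (z i) = projT1 (z j)) -> kap finset.setT = 0).
  have [kap [kapW kap0]] := matrix_word_tendsto Y_centered Y_selfadjoint Y_independent
    Y_covariance Y_covariance0 Y_moment_bound D_limit D_bounded
    (fun k => underlying_matrix (z (s k))).
  exists kap; split=> [W|n2 mixed].
    by apply: tendsto_ext (kapW W) => N; rewrite /mom moment_bimatrix.
  apply: kap0 => // same; apply: mixed => i j.
  by have := same (s^-1%g i) (s^-1%g j); rewrite !letter_family_underlying !permKV.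
(* Any word is the full subword of its own letters, since s maps the full set of positions onto
   itself. *)
have exlim (w : seq letters) : exists l, tendsto (mom ^~ w) l.
  have [kap [kapW _]] := lim _ (tnth (in_tuple w)).
  exists (NCsum kap finset.setT); have := kapW finset.setT.
  set s := schi _; have -> : s @: finset.setT = finset.setT.
    by apply/finset.setP => i; rewrite !inE -(permKV s i) imset_f.
  have -> // : [seq tnth (in_tuple w) i | i <- enum (finset.setT : {set 'I_(size w)})] = w.
  by rewrite enum_setT -enumT map_tnth_enum.
(* The limits of all words form the moment function from which the limit space is built. *)
have [m mE] := choice exlim.
have m1 : m [::] = 1.
  apply: tendsto_unique (mE [::]) _; apply: tendsto_ext (tendsto_cst 1) => N.
  by rewrite /mom /moment big_nil ncps_state1.
exists (word_space m1), (word_families m1); split=> [w|n z n2 mixed].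
  apply/tendstoP; have -> : moment (element (word_families m1)) w = m w.
    rewrite -(moment_word_space m1); congr (ncps_state _ _); apply: eq_bigr => z _.
    exact: element_word_families.
  exact: mE.
rewrite cumulant_NC; have [kap [kapW kap0]] := lim n z.
(* By uniqueness of limits the moments of the limit over the blocks s(W) are [NCsum kap W], so its
   cumulant is [kap] of the full set. *)
apply: etrans (kap0 n2 mixed); rewrite -mobius_inversion_NC; last exact: leq_trans n2.
apply: eq_bigr => q _; congr (_ * _); apply: eq_bigr => W _.
apply: tendsto_unique (kapW W); rewrite -big_enum_nc.
set s := schi _; set w := [seq z i | i <- enum (s @: W)].
suff -> : ncps_state (word_space m1) (\prod_(i <- enum (s @: W)) element (word_families m1) (z i)) = m w.
  exact: mE.
rewrite -(moment_word_space m1) /moment /w big_map; congr (ncps_state _ _).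
by apply: eq_bigr => i _; exact: element_word_families.
Qed.
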